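(* Let $\ell\ge 0$, $\beta\in\mathbb{R}$ and $\gamma>\max\{0,-\frac{\beta}{4\pi^2}\}$. Let $T,\tau>0$. There exist $\delta>0$, with $\delta$ independent of $\tau$, and $C>0$ such that the following holds. If $\phi\in H^{\ell}_{per,0}$ and $f\in L^\infty([0,\infty);H^{\ell}_{per,0})$ (so that $\langle f(t)\rangle=0$ for all $t\ge 0$) satisfy $$\|\phi\|_{H^{\ell}_{per,0}}+\|f\|_{L^{\infty}([0,\infty);H^{\ell}_{per,0})}\le\delta,$$ then there exists a unique $u\in L^\infty\cap L^2([\tau,\tau+T];H^{\ell}_{per,0})$ such that $u$ is a mild solution of $$u_t+u_x-u_{xxt}+uu_x+\beta u-\gamma u_{xx}=f(x,t)\ \text{ on }\mathbb{T}\times[0,\infty),\qquad u(x,0)=\phi(x),$$ and it satisfies $$\|u\|_{Y^{\ell}_{\tau,T}}\le C\big(\|\phi\|_{H^{\ell}_{per,0}}+\|f\|_{L^{\infty}([0,\infty);H^{\ell-2}_{per,0})}\big).$$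
   Context: $\mathbb{T}=\mathbb{R}/\mathbb{Z}$ and $\Delta=\partial_x^2$. For $\ell\in\mathbb{R}$, $H^\ell_{per}$ is the space of 1-periodic distributions $g$ with $\|g\|_{H^\ell_{per}}=\big(\sum_{k\in\mathbb{Z}}(1+(2\pi k)^2)^\ell|\widehat g(k)|^2\big)^{1/2}<\infty$, where $\widehat g(k)=\int_0^1 e^{-2\pi i kx}g(x)\,dx$. We write $\langle g\rangle=\int_{\mathbb{T}}g\,dx=\widehat g(0)$; $H^\ell_{per,0}$ is the subspace of $g\in H^\ell_{per}$ with $\langle g\rangle=0$, with the same norm. For $\tau\ge0$, $T>0$, $$\|u\|_{Y^\ell_{\tau,T}}=\sup_{\tau\le s\le\tau+T}\|u(s)\|_{H^\ell_{per}}+\Big(\int_\tau^{\tau+T}\|u(s)\|_{H^\ell_{per}}^2ds\Big)^{1/2}.$$ Let $Av=(I-\Delta)^{-1}(-v_x-\beta v+\gamma v_{xx})$, which generates a $C_0$-semigroup $e^{At}$ on $H^\ell_{per,0}$. A mild solution of the initial value problem is a function $u$ with $u(t)\in H^\ell_{per,0}$ and $$u(t)=e^{At}\phi+\int_0^t e^{A(t-s)}(I-\Delta)^{-1}\big[f(s)-u(s)u_x(s)\big]ds,\qquad t\ge0,$$ where $uu_x$ means $\tfrac12\partial_x(u^2)$; the membership in $L^\infty\cap L^2([\tau,\tau+T];H^\ell_{per,0})$ refers to its restriction to $[\tau,\tau+T]$. The constant $C$ does not depend on $\phi,f,u$. *)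

(* Defs.v *)
From HB Require Import structures.
From mathcomp Require Import all_boot all_order all_algebra.
From mathcomp Require Import ring lra.
From mathcomp Require Import complex.
From mathcomp Require Import all_classical all_reals all_analysis.
From mathcomp Require Import ess_sup_inf.

Set Implicit Arguments.
Unset Strict Implicit.
Unset Printing Implicit Defensive.

Import Order.TTheory GRing.Theory Num.Theory.
Import numFieldNormedType.Exports.

Local Open Scope classical_set_scope.
Local Open Scope ring_scope.
Local Open Scope complex_scope.

Section Periodic.
Context {R : realType}.

Local Notation mu := (@lebesgue_measure R).
Local Notation Re := complex.Re.
Local Notation Im := complex.Im.

Definition cexp (z : R[i]) : R[i] :=
  (expR (Re z) * cos (Im z)) +i* (expR (Re z) * sin (Im z)).

Definition sqnormc (z : R[i]) : R := Re z ^+ 2 + Im z ^+ 2.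

Definition cintegral (D : set R) (g : R -> R[i]) : R[i] :=
  Rintegral mu D (fun x => Re (g x)) +i* Rintegral mu D (fun x => Im (g x)).

(* A 1-periodic distribution is represented by the sequence of its Fourier
   coefficients, and an integrable 1-periodic function g : R -> R[i] is seen as
   the distribution [fcoef g].  For ell >= 0 all elements of H^ell_per are
   square-integrable functions. *)
Definition pdist := int -> R[i].

Definition freq (k : int) : R := 2 * pi * k%:~R.

Definition fcoef (g : R -> R[i]) : pdist := fun k =>
  cintegral `[0, 1] (fun x => cexp (0 +i* - (freq k * x)) * g x).

Definition Hnorm (ell : R) (c : pdist) : \bar R :=
  ((\esum_(k in [set: int])
      ((1 + freq k ^+ 2) `^ ell * sqnormc (c k))%:E) `^ 2^-1)%E.

(* H^ell_{per,0}; the mean is the zeroth coefficient, see [fcoef0]. *)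
Definition Hdist0 (ell : R) : set pdist :=
  [set c | (Hnorm ell c < +oo)%E /\ c 0 = 0].

Definition Hper0 (ell : R) : set (R -> R[i]) :=
  [set g | [/\ forall x, g (x + 1) = g x,
      mu.-integrable `[0, 1] (fun x => (Re (g x))%:E),
      mu.-integrable `[0, 1] (fun x => (Im (g x))%:E) &
      Hdist0 ell (fcoef g)]].

Record simple_fun (ell : R) := SimpleFun {
  sf_size : nat;
  sf_set : 'I_sf_size -> set (measurableTypeR R);
  sf_coef : 'I_sf_size -> pdist;
  sf_measurable : forall j, measurable (sf_set j);
  sf_finite : forall j, (mu (sf_set j) < +oo)%E;
  sf_Hdist0 : forall j, Hdist0 ell (sf_coef j) }.

Definition sf_val ell (s : simple_fun ell) (t : R) : pdist := fun k =>
  \sum_j (\1_(sf_set (s := s) j) t)%:C * sf_coef j k.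

Definition sf_integral ell (D : set R) (s : simple_fun ell) : pdist := fun k =>
  \sum_j (fine (mu (sf_set (s := s) j `&` D)))%:C * sf_coef j k.

Definition ae_approx ell (D : set R) (F : R -> pdist)
    (s : nat -> simple_fun ell) : Prop :=
  {ae mu, forall t, D t ->
    (fun n => Hnorm ell (F t \- sf_val (s n) t)) @ \oo --> 0%E}.

Definition strongly_measurable ell (D : set R) (F : R -> pdist) : Prop :=
  exists s : nat -> simple_fun ell, ae_approx D F s.

Definition is_bochner_integral ell (D : set R) (F : R -> pdist) (w : pdist) :
    Prop :=
  exists s : nat -> simple_fun ell,
    [/\ ae_approx D F s,
        (fun n => \int[mu]_(t in D) Hnorm ell (F t \- sf_val (s n) t)%R)%E
          @ \oo --> 0%E &
        (fun n => Hnorm ell (w \- sf_integral D (s n))) @ \oo --> 0%E].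

(* The zero extension outside D does not change the essential supremum over D,
   as Hnorm is nonnegative. *)
Definition Linfty_norm ell (D : set R) (F : R -> pdist) : \bar R :=
  ess_sup mu ((fun t => Hnorm ell (F t)) \_ D).

Definition L2_norm ell (D : set R) (F : R -> pdist) : \bar R :=
  ((\int[mu]_(t in D) (Hnorm ell (F t) ^+ 2)) `^ 2^-1)%E.

Definition in_Linfty ell (D : set R) (F : R -> pdist) : Prop :=
  strongly_measurable ell D F /\ (Linfty_norm ell D F < +oo)%E.

Definition in_L2 ell (D : set R) (F : R -> pdist) : Prop :=
  strongly_measurable ell D F /\ (L2_norm ell D F < +oo)%E.

Definition Ynorm (ell tau T : R) (F : R -> pdist) : \bar R :=
  (ereal_sup [set Hnorm ell (F s) | s in `[tau, (tau + T)%R]] +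
   L2_norm ell `[tau, (tau + T)%R] F)%E.

Definition ddx (c : pdist) : pdist := fun k => (0 +i* freq k) * c k.

(* (I - Delta)^{-1} *)
Definition resolvent (c : pdist) : pdist := fun k =>
  ((1 + freq k ^+ 2)^-1)%:C * c k.

Definition opA (beta gamma : R) (v : pdist) : pdist :=
  resolvent (fun k =>
    - ddx v k - beta%:C * v k + gamma%:C * ddx (ddx v) k).

(* A is the Fourier multiplier with symbol [symA], see [opAE]. *)
Definition symA (beta gamma : R) : pdist := opA beta gamma (fun=> 1).

(* The semigroup e^{At}, see [expA_C0_semigroup]. *)
Definition expA (beta gamma t : R) (v : pdist) : pdist := fun k =>
  cexp (t%:C * symA beta gamma k) * v k.

(* u u_x = (u^2)_x / 2 in the sense of distributions *)
Definition convection (u : R -> R[i]) : pdist := fun k =>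
  2^-1 * ddx (fcoef (fun x => u x ^+ 2)) k.

Definition mild_solution (ell beta gamma : R) (phi : R -> R[i])
    (f u : R -> R -> R[i]) : Prop :=
  forall t, 0 <= t -> Hper0 ell (u t) /\
    exists2 w : pdist,
      is_bochner_integral ell `[0, t]
        (fun s => expA beta gamma (t - s)
           (resolvent (fcoef (f s) \- convection (u s)))) w &
      forall k, fcoef (u t) k = expA beta gamma t (fcoef phi) k + w k.

(* S is a C_0-semigroup on H^ell_{per,0} whose generator is the everywhere
   defined operator A. *)
Definition C0_semigroup_generated_by (ell : R) (S : R -> pdist -> pdist)
    (A : pdist -> pdist) : Prop :=
  [/\ forall t, 0 <= t -> exists M : R, forall v, Hdist0 ell v ->
        Hdist0 ell (S t v) /\ (Hnorm ell (S t v) <= M%:E * Hnorm ell v)%E,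
      forall t (a : R[i]) v w,
        S t (fun k => a * v k + w k) = (fun k => a * S t v k + S t w k),
      (forall v, S 0 v = v) /\
        (forall s t v, 0 <= s -> 0 <= t -> S (s + t) v = S s (S t v)),
      forall v, Hdist0 ell v ->
        Hnorm ell (S t v \- v) @[t --> 0^'+] --> 0%E &
      forall v, Hdist0 ell v ->
        Hnorm ell ((fun k => (t^-1)%:C * (S t v k - v k)) \- A v)
          @[t --> 0^'+] --> 0%E].

Lemma sqnormcM (z w : R[i]) : sqnormc (z * w) = sqnormc z * sqnormc w.
Proof. by case: z w => [a b] [c d]; rewrite /sqnormc /=; ring. Qed.

Lemma sqnormc_ge0 (z : R[i]) : 0 <= sqnormc z.
Proof. by rewrite addr_ge0 ?sqr_ge0. Qed.

Lemma Hnorm_le (ell M : R) (c d : pdist) : 0 <= M ->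
  (forall k, sqnormc (c k) <= M ^+ 2 * sqnormc (d k)) ->
  (Hnorm ell c <= M%:E * Hnorm ell d)%E.
Proof.
move=> M0 cd; rewrite /Hnorm.
set a := fun k => ((1 + freq k ^+ 2) `^ ell * sqnormc (c k))%:E.
set b := fun k => ((1 + freq k ^+ 2) `^ ell * sqnormc (d k))%:E.
have a0 k : (0 <= a k)%E by rewrite lee_fin mulr_ge0 ?powR_ge0 ?sqnormc_ge0.
have b0 k : (0 <= b k)%E by rewrite lee_fin mulr_ge0 ?powR_ge0 ?sqnormc_ge0.
have ea0 : (0 <= \esum_(k in [set: int]) a k)%E by apply: esum_ge0.
have eb0 : (0 <= \esum_(k in [set: int]) b k)%E by apply: esum_ge0.
have ab : (\esum_(k in [set: int]) a k <=
    (M ^+ 2)%:E * \esum_(k in [set: int]) b k)%E.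
  apply: ge_ereal_sup => _ [X [fX _] <-].
  apply: (@le_trans _ _ ((M ^+ 2)%:E * \sum_(k \in X) b k)%E).
    rewrite ge0_mule_fsumr//; apply: lee_fsum => // k _.
    by rewrite lee_fin mulrCA ler_wpM2l ?powR_ge0.
  apply: lee_wpmul2l; first by rewrite lee_fin sqr_ge0.
  by apply: ereal_sup_ubound; exists X.
have -> : M%:E = ((M ^+ 2)%:E `^ 2^-1)%E.
  by rewrite poweR_EFin powR12_sqrt ?sqr_ge0// sqrtr_sqr ger0_norm.
rewrite -poweRM ?lee_fin ?sqr_ge0//.
apply: gt0_ler_poweR => //; rewrite ?in_itv/= ?leey ?andbT//.
by rewrite mule_ge0 ?lee_fin ?sqr_ge0.
Qed.

Lemma norm_le_MVT (g dg : R -> R) (M y : R) :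
  (forall x : R, is_derive x (1 : R) g (dg x)) ->
  (forall x : R, `|x| <= `|y| -> `|dg x| <= M) ->
  `|g y - g 0| <= M * `|y|.
Proof.
move=> dgP gM.
have gc (x : R) : {for x, continuous g}.
  by apply/differentiable_continuous/derivable1_diffP; apply: ex_derive.
have gcW A : {within A, continuous g} by apply: continuous_subspaceT.
have [y0|y0] := leP 0 y.
  have [c + ->] := MVT_segment y0 (fun x _ => dgP x) (gcW _).
  rewrite in_itv/= => /andP[c0 cy]; rewrite subr0 normrM ler_wpM2r//.
  by apply: gM; rewrite !ger0_norm.
have [c + /eqP] := MVT_segment (ltW y0) (fun x _ => dgP x) (gcW _).
rewrite in_itv/= => /andP[cy c0]; rewrite distrC => /eqP ->.
rewrite sub0r normrM normrN ler_wpM2r//.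
by apply: gM; rewrite !ler0_norm ?lerN2// ltW.
Qed.

Lemma norm_sin_le (y : R) : `|sin y| <= `|y|.
Proof.
have := @norm_le_MVT sin cos 1 y (fun x => is_derive_sin x)
  (fun x _ => cos_max x).
by rewrite sin0 subr0 mul1r.
Qed.

Lemma norm_cosB1_le (y : R) : `|cos y - 1| <= `|y| * `|y|.
Proof.
have := @norm_le_MVT cos (fun x => - sin x) `|y| y (fun x => is_derive_cos x).
rewrite cos0; apply => x xy.
by rewrite normrN (le_trans (norm_sin_le x)).
Qed.

Lemma norm_sinBid_le (y : R) : `|y| <= 1 -> `|sin y - y| <= `|y| * `|y|.
Proof.
move=> y1.
have := @norm_le_MVT (fun x => sin x - x) (fun x => cos x - 1) `|y| y.
rewrite sin0 !subr0; apply => x xy.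
apply: le_trans (norm_cosB1_le x) _.
rewrite -[leRHS]mul1r ler_pM// (le_trans xy)//.
Qed.

Lemma norm_expRB1_le (x : R) : `|expR x - 1| <= `|x| * expR `|x|.
Proof.
have h1 := expR_ge1Dx x.
have h2 : 1 - x <= expR (- x) by rewrite expR_ge1Dx.
have h3 : expR x * (1 - x) <= 1.
  by rewrite -[leRHS](expRxMexpNx_1 x) ler_wpM2l ?expR_ge0.
have h4 := expR_ge0 x.
have [x0|x0] := leP 0 x.
  rewrite ger0_norm ?ger0_norm//; nra.
rewrite !ler0_norm; [|lra|nra].
have : 1 <= expR (- x) by lra.
nra.
Qed.

Lemma norm_expRB1Bid_le (x : R) : `|expR x - 1 - x| <= `|x| * `|x| * expR `|x|.
Proof.
have h1 := expR_ge1Dx x.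
have h2 : 1 - x <= expR (- x) by rewrite expR_ge1Dx.
have h3 : expR x * (1 - x) <= 1.
  by rewrite -[leRHS](expRxMexpNx_1 x) ler_wpM2l ?expR_ge0.
have h4 := expR_ge0 x.
have h5 := norm_expRB1_le x.
rewrite ger0_norm; last by lra.
apply: (@le_trans _ _ (x * (expR x - 1))); first by lra.
by rewrite (le_trans (ler_norm _))// normrM -mulrA ler_wpM2l.
Qed.

Lemma sqnormcD_le (z w : R[i]) :
  sqnormc (z + w) <= 2 * sqnormc z + 2 * sqnormc w.
Proof.
case: z w => [a b] [c d]; rewrite /sqnormc /= -subr_ge0.
rewrite [leRHS](_ : _ = (a - c) ^+ 2 + (b - d) ^+ 2); last by ring.
by rewrite addr_ge0 ?sqr_ge0.
Qed.

Lemma cexpD (z w : R[i]) : cexp (z + w) = cexp z * cexp w.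
Proof.
case: z w => [a b] [c d]; apply/eqP; rewrite eq_complex/= expRD cosD sinD.
by apply/andP; split; apply/eqP; ring.
Qed.

Lemma ReCM (t : R) (z : R[i]) : Re (t%:C * z) = t * Re z.
Proof. by case: z => a b; rewrite /= mul0r subr0. Qed.

Lemma cexp0 : cexp 0 = 1.
Proof. by rewrite /cexp/= expR0 cos0 sin0 mul1r mulr0. Qed.

Lemma fcoef0 (g : R -> R[i]) : fcoef g 0 = cintegral `[0, 1] g.
Proof.
congr cintegral; apply/funext => x.
by rewrite /freq mulr0 mul0r oppr0 cexp0 mul1r.
Qed.

Lemma sqnormc_cexp (z : R[i]) : sqnormc (cexp z) = expR (Re z) ^+ 2.
Proof. by rewrite /sqnormc/= !exprMn -mulrDr cos2Dsin2 mulr1. Qed.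

Lemma cexp_taylor (L t : R) (a : R[i]) : 1 <= L -> 0 <= t -> t * L <= 1 ->
  `|Re a| <= L -> `|Im a| <= L ->
  sqnormc (cexp (t%:C * a) - 1 - t%:C * a) <= (4 * expR 1 * L ^+ 2 * t ^+ 2) ^+ 2.
Proof.
case: a => p q L1 t0 tL /= pL qL.
set x := t * p; set y := t * q; set e := expR 1; set s := t * L.
have e1 : 1 <= e by have := expR_ge1Dx (1 : R); rewrite -/e; lra.
have e0 : 0 <= e by lra.
have L0 : 0 <= L by lra.
have xs : `|x| <= s by rewrite normrM (ger0_norm t0) ler_wpM2l.
have ys : `|y| <= s by rewrite normrM (ger0_norm t0) ler_wpM2l.
have s0 : 0 <= s by rewrite (le_trans _ xs).
have xe : expR `|x| <= e by rewrite ler_expR (le_trans xs).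
have ex : expR x <= e by rewrite ler_expR (le_trans (ler_norm _))// (le_trans xs).
have sqs (u v : R) : `|u| <= s -> `|v| <= s -> `|u| * `|v| <= s ^+ 2.
  by move=> us vs; rewrite expr2 ler_pM.
have h1 : `|expR x * cos y - 1 - x| <= 2 * e * s ^+ 2.
  have -> : expR x * cos y - 1 - x =
    expR x * (cos y - 1) + (expR x - 1 - x) by ring.
  apply: le_trans (ler_normD _ _) _.
  have -> : 2 * e * s ^+ 2 = e * s ^+ 2 + s ^+ 2 * e by ring.
  apply: lerD.
    rewrite normrM ger0_norm ?expR_ge0//.
    by rewrite ler_pM ?expR_ge0// (le_trans (norm_cosB1_le y))// sqs.
  apply: le_trans (norm_expRB1Bid_le x) _.
  by rewrite ler_pM ?mulr_ge0 ?expR_ge0// sqs.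
have h2 : `|expR x * sin y - y| <= 2 * e * s ^+ 2.
  have -> : expR x * sin y - y = (expR x - 1) * sin y + (sin y - y) by ring.
  apply: le_trans (ler_normD _ _) _.
  have -> : 2 * e * s ^+ 2 = e * s ^+ 2 + e * s ^+ 2 by ring.
  apply: lerD.
    rewrite normrM (@le_trans _ _ ((`|x| * expR `|x|) * `|y|))//.
      by rewrite ler_pM ?norm_expRB1_le ?norm_sin_le.
    by rewrite mulrAC mulrC ler_pM ?mulr_ge0 ?expR_ge0// sqs.
  apply: le_trans (norm_sinBid_le _) _; first by rewrite (le_trans ys).
  apply: (@le_trans _ _ (s ^+ 2)); first by rewrite sqs.
  by rewrite ler_peMl ?sqr_ge0.
have -> : 4 * e * L ^+ 2 * t ^+ 2 = 4 * e * s ^+ 2 by rewrite /s; ring.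
set B := 2 * e * s ^+ 2 in h1 h2 *.
have -> : 4 * e * s ^+ 2 = 2 * B by rewrite /B; ring.
have B0 : 0 <= B by rewrite (le_trans _ h1).
rewrite /sqnormc/= !mul0r !subr0 !addr0 -/x -/y.
have -> : (2 * B) ^+ 2 = B ^+ 2 + B ^+ 2 + 2 * B ^+ 2 by ring.
rewrite -[leLHS]addr0 lerD ?mulr_ge0 ?sqr_ge0//.
by rewrite lerD// -[leLHS]real_normK ?num_real// ler_sqr ?nnegrE.
Qed.

Lemma opAE (beta gamma : R) (v : pdist) k :
  opA beta gamma v k = symA beta gamma k * v k.
Proof. by rewrite /symA /opA /resolvent /ddx; ring. Qed.

Lemma symA_le (beta gamma : R) k :
  `|Re (symA beta gamma k)| <= 1 + `|beta| + `|gamma| /\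
  `|Im (symA beta gamma k)| <= 1 + `|beta| + `|gamma|.
Proof.
rewrite /symA /opA /resolvent /ddx; move: (freq k) => w.
have w0 : 0 < 1 + w ^+ 2 by rewrite ltr_pwDl ?sqr_ge0.
rewrite (_ : _ * _ =
    (- ((beta + gamma * w ^+ 2) / (1 + w ^+ 2))) +i* (- (w / (1 + w ^+ 2))));
  last by apply/eqP; rewrite eq_complex/=; apply/andP; split; apply/eqP; ring.
rewrite /= !normrN !normrM !normfV !(gtr0_norm w0) !ler_pdivrMr//; split.
  apply: le_trans (ler_normD _ _) _; rewrite normrM (ger0_norm (sqr_ge0 w)).
  have := normr_ge0 beta; have := normr_ge0 gamma; have := sqr_ge0 w; nra.
apply: (@le_trans _ _ (1 + w ^+ 2)); last first.
  by rewrite ler_peMl ?(ltW w0)// -addrA lerDl addr_ge0.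
rewrite -[w ^+ 2]real_normK ?num_real//.
by have := normr_ge0 w; have := sqr_ge0 (`|w| - 1); nra.
Qed.

Lemma cvg_Hnorm0 (ell K : R) (v : pdist) (F : R -> pdist) : 0 <= K ->
  Hdist0 ell v ->
  (\forall t \near 0^'+, forall k,
     sqnormc (F t k) <= (K * t) ^+ 2 * sqnormc (v k)) ->
  Hnorm ell (F t) @[t --> 0^'+] --> 0%E.
Proof.
move=> K0 [vfin _] Fle.
have Hv0 : (0 <= Hnorm ell v)%E by rewrite poweR_ge0.
have : (K * t * fine (Hnorm ell v))%:E @[t --> 0^'+] --> 0%E.
  have h : continuous (fun t : R => K * t * fine (Hnorm ell v)).
    move=> t; apply: cvgMl; apply: cvgMr; exact: cvg_id.
  apply: cvg_EFin; first exact: nearW.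
  have := cvg_at_right_filter (h 0); rewrite mulr0 mul0r; exact.
apply: squeeze_cvge; last exact: cvg_cst.
near=> t; rewrite poweR_ge0/= EFinM fineK ?ge0_fin_numE//.
by apply: Hnorm_le; [rewrite mulr_ge0// ltW//; near: t; exact: nbhs_right_gt|near: t].
Unshelve. all: by end_near. Qed.

Lemma expA_C0_semigroup (ell beta gamma : R) :
  C0_semigroup_generated_by ell (expA beta gamma) (opA beta gamma).
Proof.
set L := 1 + `|beta| + `|gamma|.
have L1 : 1 <= L by rewrite /L -addrA lerDl addr_ge0.
have L0 : 0 <= L by lra.
have aL k := symA_le beta gamma k; rewrite -/L in aL.
set K := 4 * expR 1 * L ^+ 2.
have K0 : 0 <= K by rewrite !mulr_ge0 ?expR_ge0.
have smallt : \forall t \near (0 : R)^'+, 0 < t /\ t * L <= 1.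
  near=> t; split; first by near: t; exact: nbhs_right_gt.
  rewrite -ler_pdivlMr ?(lt_le_trans _ L1)//.
  near: t; apply: nbhs_right_le; rewrite divr_gt0//; lra.
have taylor t k : 0 < t -> t * L <= 1 ->
    sqnormc (cexp (t%:C * symA beta gamma k) - 1 - t%:C * symA beta gamma k)
      <= (K * t ^+ 2) ^+ 2.
  move=> t0 tL; have [h1 h2] := aL k.
  exact: cexp_taylor L1 (ltW t0) tL h1 h2.
split.
- move=> t t0; exists (expR (t * L)) => v [vfin v0].
  have le : (Hnorm ell (expA beta gamma t v) <=
      (expR (t * L))%:E * Hnorm ell v)%E.
    apply: Hnorm_le; first exact: expR_ge0.
    move=> k; rewrite sqnormcM sqnormc_cexp ler_wpM2r ?sqnormc_ge0//.
    rewrite ler_sqr ?nnegrE ?expR_ge0// ler_expR.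
    have [h1 _] := aL k.
    rewrite ReCM ler_wpM2l// (le_trans (ler_norm _))//.
  split=> //; split; last by rewrite /expA v0 mulr0.
  by rewrite (le_lt_trans le)// lte_mul_pinfty// lee_fin expR_ge0.
- by move=> t a v w; apply/funext => k; rewrite /expA; ring.
- split=> [v|s t v _ _]; apply/funext => k; rewrite /expA.
    by rewrite mul0r cexp0 mul1r.
  by rewrite rmorphD/= mulrDl cexpD mulrA.
- move=> v vX; apply: (@cvg_Hnorm0 _ (2 * (K + L)) v) => //.
    by rewrite mulr_ge0 ?addr_ge0.
  near=> t => k.
  have [t0 tL] : 0 < t /\ t * L <= 1 by near: t.
  rewrite (_ : (_ \- _) k = (cexp (t%:C * symA beta gamma k) - 1) * v k);
    last by rewrite /= /expA -/(symA _ _); ring.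
  rewrite sqnormcM ler_wpM2r ?sqnormc_ge0//.
  rewrite -[X in sqnormc X](subrK (t%:C * symA beta gamma k)).
  apply: le_trans (sqnormcD_le _ _) _.
  have h1 := taylor t k t0 tL.
  have h2 : sqnormc (t%:C * symA beta gamma k) <= t ^+ 2 * (2 * L ^+ 2).
    rewrite sqnormcM {1}/sqnormc/= expr0n/= addr0 ler_wpM2l ?sqr_ge0//.
    have [pL qL] := aL k.
    rewrite mulrDl mul1r lerD// -[leLHS]real_normK ?num_real//.
      by rewrite ler_sqr ?nnegrE.
    by rewrite ler_sqr ?nnegrE.
  have t1 : t <= 1 by nra.
  have h3 : (K * t ^+ 2) ^+ 2 <= (K * t) ^+ 2.
    rewrite ler_sqr ?nnegrE ?mulr_ge0 ?sqr_ge0 ?(ltW t0)//.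
    by rewrite ler_wpM2l// expr2 ler_piMr// ltW.
  have := mulr_ge0 (mulr_ge0 K0 L0) (sqr_ge0 t).
  have -> : (2 * (K + L) * t) ^+ 2 =
    4 * (K * t) ^+ 2 + 8 * (K * L * t ^+ 2) + 2 * (t ^+ 2 * (2 * L ^+ 2)) by ring.
  have := sqr_ge0 (K * t); lra.
- move=> v vX; apply: (@cvg_Hnorm0 _ K v) => //.
  near=> t => k.
  have [t0 tL] : 0 < t /\ t * L <= 1 by near: t.
  rewrite (_ : (_ \- _) k = (t^-1)%:C *
    (cexp (t%:C * symA beta gamma k) - 1 - t%:C * symA beta gamma k) * v k).
    rewrite 2!sqnormcM ler_wpM2r ?sqnormc_ge0// {1}/sqnormc/= expr0n/= addr0.
    apply: le_trans (ler_wpM2l _ (taylor t k t0 tL)) _; first exact: sqr_ge0.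
    by rewrite -exprMn (_ : t^-1 * _ = K * t)//; field; rewrite gt_eqF.
  have tC : (t^-1)%:C * t%:C = 1 :> R[i].
    by rewrite -rmorphM/= mulVf ?gt_eqF.
  set a := symA beta gamma k; set c := cexp _.
  transitivity ((t^-1)%:C * (c * v k - v k) - a * v k).
    by rewrite /a -opAE.
  rewrite [RHS](_ : _ = (t^-1)%:C * (c * v k - v k) -
    (t^-1)%:C * t%:C * (a * v k)); last by ring.
  by rewrite tC mul1r.
Unshelve. all: by end_near. Qed.

End Periodic.

(* Main.v *)
Require Import Defs.
From mathcomp Require Import all_boot all_order all_algebra.
From mathcomp Require Import zify ring lra.
From mathcomp Require Import complex.
From mathcomp Require Import all_classical all_reals all_analysis.
From mathcomp Require Import ess_sup_inf measurable_realfun.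

Set Implicit Arguments.
Unset Strict Implicit.
Unset Printing Implicit Defensive.

Import Order.TTheory GRing.Theory Num.Theory.
Import numFieldNormedType.Exports.

Local Open Scope classical_set_scope.
Local Open Scope ring_scope.
Local Open Scope complex_scope.

(* On Fourier coefficients the equation is the ODE c' = A c + (I - Delta)^{-1} f - Q c
   in a weighted l^2 space, where Q c = (I - Delta)^{-1} (u u_x) is a bounded
   quadratic map: the convolution of two elements of H^ell has bounded weighted
   coefficients, and the derivative gained makes them square summable. The condition
   on gamma says exactly that Re A <= - a < 0 on the nonzero modes, so for small data
   the Duhamel map is a contraction by 1/2 in the sup norm over [0, oo) on a ball
   whose radius is linear in the data. Its fixed point is turned into functions by a
   Riesz-Fischer theorem that also identifies the coefficients of u ^ 2. For
   uniqueness, the Bochner integral at a time t1 bounds any solution on [0, t1], and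
   the Duhamel map is contracting there in an exponentially weighted norm. *)

(** * Weighted square-summable sequences and complex integrals *)

(** The range ell >= 0 shapes the estimates. For ell <= 1/2 the space H^ell is not an algebra, and
    at ell = 0 the square u^2 is merely integrable, so the square is controlled only by a weighted
    supremum of its coefficients. The multiplier freq / (1 + freq^2) of (I - Delta)^{-1} d/dx is
    square summable and pays for the return to l^2. The exponent ell - 2 on f comes from the
    resolvent, an isometry from H^{ell-2} to H^ell. The other obstacle is measurability. Bochner
    integrals are specified by simple functions converging almost everywhere, so their integrands
    are measurable only off a null set. Paths with Borel coefficients at every time keep the
    iteration free of exceptional times; null sets enter only when the forcing is replaced by such a
    path and when a given mild solution is analysed. Uniqueness cannot use the smallness of the
    data: a competing solution is not known to lie in the ball of the contraction, and the
    exponential weight absorbs its possibly large Lipschitz constant. *)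

Section WeightedL2.
Context {R : realType}.
Local Notation Re := complex.Re.
Local Notation Im := complex.Im.
Local Notation cabs := (@Normc.normc R).
Implicit Types (c d : @pdist R) (ell : R) (s : seq int).

Lemma cabsE (z : R[i]) : cabs z = Num.sqrt (sqnormc z).
Proof. by case: z. Qed.

Lemma sqr_cabs (z : R[i]) : cabs z ^+ 2 = sqnormc z.
Proof. by rewrite cabsE sqr_sqrtr// sqnormc_ge0. Qed.

Lemma cabs_ge0 (z : R[i]) : 0 <= cabs z.
Proof. by rewrite cabsE sqrtr_ge0. Qed.

Lemma cabsD (z w : R[i]) : cabs (z + w) <= cabs z + cabs w.
Proof. exact: le_normcD. Qed.

Lemma cabsM (z w : R[i]) : cabs (z * w) = cabs z * cabs w.
Proof. exact: Normc.normcM. Qed.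

Lemma cabs0 : cabs 0 = 0.
Proof. exact: Normc.normc0. Qed.

Lemma cabsN (z : R[i]) : cabs (- z) = cabs z.
Proof. by case: z => a b; rewrite !cabsE /sqnormc/= !sqrrN. Qed.

Lemma cabs_real (x : R) : cabs x%:C = `|x|.
Proof. by rewrite cabsE /sqnormc/= expr0n addr0 sqrtr_sqr. Qed.

Lemma Re_le_cabs (z : R[i]) : `|Re z| <= cabs z.
Proof.
rewrite cabsE -(sqrtr_sqr (Re z)) ler_sqrt ?sqnormc_ge0//.
by rewrite /sqnormc lerDl sqr_ge0.
Qed.

Lemma Im_le_cabs (z : R[i]) : `|Im z| <= cabs z.
Proof.
rewrite cabsE -(sqrtr_sqr (Im z)) ler_sqrt ?sqnormc_ge0//.
by rewrite /sqnormc lerDr sqr_ge0.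
Qed.

Lemma cabs_sum (I : Type) (s : seq I) (P : pred I) (F : I -> R[i]) :
  cabs (\sum_(i <- s | P i) F i) <= \sum_(i <- s | P i) cabs (F i).
Proof.
elim/big_ind2 : _ => [|z x w y zx wy|//]; first by rewrite cabs0.
by rewrite (le_trans (cabsD _ _))// lerD.
Qed.

Lemma cauchy_schwarz_sum (I : Type) (s : seq I) (x y : I -> R) (A B : R) :
  0 <= A -> 0 <= B ->
  \sum_(i <- s) x i ^+ 2 <= A ^+ 2 -> \sum_(i <- s) y i ^+ 2 <= B ^+ 2 ->
  \sum_(i <- s) x i * y i <= A * B.
Proof.
move=> A0 B0 xA yB.
have sqs_ge0 (z : I -> R) : 0 <= \sum_(i <- s) z i ^+ 2.
  by apply: sumr_ge0 => i _; rewrite sqr_ge0.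
have cs : (\sum_(i <- s) x i * y i) ^+ 2 <=
    (\sum_(i <- s) x i ^+ 2) * (\sum_(i <- s) y i ^+ 2).
  elim: s {xA yB sqs_ge0} => [|i s]; first by rewrite !big_nil expr0n mulr0.
  rewrite !big_cons.
  have : 0 <= \sum_(j <- s) x j ^+ 2 by apply: sumr_ge0 => j _; rewrite sqr_ge0.
  have : 0 <= \sum_(j <- s) y j ^+ 2 by apply: sumr_ge0 => j _; rewrite sqr_ge0.
  move: (\sum_(j <- s) _ ^+ 2) (\sum_(j <- s) _ ^+ 2) (\sum_(j <- s) _ * _).
  move=> X Y P Y0 X0 PXY; move: (x i) (y i) => a b.
  (* The cross term of (P + a b)^2. Squared, the inequality follows from P^2 <= X Y and 4 X Y (a
     b)^2 <= (X b^2 + Y a^2)^2. *)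
  have h : 2 * P * (a * b) <= X * b ^+ 2 + Y * a ^+ 2.
    have h0 : 0 <= X * b ^+ 2 + Y * a ^+ 2.
      by rewrite addr_ge0// mulr_ge0// sqr_ge0.
    apply: (le_trans (ler_norm _)).
    rewrite -ler_sqr ?nnegrE// real_normK ?num_real//.
    apply: (@le_trans _ _ (4 * (X * Y) * (a * b) ^+ 2)).
      rewrite [leLHS](_ : _ = 4 * (a * b) ^+ 2 * P ^+ 2); last by ring.
      rewrite [leRHS](_ : _ = 4 * (a * b) ^+ 2 * (X * Y)); last by ring.
      apply: ler_wpM2l => //; apply: mulr_ge0 => //; exact: sqr_ge0.
    rewrite -subr_ge0 [leRHS](_ : _ = (X * b ^+ 2 - Y * a ^+ 2) ^+ 2) ?sqr_ge0//.
    by ring.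
  rewrite -subr_ge0 [leRHS](_ : _ = (X * Y - P ^+ 2) +
    (X * b ^+ 2 + Y * a ^+ 2 - 2 * P * (a * b))); last by ring.
  by rewrite addr_ge0// subr_ge0.
apply: (le_trans (ler_norm _)).
rewrite -ler_sqr ?nnegrE ?mulr_ge0// real_normK ?num_real// (le_trans cs)//.
by rewrite exprMn ler_pM.
Qed.

Lemma minkowski_sum (I : Type) (s : seq I) (x y : I -> R) (A B : R) :
  0 <= A -> 0 <= B ->
  \sum_(i <- s) x i ^+ 2 <= A ^+ 2 -> \sum_(i <- s) y i ^+ 2 <= B ^+ 2 ->
  \sum_(i <- s) (x i + y i) ^+ 2 <= (A + B) ^+ 2.
Proof.
move=> A0 B0 xA yB; have xy := cauchy_schwarz_sum A0 B0 xA yB.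
under eq_bigr do rewrite sqrrD -mulr_natl.
rewrite !big_split/= -mulr_sumr.
by rewrite (_ : (A + B) ^+ 2 = A ^+ 2 + 2 * (A * B) + B ^+ 2); [lra|ring].
Qed.

Definition weight ell (k : int) : R := (1 + freq k ^+ 2) `^ ell.

Lemma freq1_ge1 (k : int) : 1 <= 1 + (@freq R k) ^+ 2.
Proof. by rewrite lerDl sqr_ge0. Qed.

Lemma weight_gt0 ell k : 0 < weight ell k.
Proof. by rewrite powR_gt0// (lt_le_trans ltr01 (freq1_ge1 _)). Qed.

Lemma weight_ge0 ell k : 0 <= weight ell k.
Proof. exact/ltW/weight_gt0. Qed.

Lemma weight_ge1 ell k : 0 <= ell -> 1 <= weight ell k.
Proof.
move=> l0; apply: (@le_trans _ _ (1 `^ ell)); first by rewrite powR1.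
apply: ge0_ler_powR => //; rewrite ?nnegrE ?ler01//.
  exact: le_trans ler01 (freq1_ge1 _).
exact: freq1_ge1.
Qed.

(** The square root of the k-th term of the series in [Hnorm]: the norm is the l^2 norm of this
    nonnegative sequence, so a pointwise comparison of [wabs] compares norms. *)
Definition wabs ell c (k : int) : R :=
  locked (Num.sqrt (weight ell k) * cabs (c k)).

Lemma wabsE ell c k : wabs ell c k = Num.sqrt (weight ell k) * cabs (c k).
Proof. by rewrite /wabs -lock. Qed.

Lemma wabs_ge0 ell c k : 0 <= wabs ell c k.
Proof. by rewrite wabsE mulr_ge0 ?sqrtr_ge0 ?cabs_ge0. Qed.

Lemma sqr_wabs ell c k : wabs ell c k ^+ 2 = weight ell k * sqnormc (c k).
Proof. by rewrite wabsE exprMn sqr_cabs sqr_sqrtr// ltW// weight_gt0. Qed.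

Lemma wabsD ell c d k : wabs ell (c \+ d) k <= wabs ell c k + wabs ell d k.
Proof. by rewrite !wabsE -mulrDr ler_wpM2l ?sqrtr_ge0// cabsD. Qed.

Lemma cabs_le_wabs ell c k : 0 <= ell -> cabs (c k) <= wabs ell c k.
Proof.
move=> l0; rewrite wabsE ler_peMl ?cabs_ge0//.
by rewrite -sqrtr1 ler_sqrt ?weight_ge1// ltW// weight_gt0.
Qed.

Lemma Hnorm_ge0 ell c : (0 <= Hnorm ell c)%E.
Proof. exact: poweR_ge0. Qed.

Lemma Hnorm_sqr_le ell c (M : R) : 0 <= M ->
  (Hnorm ell c <= M%:E)%E =
  (\esum_(k in [set: int]) (weight ell k * sqnormc (c k))%:E <= (M ^+ 2)%:E)%E.
Proof.
move=> M0; rewrite /Hnorm -/(weight _ _).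
set S := \esum_(k in _) _.
have S0 : (0 <= S)%E.
  by apply: esum_ge0 => k _; rewrite lee_fin mulr_ge0 ?powR_ge0 ?sqnormc_ge0.
apply/idP/idP.
  move=> h; have : ((S `^ 2^-1) `^ 2 <= M%:E `^ 2)%E.
    by apply: gt0_ler_poweR => //; rewrite ?in_itv/= ?leey ?andbT ?poweR_ge0.
  by rewrite -poweRrM mulVf// poweRe1// poweR_EFin powR_mulrn.
move=> h; have : (S `^ 2^-1 <= (M ^+ 2)%:E `^ 2^-1)%E.
  by apply: gt0_ler_poweR => //; rewrite ?in_itv/= ?leey ?andbT// lee_fin sqr_ge0.
by rewrite poweR_EFin powR12_sqrt ?sqr_ge0// sqrtr_sqr ger0_norm.
Qed.

(** The extended sum in [Hnorm] is a supremum of finite sums, and duplicate-free lists index them.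
    Norm estimates thereby reduce to inequalities between finite real sums. *)
Lemma Hnorm_leP ell c (M : R) : 0 <= M ->
  (Hnorm ell c <= M%:E)%E <->
  (forall s, uniq s -> \sum_(k <- s) wabs ell c k ^+ 2 <= M ^+ 2).
Proof.
move=> M0; rewrite Hnorm_sqr_le//; split.
  move=> h s us; rewrite -lee_fin (le_trans _ h)//.
  apply: ereal_sup_ubound; exists [set` s] => //.
    by split => //; exact: finite_seq.
  rewrite -fsbig_seq//= -sumEFin; apply: eq_bigr => k _.
  by rewrite sqr_wabs.
move=> h; apply: ge_ereal_sup => _ [X [fX _] <-].
rewrite fsbig_finite//= sumEFin lee_fin.
under eq_bigr do rewrite -sqr_wabs.
by apply: h; exact: finmap.fset_uniq.
Qed.

Definition win (n : nat) : seq int :=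
  [seq (i%:Z - n%:Z)%R | i <- iota 0 n.*2.+1].

Lemma win_uniq n : uniq (win n).
Proof. by rewrite map_inj_uniq ?iota_uniq// => i j /addIr[]. Qed.

Lemma mem_win n (k : int) : (k \in win n) = (`|k| <= n)%N.
Proof.
apply/mapP/idP => [[i + ->]|kn]; first by rewrite mem_iota; lia.
exists (absz (k + n%:Z)); first by rewrite mem_iota; lia.
by rewrite gez0_abs; lia.
Qed.

Lemma sub_win m n : (m <= n)%N -> {subset win m <= win n}.
Proof. by move=> mn k; rewrite !mem_win => /leq_trans; apply. Qed.

Lemma seq_sub_win s : exists n, {subset s <= win n}.
Proof.
elim: s => [|k s [n sn]]; first by exists 0%N.
exists (maxn `|k| n)%N => j; rewrite inE => /orP[/eqP ->|/sn].
  by rewrite mem_win leq_maxl.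
by apply: sub_win; rewrite leq_maxr.
Qed.

Lemma ler_sum_sub s s' (F : int -> R) : (forall k, 0 <= F k) -> uniq s ->
  {subset s <= s'} -> \sum_(k <- s) F k <= \sum_(k <- s') F k.
Proof.
move=> F0; elim: s s' => [|k s IH] s' /=.
  by rewrite big_nil sumr_ge0.
move=> /andP[ks us] ss'; have ks' : k \in s' by rewrite ss' ?inE ?eqxx.
rewrite (perm_big _ (perm_to_rem ks'))/= !big_cons lerD2l IH// => j js.
have jk : j != k by apply: contraNneq ks => <-.
have := ss' j; rewrite inE js orbT => /(_ isT).
by rewrite (perm_mem (perm_to_rem ks')) inE (negPf jk).
Qed.

Lemma Hnorm_winP ell c (M : R) : 0 <= M ->
  (Hnorm ell c <= M%:E)%E <->
  (forall n, \sum_(k <- win n) wabs ell c k ^+ 2 <= M ^+ 2).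
Proof.
move=> M0; split=> [/(Hnorm_leP _ _ M0) h n|h]; first exact/h/win_uniq.
apply/Hnorm_leP => // s us; have [n sn] := seq_sub_win s.
by rewrite (le_trans _ (h n))// ler_sum_sub// => k; exact: sqr_ge0.
Qed.

Lemma Hnorm_finP ell c : (Hnorm ell c < +oo)%E ->
  exists2 M, 0 <= M & Hnorm ell c = M%:E.
Proof.
move=> cfin; exists (fine (Hnorm ell c)); first by rewrite fine_ge0// Hnorm_ge0.
by rewrite fineK// ge0_fin_numE// Hnorm_ge0.
Qed.

Lemma HnormD ell c d : (Hnorm ell (c \+ d)%R <= Hnorm ell c + Hnorm ell d)%E.
Proof.
have := Hnorm_ge0 ell c; have := Hnorm_ge0 ell d.
have [|+ d0 c0] := leP +oo%E (Hnorm ell d).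
  by rewrite leye_eq => /eqP -> _; case: (Hnorm ell c) => //= *; rewrite ?leey.
have [|+ +] := leP +oo%E (Hnorm ell c).
  by rewrite leye_eq => /eqP -> _; case: (Hnorm ell d) d0 => //= *; rewrite ?leey.
move=> /Hnorm_finP[M M0 cM] /Hnorm_finP[N N0 dN].
rewrite cM dN -EFinD; apply/Hnorm_leP => [|s us]; first exact: addr_ge0.
apply: (@le_trans _ _ (\sum_(k <- s) (wabs ell c k + wabs ell d k) ^+ 2)).
  apply: ler_sum => k _.
  by rewrite ler_sqr ?nnegrE ?addr_ge0 ?wabs_ge0// wabsD.
apply: minkowski_sum => //.
- by move: s us; apply/Hnorm_leP; rewrite ?cM.
- by move: s us; apply/Hnorm_leP; rewrite ?dN.
Qed.

Lemma Hnorm_le_wabs ell ell' (M : R) c d : 0 <= M ->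
  (forall k, wabs ell c k <= M * wabs ell' d k) ->
  (Hnorm ell c <= M%:E * Hnorm ell' d)%E.
Proof.
(* At M = 0 the right-hand side is 0 even if the norm of d is infinite, so the coefficients of c
   have to vanish one by one. *)
move=> M0 cd; have [Me|Mn0] := eqVneq M 0.
  rewrite Me mul0e; apply/Hnorm_leP => // s _; rewrite expr0n/= big1// => k _.
  have := cd k; rewrite Me mul0r => ck; apply/eqP; rewrite sqrf_eq0.
  by rewrite eq_le ck wabs_ge0.
have Mgt0 : 0 < M by rewrite lt0r Mn0.
have := Hnorm_ge0 ell' d; have [|/Hnorm_finP[N N0 dN] _] := leP +oo%E (Hnorm ell' d).
  by rewrite leye_eq => /eqP -> _; rewrite gt0_muley ?lte_fin// leey.
rewrite dN -EFinM; apply/Hnorm_leP => [|s us]; first exact: mulr_ge0.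
have h : \sum_(k <- s) wabs ell' d k ^+ 2 <= N ^+ 2.
  by move: s us; apply/Hnorm_leP; rewrite ?dN.
rewrite exprMn; apply: le_trans (ler_wpM2l (sqr_ge0 M) h).
rewrite mulr_sumr; apply: ler_sum => k _.
by rewrite -exprMn; apply: lerXn2r => //; rewrite nnegrE ?mulr_ge0 ?wabs_ge0.
Qed.

Lemma HnormN ell c : Hnorm ell (fun k => - c k) = Hnorm ell c.
Proof.
rewrite /Hnorm; congr (_ `^ _)%E; apply: eq_esum => k _.
by rewrite -!sqr_cabs cabsN.
Qed.

Lemma Hnorm0 ell : Hnorm ell (fun=> 0) = 0%E.
Proof.
apply/eqP; rewrite eq_le Hnorm_ge0 andbT; apply/Hnorm_leP => // s _.
by rewrite big1 ?sqr_ge0// => k _; rewrite wabsE cabs0 mulr0 expr0n.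
Qed.

Lemma HnormB ell c d : (Hnorm ell (c \- d)%R <= Hnorm ell c + Hnorm ell d)%E.
Proof.
rewrite -(HnormN ell d); apply: le_trans (HnormD _ _ _).
by rewrite le_eqVlt; apply/orP; left; apply/eqP; congr Hnorm; apply/funext.
Qed.

Lemma wabs_le_Hnorm ell c k : ((wabs ell c k)%:E <= Hnorm ell c)%E.
Proof.
have := Hnorm_ge0 ell c; have [|/Hnorm_finP[N N0 cN] _] := leP +oo%E (Hnorm ell c).
  by rewrite leye_eq => /eqP -> _; rewrite leey.
rewrite cN lee_fin -ler_sqr ?nnegrE ?wabs_ge0//.
have : \sum_(j <- [:: k]) wabs ell c j ^+ 2 <= N ^+ 2.
  by have : uniq [:: k] by []; move: [:: k]; apply/Hnorm_leP; rewrite ?cN.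
by rewrite big_seq1.
Qed.

Lemma cabs_le_Hnorm ell c k : 0 <= ell -> ((cabs (c k))%:E <= Hnorm ell c)%E.
Proof.
move=> l0; apply: le_trans (wabs_le_Hnorm ell c k).
by rewrite lee_fin cabs_le_wabs.
Qed.

Lemma Hnorm_mono ell ell' c : ell <= ell' -> (Hnorm ell c <= Hnorm ell' c)%E.
Proof.
move=> ll; rewrite -[leRHS]mul1e; apply: Hnorm_le_wabs => // k.
rewrite mul1r !wabsE ler_wpM2r ?cabs_ge0// ler_sqrt ?(ltW (weight_gt0 _ _))//.
by rewrite ler_powR// freq1_ge1.
Qed.

(** The windows are cofinal among the finite sets of modes. The supremum becomes countable, and the
    norm of a path inherits measurability from its coefficients. *)
Lemma Hnorm_esups ell c : Hnorm ell c =
  (esups (fun n => (\sum_(k <- win n) wabs ell c k ^+ 2)%:E) 0%N `^ 2^-1)%E.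
Proof.
rewrite /Hnorm; congr (_ `^ _)%E; apply/eqP; rewrite eq_le; apply/andP; split.
  apply: ge_ereal_sup => _ [X [fX _] <-].
  rewrite fsbig_finite//= sumEFin.
  have [n Xn] := seq_sub_win (finmap.enum_fset (fset_set X)).
  apply: (@le_trans _ _ (\sum_(k <- win n) wabs ell c k ^+ 2)%:E).
    rewrite lee_fin -/(weight _ _).
    under eq_bigr do rewrite -/(weight _ _) -sqr_wabs.
    by apply: ler_sum_sub (finmap.fset_uniq _) Xn => k; exact: sqr_ge0.
  by apply: ereal_sup_ubound; exists n.
apply: ge_ereal_sup => _ [n _ <-]; apply: ereal_sup_ubound.
exists [set` win n]; first by split => //; exact: finite_seq.
rewrite -fsbig_seq ?win_uniq//= -sumEFin; apply: eq_bigr => k _.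
by rewrite sqr_wabs.
Qed.

(** Weak measurability tested on the Fourier modes. It survives limits and the nonlinearity mode by
    mode; for bounded mean-zero paths on a set of finite measure [strongly_measurable_bounded]
    recovers strong measurability from it. *)
Definition coef_measurable (D : set (measurableTypeR R)) (F : R -> @pdist R) :=
  forall k, measurable_fun D (fun t => Re (F t k)) /\
            measurable_fun D (fun t => Im (F t k)).

Lemma measurable_sqrt : measurable_fun [set: R] (@Num.sqrt R).
Proof. exact: (continuous_measurable_fun (@sqrt_continuous R)). Qed.

Lemma measurable_cabs (D : set (measurableTypeR R)) (F : R -> R[i]) :
  measurable_fun D (fun t => Re (F t)) -> measurable_fun D (fun t => Im (F t)) ->
  measurable_fun D (fun t => cabs (F t)).
Proof.
move=> mRe mIm; rewrite [X in measurable_fun _ X](_ : _ = Num.sqrt \o (fun t => sqnormc (F t))).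
  by apply: measurableT_comp measurable_sqrt _; apply: measurable_funD;
    apply: measurable_funX.
by apply/funext => t; rewrite cabsE.
Qed.

Lemma measurable_Hnorm ell (D : set (measurableTypeR R)) F : coef_measurable D F ->
  measurable_fun D (fun t => Hnorm ell (F t)).
Proof.
move=> mF; rewrite [X in measurable_fun _ X](_ : _ = (fun x => (x `^ 2^-1)%E) \o (fun t =>
    esups (fun n => (\sum_(k <- win n) wabs ell (F t) k ^+ 2)%:E) 0%N)); last first.
  by apply/funext => t; rewrite Hnorm_esups.
apply: measurableT_comp (measurable_poweR _) _.
apply: measurable_fun_esups => n.
apply/measurable_EFinP/measurable_sum => k; apply: measurable_funX.
rewrite [X in measurable_fun _ X](_ : _ = (fun t =>
    Num.sqrt (weight ell k) * cabs (F t k))); last first.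
  by apply/funext => t; rewrite wabsE.
apply: measurable_funM; first exact: measurable_cst.
by have [? ?] := mF k; exact: measurable_cabs.
Qed.

Lemma cvgr_sum (I T : Type) (F : set_system T) (FF : Filter F) (s : seq I)
    (u : I -> T -> R) (l : I -> R) :
  (forall i, u i t @[t --> F] --> l i) ->
  \sum_(i <- s) u i t @[t --> F] --> \sum_(i <- s) l i.
Proof. by move=> ul; apply: cvg_big => //; exact: add_continuous. Qed.

(** Lower semicontinuity of the norm under convergence of each coefficient: every finite partial sum
    passes to the limit. *)
Lemma Hnorm_lim ell (c_ : nat -> @pdist R) c (M : R) : 0 <= M ->
  (forall k, (fun n => Re (c_ n k)) @ \oo --> Re (c k) /\
             (fun n => Im (c_ n k)) @ \oo --> Im (c k)) ->
  (\forall n \near \oo, Hnorm ell (c_ n) <= M%:E)%E ->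
  (Hnorm ell c <= M%:E)%E.
Proof.
move=> M0 cc cM; apply/Hnorm_leP => // s us.
have h : (fun n => \sum_(k <- s) weight ell k * sqnormc (c_ n k)) @ \oo -->
         \sum_(k <- s) weight ell k * sqnormc (c k).
  apply: cvgr_sum => k; apply: cvgMl_tmp; have [? ?] := cc k.
  by apply: cvgD; apply: cvgM.
under eq_bigr do rewrite sqr_wabs.
rewrite -(cvg_lim (@Rhausdorff R) h); apply: limr_le; first exact: cvgP h.
near=> n; under eq_bigr do rewrite -sqr_wabs.
by move: s us {h}; apply/Hnorm_leP => //; near: n.
Unshelve. all: by end_near. Qed.

End WeightedL2.

(** * Integrals of complex functions and of coefficient paths *)

Section ComplexIntegral.
Context {R : realType}.
Local Notation mu := (@lebesgue_measure R).
Local Notation Re := complex.Re.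
Local Notation Im := complex.Im.
Local Notation cabs := (@Normc.normc R).
Implicit Types (D : set (measurableTypeR R)) (f h : R -> R) (g m : R -> R[i]).

Definition rintegrable D f := mu.-integrable D (EFin \o f).

Lemma rintegrableD D f h : measurable D ->
  rintegrable D f -> rintegrable D h -> rintegrable D (fun x => f x + h x).
Proof.
by move=> mD fi hi; have := integrableD mD fi hi; apply: eq_integrable.
Qed.

Lemma rintegrableZ D (r : R) f : measurable D ->
  rintegrable D f -> rintegrable D (fun x => r * f x).
Proof.
by move=> mD fi; have := integrableZl mD r fi; apply: eq_integrable.
Qed.

Lemma rintegrableN D f : measurable D ->
  rintegrable D f -> rintegrable D (fun x => - f x).
Proof.
move=> mD fi; rewrite (_ : (fun x => _) = (fun x => -1 * f x)).
  exact: rintegrableZ.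
by apply/funext => x; rewrite mulN1r.
Qed.

Lemma rintegrable_sum (I : Type) (s : seq I) D (F : I -> R -> R) : measurable D ->
  (forall i, rintegrable D (F i)) -> rintegrable D (fun x => \sum_(i <- s) F i x).
Proof.
move=> mD Fi; have := integrable_sum mD s (fun i (_ : xpredT i) => Fi i).
by apply: eq_integrable => // x _; rewrite /= sumEFin.
Qed.

Lemma rintegrable_measurable D f : rintegrable D f -> measurable_fun D f.
Proof. by move=> /measurable_int/measurable_EFinP. Qed.

Lemma rintegrable_mul D f h (M : R) : measurable D ->
  measurable_fun D h -> (forall x, D x -> `|h x| <= M) ->
  rintegrable D f -> rintegrable D (fun x => h x * f x).
Proof.
move=> mD mh hM fi.
have hb : [bounded h x | x in D].
  exists M; split; first exact: num_real.
  by move=> y My x /hM/le_trans; apply; exact: ltW.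
have := @integrableMr _ _ R mu D mD h (EFin \o f) mh hb fi.
by apply: eq_integrable.
Qed.

Lemma rintegrable_bounded D f (M : R) : measurable D -> (mu D < +oo)%E ->
  measurable_fun D f -> (forall x, D x -> `|f x| <= M) -> rintegrable D f.
Proof.
move=> mD Dfin mf fM; apply: measurable_bounded_integrable => //.
exists M; split; first exact: num_real.
by move=> y My x /fM/le_trans; apply; exact: ltW.
Qed.

Lemma Rintegral_sum (I : Type) (s : seq I) D (F : I -> R -> R) : measurable D ->
  (forall i, rintegrable D (F i)) ->
  Rintegral mu D (fun x => \sum_(i <- s) F i x) =
  \sum_(i <- s) Rintegral mu D (F i).
Proof.
move=> mD Fi; elim: s => [|i s IH].
  by under eq_Rintegral do rewrite big_nil; rewrite big_nil Rintegral_cst// mul0r.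
rewrite big_cons -IH -RintegralD//; [|exact: Fi|exact: rintegrable_sum].
by apply: eq_Rintegral => x _; rewrite big_cons.
Qed.

Lemma EFin_Rintegral D f : measurable D -> rintegrable D f ->
  (Rintegral mu D f)%:E = (\int[mu]_(x in D) (f x)%:E)%E.
Proof. by move=> mD fi; rewrite fineK//; exact: integrable_fin_num. Qed.

Lemma cvg_Rintegral_dominated D (f_ : nat -> R -> R) f (G : R -> R) :
  measurable D -> (forall n, measurable_fun D (f_ n)) -> measurable_fun D f ->
  {ae mu, forall x, D x -> (fun n => f_ n x) @ \oo --> f x} ->
  rintegrable D G -> {ae mu, forall x, D x -> forall n, `|f_ n x| <= G x} ->
  rintegrable D f /\
  (fun n => Rintegral mu D (f_ n)) @ \oo --> Rintegral mu D f.
Proof.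
move=> mD mf_ mf f_f Gi f_G.
have f_i n : rintegrable D (f_ n).
  apply/integrableP; split; first exact/measurable_EFinP.
  have /integrableP[_] := Gi; apply: le_lt_trans.
  apply: ae_ge0_le_integral => //.
  - exact/measurableT_comp/measurable_EFinP.
  - by apply: measurableT_comp => //; exact: measurable_int Gi.
  apply: filterS f_G => x fG Dx; rewrite /= lee_fin.
  exact: le_trans (fG Dx n) (ler_norm _).
have f_fE : {ae mu, forall x, D x ->
    (fun n => (EFin \o f_ n) x) @ \oo --> (EFin \o f) x}.
  by apply: filterS f_f => x h Dx; apply: cvg_EFin; [exact: nearW|exact: h].
have f_GE : {ae mu, forall x, forall n, D x -> (`|(EFin \o f_ n) x| <= (EFin \o G) x)%E}.
  by apply: filterS f_G => x h n Dx; rewrite lee_fin; exact: h.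
have [fi _ cvgf] := @dominated_convergence _ _ R mu D mD
  (fun n => EFin \o f_ n) (EFin \o f) (EFin \o G)
  (fun n => (measurable_EFinP _ _).2 (mf_ n)) ((measurable_EFinP _ _).2 mf)
  f_fE Gi f_GE.
split; first exact: fi.
by rewrite /Rintegral; apply: fine_cvg; rewrite fineK//; exact: integrable_fin_num.
Qed.

Definition cintegrable D g :=
  rintegrable D (fun x => Re (g x)) /\ rintegrable D (fun x => Im (g x)).

Lemma ReD (z w : R[i]) : Re (z + w) = Re z + Re w.
Proof. by case: z w => ? ? []. Qed.

Lemma ImD (z w : R[i]) : Im (z + w) = Im z + Im w.
Proof. by case: z w => ? ? []. Qed.

Lemma ReM (z w : R[i]) : Re (z * w) = Re z * Re w - Im z * Im w.
Proof. by case: z w => ? ? []. Qed.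

Lemma ImM (z w : R[i]) : Im (z * w) = Re z * Im w + Im z * Re w.
Proof. by case: z w => ? ? []. Qed.

Lemma ReN (z : R[i]) : Re (- z) = - Re z.
Proof. by case: z. Qed.

Lemma ImN (z : R[i]) : Im (- z) = - Im z.
Proof. by case: z. Qed.

Lemma Re_sum (I : Type) (s : seq I) (P : pred I) (F : I -> R[i]) :
  Re (\sum_(i <- s | P i) F i) = \sum_(i <- s | P i) Re (F i).
Proof. by elim/big_ind2 : _ => // z x w y <- <-; rewrite ReD. Qed.

Lemma Im_sum (I : Type) (s : seq I) (P : pred I) (F : I -> R[i]) :
  Im (\sum_(i <- s | P i) F i) = \sum_(i <- s | P i) Im (F i).
Proof. by elim/big_ind2 : _ => // z x w y <- <-; rewrite ImD. Qed.

Lemma eqC (z w : R[i]) : Re z = Re w -> Im z = Im w -> z = w.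
Proof. by case: z w => ? ? [? ?] /= -> ->. Qed.

Lemma cintegrableD D g m : measurable D ->
  cintegrable D g -> cintegrable D m -> cintegrable D (fun x => g x + m x).
Proof.
move=> mD [g1 g2] [m1 m2]; split.
  under eq_fun do rewrite ReD; exact: rintegrableD.
under eq_fun do rewrite ImD; exact: rintegrableD.
Qed.

Lemma cintegrable_mul D g m (M : R) : measurable D ->
  measurable_fun D (fun x => Re (m x)) -> measurable_fun D (fun x => Im (m x)) ->
  (forall x, D x -> cabs (m x) <= M) ->
  cintegrable D g -> cintegrable D (fun x => m x * g x).
Proof.
move=> mD mRe mIm mM [g1 g2].
have ReM' x : D x -> `|Re (m x)| <= M.
  by move=> Dx; apply: le_trans (Re_le_cabs _) (mM _ Dx).
have ImM' x : D x -> `|Im (m x)| <= M.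
  by move=> Dx; apply: le_trans (Im_le_cabs _) (mM _ Dx).
split.
  under eq_fun do rewrite ReM; apply: rintegrableD => //.
    exact: rintegrable_mul mRe ReM' g1.
  apply: rintegrableN => //; exact: rintegrable_mul mIm ImM' g2.
under eq_fun do rewrite ImM; apply: rintegrableD => //.
  exact: rintegrable_mul mRe ReM' g2.
exact: rintegrable_mul mIm ImM' g1.
Qed.

Lemma cintegrableZ D (z : R[i]) g : measurable D ->
  cintegrable D g -> cintegrable D (fun x => z * g x).
Proof. by move=> mD; apply: (@cintegrable_mul _ _ (fun=> z) (cabs z)). Qed.

Lemma cintegrable_sum (I : Type) (s : seq I) D (F : I -> R -> R[i]) :
  measurable D -> (forall i, cintegrable D (F i)) ->
  cintegrable D (fun x => \sum_(i <- s) F i x).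
Proof.
move=> mD Fi; split.
  under eq_fun do rewrite Re_sum; apply: rintegrable_sum => // i.
  by have [] := Fi i.
under eq_fun do rewrite Im_sum; apply: rintegrable_sum => // i.
by have [] := Fi i.
Qed.

Lemma cintegralD D g m : measurable D -> cintegrable D g -> cintegrable D m ->
  cintegral D (fun x => g x + m x) = cintegral D g + cintegral D m.
Proof.
move=> mD [g1 g2] [m1 m2]; rewrite /cintegral; apply: eqC => /=.
  by rewrite -RintegralD//; apply: eq_Rintegral => x _; rewrite ReD.
by rewrite -RintegralD//; apply: eq_Rintegral => x _; rewrite ImD.
Qed.

Lemma cintegralZ D (z : R[i]) g : measurable D -> cintegrable D g ->
  cintegral D (fun x => z * g x) = z * cintegral D g.
Proof.
move=> mD [g1 g2]; rewrite /cintegral; apply: eqC => /=.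
  rewrite ReM/= -!RintegralZl// -RintegralB//; try exact: rintegrableZ.
  by apply: eq_Rintegral => x _; rewrite ReM.
rewrite ImM/= -!RintegralZl// -RintegralD//; try exact: rintegrableZ.
by apply: eq_Rintegral => x _; rewrite ImM.
Qed.

Lemma cintegralB D g m : measurable D -> cintegrable D g -> cintegrable D m ->
  cintegral D (fun x => g x - m x) = cintegral D g - cintegral D m.
Proof.
move=> mD gi mi; rewrite -mulN1r -cintegralZ// -cintegralD//.
  by rewrite /cintegral; congr (_ +i* _); apply: eq_Rintegral => x _; rewrite mulN1r.
exact: cintegrableZ.
Qed.

Lemma cintegrableB D g m : measurable D ->
  cintegrable D g -> cintegrable D m -> cintegrable D (fun x => g x - m x).
Proof.
move=> mD gi mi; rewrite (_ : (fun x => _) = (fun x => g x + (-1) * m x)).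
  by apply: cintegrableD => //; exact: cintegrableZ.
by apply/funext => x; rewrite mulN1r.
Qed.

Lemma cintegral_sum (I : Type) (s : seq I) D (F : I -> R -> R[i]) :
  measurable D -> (forall i, cintegrable D (F i)) ->
  cintegral D (fun x => \sum_(i <- s) F i x) = \sum_(i <- s) cintegral D (F i).
Proof.
move=> mD Fi; apply: eqC; rewrite (Re_sum, Im_sum) /cintegral /= -Rintegral_sum//.
- by apply: eq_Rintegral => x _; rewrite Re_sum.
- by move=> i; have [] := Fi i.
- by apply: eq_Rintegral => x _; rewrite Im_sum.
- by move=> i; have [] := Fi i.
Qed.

Lemma eq_cintegral D g m : (forall x, D x -> g x = m x) ->
  cintegral D g = cintegral D m.
Proof.
by move=> gm; rewrite /cintegral; congr (_ +i* _);
  apply: eq_Rintegral => x /set_mem Dx; rewrite gm.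
Qed.

Lemma inner_le_cabs (z w : R[i]) : Re z * Re w + Im z * Im w <= cabs z * cabs w.
Proof.
have := Re_le_cabs (conjc z * w); rewrite cabsM => /(le_trans (ler_norm _)).
rewrite ReM; case: z => a b /=; rewrite mulNr opprK => /le_trans; apply.
by rewrite sqrrN.
Qed.

(* Duality: testing against the weighted conjugate of the integral itself. *)
Lemma Hnorm_cintegral_le ell D (F : R -> @pdist R) : measurable D ->
  (forall k, cintegrable D (fun t => F t k)) ->
  (Hnorm ell (fun k => cintegral D (fun t => F t k)) <=
   \int[mu]_(t in D) Hnorm ell (F t))%E.
Proof.
move=> mD Fi; set z := fun k => cintegral D _.
have mF : measurable_fun D (fun t => Hnorm ell (F t)).
  by apply: measurable_Hnorm => k; have [/rintegrable_measurable ? /rintegrable_measurable] := Fi k.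
have H0 t : (0 <= Hnorm ell (F t))%E by exact: Hnorm_ge0.
have I0 : (0 <= \int[mu]_(t in D) Hnorm ell (F t))%E by exact: integral_ge0.
have [|Ifin] := leP +oo%E (\int[mu]_(t in D) Hnorm ell (F t))%E.
  by rewrite leye_eq => /eqP ->; rewrite leey.
have Iint : mu.-integrable D (fun t => Hnorm ell (F t)).
  by apply/integrableP; split => //; under eq_integral do rewrite gee0_abs//.
rewrite -(fineK (integrable_fin_num mD Iint)).
set I := fine _; have I0' : 0 <= I by exact: fine_ge0.
apply/Hnorm_leP => // s us.
set S := \sum_(k <- s) _; have S0 : 0 <= S by apply: sumr_ge0 => k _; exact: sqr_ge0.
pose psi t := \sum_(k <- s) weight ell k * (Re (z k) * Re (F t k) + Im (z k) * Im (F t k)).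
have i1 k : rintegrable D (fun t => weight ell k * (Re (z k) * Re (F t k) + Im (z k) * Im (F t k))).
  have [? ?] := Fi k; apply: rintegrableZ => //; apply: rintegrableD => //; exact: rintegrableZ.
have psiI : rintegrable D psi by exact: rintegrable_sum.
have SE : S = Rintegral mu D psi.
  rewrite Rintegral_sum//; apply: eq_bigr => k _; have [? ?] := Fi k.
  rewrite RintegralZl//; last by apply: rintegrableD => //; exact: rintegrableZ.
  rewrite RintegralD//; try exact: rintegrableZ.
  by rewrite !RintegralZl// sqr_wabs /sqnormc !expr2.
have psiH t : ((psi t)%:E <= (Num.sqrt S)%:E * Hnorm ell (F t))%E.
  have := H0 t; have [|/Hnorm_finP[N N0 FN] _] := leP +oo%E (Hnorm ell (F t)).
    (* With an infinite norm and S = 0 the right-hand side is 0, so [psi] must vanish: S = 0 forces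
       z k = 0 for every k in s. *)
    rewrite leye_eq => /eqP -> _; have [S0'|Sn0] := eqVneq S 0.
      rewrite S0' sqrtr0 mul0e lee_fin /psi big_seq big1// => k ks.
      have /eqP : wabs ell z k ^+ 2 = 0.
        apply/eqP; move: S0'; rewrite /S => /eqP; rewrite psumr_eq0.
          by move=> /allP/(_ k ks).
        by move=> i _; exact: sqr_ge0.
      rewrite sqrf_eq0 wabsE mulf_eq0 gt_eqF ?sqrtr_gt0 ?weight_gt0// orFb => /eqP z0.
      rewrite (Normc.eq0_normc z0).
      by rewrite /= !mul0r addr0 mulr0.
    by rewrite gt0_muley ?leey// lte_fin sqrtr_gt0 lt0r Sn0.
  rewrite FN -EFinM lee_fin /psi.
  apply: (@le_trans _ _ (\sum_(k <- s) wabs ell z k * wabs ell (F t) k)).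
    apply: ler_sum => k _; rewrite !wabsE mulrACA -expr2 sqr_sqrtr ?weight_ge0//.
    by rewrite ler_wpM2l ?weight_ge0// inner_le_cabs.
  apply: cauchy_schwarz_sum => //; first by rewrite sqr_sqrtr.
  by move: s us {S S0 psi i1 psiI SE}; apply/Hnorm_leP; rewrite ?FN.
have SI : S <= Num.sqrt S * I.
  rewrite -lee_fin EFinM fineK; last exact: integrable_fin_num.
  rewrite {1}SE EFin_Rintegral// -integralZl//.
  apply: le_integral => //; first exact: integrableZl.
have := sqr_sqrtr S0; have := sqrtr_ge0 S.
move: (Num.sqrt S) SI => r SI r0 rS; move: SI; rewrite -rS expr2.
have [->|rn0] := eqVneq r 0; first by rewrite mul0r sqr_ge0.
have rgt0 : 0 < r by rewrite lt0r rn0.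
by rewrite ler_pM2l// => rI; rewrite expr2 ler_pM.
Qed.

End ComplexIntegral.

(** * Fourier series *)

Section Trigonometric.
Context {R : realType}.
Local Notation mu := (@lebesgue_measure R).
Local Notation Re := complex.Re.
Local Notation Im := complex.Im.
Local Notation cabs := (@Normc.normc R).
Implicit Types (k : int).

Lemma Rintegral_FTC2 (a b : R) (F f : R -> R) : a <= b ->
  (forall x : R, is_derive x (1 : R) F (f x)) -> continuous f ->
  Rintegral mu `[a, b] f = F b - F a.
Proof.
rewrite le_eqVlt => /orP[/eqP <- _ _|ab dF fc].
  by rewrite set_itv1 Rintegral_set1 subrr.
have Fc (x : R) : {for x, continuous F}.
  by apply/differentiable_continuous/derivable1_diffP; apply: ex_derive.
rewrite /Rintegral (@continuous_FTC2 _ _ F)//.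
- exact: continuous_subspaceT.
- split=> [x _||]; first exact: ex_derive.
    by apply: cvg_at_right_filter; exact: Fc.
  by apply: cvg_at_left_filter; exact: Fc.
- by move=> x _; rewrite derive1E; apply: derive_val.
Qed.

Definition expi k (x : R) : R[i] := cexp (0 +i* (freq k * x)).

Lemma Re_expi k x : Re (expi k x) = cos (freq k * x).
Proof. by rewrite /expi /cexp/= expR0 mul1r. Qed.

Lemma Im_expi k x : Im (expi k x) = sin (freq k * x).
Proof. by rewrite /expi /cexp/= expR0 mul1r. Qed.

Lemma freqD k l : freq (k + l) = freq k + freq l :> R.
Proof. by rewrite /freq intrD mulrDr. Qed.

Lemma freqN k : freq (- k) = - freq k :> R.
Proof. by rewrite /freq intrN mulrN. Qed.

Lemma freq_eq0 k : (freq k == 0 :> R) = (k == 0).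
Proof. by rewrite /freq !mulf_eq0 pnatr_eq0/= intr_eq0 gt_eqF// pi_gt0. Qed.

Lemma expiD k l x : expi (k + l) x = expi k x * expi l x.
Proof.
rewrite /expi -cexpD; congr cexp; apply: eqC; rewrite /= ?addr0//.
by rewrite freqD mulrDl.
Qed.

Lemma expi0 x : expi 0 x = 1.
Proof. by rewrite /expi /freq mulr0 mul0r cexp0. Qed.

Lemma expi_nat (n : nat) x : expi n%:Z x = expi 1 x ^+ n.
Proof.
elim: n => [|n IH]; first by rewrite expi0 expr0.
by rewrite exprSr -IH -expiD -PoszD addn1.
Qed.

Lemma expi_at1 k : expi k 1 = 1.
Proof.
have e1 : expi 1 1 = 1.
  by rewrite /expi /freq !mulr1 mulr_natl /cexp/= cos2pi sin2pi expR0 mulr1 mulr0.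
have en n : expi n%:Z 1 = 1 by rewrite expi_nat e1 expr1n.
case: k => n; first exact: en.
have := expiD n.+1%:Z (- n.+1%:Z) 1.
by rewrite subrr expi0 en mul1r => ->.
Qed.

Lemma expi_periodic k x : expi k (x + 1) = expi k x.
Proof.
rewrite -[RHS]mulr1 -(expi_at1 k) /expi -cexpD; congr cexp.
by apply: eqC; rewrite /= ?addr0// mulrDr.
Qed.

Lemma cabs_expi k x : cabs (expi k x) = 1.
Proof. by rewrite cabsE /expi sqnormc_cexp/= expR0 expr1n sqrtr1. Qed.

Lemma continuous_cosM (w : R) : continuous (fun x => cos (w * x)).
Proof.
by move=> x; apply: continuous_comp; [exact: mulrl_continuous|exact: continuous_cos].
Qed.

Lemma continuous_sinM (w : R) : continuous (fun x => sin (w * x)).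
Proof.
by move=> x; apply: continuous_comp; [exact: mulrl_continuous|exact: continuous_sin].
Qed.

Lemma measurable_Re_expi k (D : set (measurableTypeR R)) :
  measurable D -> measurable_fun D (fun x => Re (expi k x)).
Proof.
move=> mD; under eq_fun do rewrite Re_expi; apply: measurable_funTS.
exact: continuous_measurable_fun (@continuous_cosM _).
Qed.

Lemma measurable_Im_expi k (D : set (measurableTypeR R)) :
  measurable D -> measurable_fun D (fun x => Im (expi k x)).
Proof.
move=> mD; under eq_fun do rewrite Im_expi; apply: measurable_funTS.
exact: continuous_measurable_fun (@continuous_sinM _).
Qed.

Lemma mu01 : mu `[0, 1] = 1%E.
Proof.
have := @lebesgue_measure_itv R `[0, 1]%R.
by rewrite /= lte_fin ltr01 oppr0 adde0.
Qed.

Lemma cintegral_expi k : cintegral `[0, 1] (expi k) = (k == 0)%:R.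
Proof.
have [->|k0] := eqVneq k 0.
  rewrite (eq_cintegral (m := fun=> 1)); last by move=> x _; exact: expi0.
  rewrite /cintegral/= !Rintegral_cst// mul0r.
  by rewrite [X in fine X](_ : _ = 1%E) ?mul1r//; exact: mu01.
have w0 : freq k != 0 :> R by rewrite freq_eq0.
have /(congr1 (@complex.Re R)) := expi_at1 k; rewrite Re_expi mulr1 /= => cos1.
have /(congr1 (@complex.Im R)) := expi_at1 k; rewrite Im_expi mulr1 /= => sin1.
have h1 : Rintegral mu `[0, 1] (fun x => Re (expi k x)) = 0.
  under eq_Rintegral do rewrite Re_expi.
  have dF (x : R) : is_derive x (1 : R) 
      (fun x : R => (freq k)^-1 * sin (freq k * x)) (cos (freq k * x)).
    apply: is_derive_eq; rewrite /GRing.scale/= !mulr1.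
    by rewrite mulrCA mulVf ?mulr1.
  rewrite (Rintegral_FTC2 ler01 dF); last exact: continuous_cosM.
  by rewrite mulr1 sin1 !mulr0 sin0 mulr0 subrr.
have h2 : Rintegral mu `[0, 1] (fun x => Im (expi k x)) = 0.
  under eq_Rintegral do rewrite Im_expi.
  have dF (x : R) : is_derive x (1 : R) 
      (fun x : R => - (freq k)^-1 * cos (freq k * x)) (sin (freq k * x)).
    apply: is_derive_eq; rewrite /GRing.scale/= !mulr1.
    by field.
  rewrite (Rintegral_FTC2 ler01 dF); last exact: continuous_sinM.
  by rewrite mulr1 cos1 !mulr0 cos0 mulr1 subrr.
by rewrite /cintegral h1 h2.
Qed.

End Trigonometric.

(** * Injectivity of the Fourier coefficients on integrable functions *)

Section FourierInjectivity.
Context {R : realType}.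
Local Notation mu := (@lebesgue_measure R).
Local Notation I01 := (`[0, 1]%classic : set (measurableTypeR R)).

Lemma measurable_I01 : measurable I01.
Proof. exact: measurable_itv. Qed.
Hint Resolve measurable_I01 : core.

Lemma bernoulli_le (x : R) n : -1 <= x -> 1 + n%:R * x <= (1 + x) ^+ n.
Proof.
move=> x1; elim: n => [|n IH]; first by rewrite mul0r addr0 expr0.
rewrite exprS; apply: (@le_trans _ _ ((1 + x) * (1 + n%:R * x))).
  rewrite -subr_ge0 -natr1 (_ : _ - _ = n%:R * (x * x)); last by ring.
  by rewrite mulr_ge0// -expr2 sqr_ge0.
by rewrite ler_wpM2l// addrC -lerBlDr sub0r.
Qed.

Lemma cvg_expr0 (z : R) : 0 <= z -> z < 1 -> (fun n => z ^+ n) @ \oo --> (0 : R).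
Proof. by move=> z0 z1; apply: cvg_expr; rewrite ger0_norm. Qed.

(* The polynomials of Brosowski and Deutsch: their limit is the indicator of p < 1/2. *)
Lemma cvg_step_lt (p : R) : 0 <= p -> p < 2^-1 ->
  (fun n => (1 - p ^+ n) ^+ (2 ^ n)) @ \oo --> (1 : R).
Proof.
move=> p0 p1; have p1' : p <= 1 by lra.
have pn n : 0 <= p ^+ n <= 1 by rewrite exprn_ge0// exprn_ile1.
have l : (fun n => 1 - (2 * p) ^+ n) @ \oo --> (1 : R).
  rewrite -[X in _ --> X]subr0; apply: cvgB; first exact: cvg_cst.
  by apply: cvg_expr0; lra.
apply: (@squeeze_cvgr _ _ _ _ (fun n => 1 - (2 * p) ^+ n) (cst 1)); [|exact: l|exact: cvg_cst].
apply: nearW => n; apply/andP; split.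
  have := @bernoulli_le (- p ^+ n) (2 ^ n).
  rewrite natrX mulrN -exprMn; apply; have := pn n; lra.
by have := pn n => /andP[? ?]; rewrite exprn_ile1//; lra.
Qed.

Lemma cvg_step_gt (p : R) : p <= 1 -> 2^-1 < p ->
  (fun n => (1 - p ^+ n) ^+ (2 ^ n)) @ \oo --> (0 : R).
Proof.
move=> p1 p2; have p0 : 0 <= p by lra.
have pn n : 0 <= p ^+ n <= 1 by rewrite exprn_ge0// exprn_ile1.
have l : (fun n => (2 * p)^-1 ^+ n) @ \oo --> (0 : R).
  apply: cvg_expr0; first by rewrite invr_ge0; lra.
  by rewrite invf_lt1; lra.
apply: (@squeeze_cvgr _ _ _ _ (cst 0) (fun n => (2 * p)^-1 ^+ n)); [|exact: cvg_cst|exact: l].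
apply: nearW => n; apply/andP; split.
  by apply: exprn_ge0; have := pn n; lra.
have p2n : 0 < (2 * p) ^+ n by apply: exprn_gt0; lra.
rewrite exprVn -[leRHS]mul1r ler_pdivlMr//.
(* Bernoulli bounds (1 + p^n)^(2^n) below by (2 p)^n, while (1 - p^n)(1 + p^n) <= 1 bounds the
   product of the two powers by 1. *)
apply: (@le_trans _ _ ((1 - p ^+ n) ^+ (2 ^ n) * (1 + p ^+ n) ^+ (2 ^ n))).
  rewrite ler_wpM2l//; first by apply: exprn_ge0; have := pn n; lra.
  have := @bernoulli_le (p ^+ n) (2 ^ n); rewrite natrX -exprMn => h.
  apply: le_trans (h _); first by lra.
  by have := pn n; lra.
have /andP[q0 q1] := pn n; have qq := mulr_ge0 q0 q0.
by rewrite -exprMn; apply: exprn_ile1; nra.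
Qed.

Variable a : R -> R.
Hypothesis ia : rintegrable I01 a.
Hypothesis acos : forall k, Rintegral mu I01 (fun x => cos (freq k * x) * a x) = 0.
Hypothesis asin : forall k, Rintegral mu I01 (fun x => sin (freq k * x) * a x) = 0.

(** The bounded continuous h such that all Fourier coefficients of h a vanish. The arbitrary phase
    [th] merges cosine and sine tests and makes the class stable under multiplication by a shifted
    cosine, through the product formula, hence under polynomials in it. *)
Let multiplier (h : R -> R) := [/\ continuous h, exists M, forall x, `|h x| <= M &
  forall (k : int) (th : R),
    Rintegral mu I01 (fun x => h x * cos (freq k * x + th) * a x) = 0].

Let cosp (k : int) (th x : R) : R := cos (freq k * x + th).

Let continuous_cosp k th : continuous (cosp k th).
Proof.
move=> x; apply: continuous_comp; last exact: continuous_cos.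
by apply: cvgD; [exact: mulrl_continuous|exact: cvg_cst].
Qed.

Let rint_mul (h : R -> R) (M : R) : continuous h -> (forall x, `|h x| <= M) ->
  rintegrable I01 (fun x => h x * a x).
Proof.
move=> hc hM; apply: (@rintegrable_mul _ _ _ _ M) => //.
by apply: measurable_funTS; exact: continuous_measurable_fun.
Qed.

Let rint_mul_cosp (h : R -> R) (M : R) k th : continuous h ->
  (forall x, `|h x| <= M) -> rintegrable I01 (fun x => h x * cosp k th x * a x).
Proof.
move=> hc hM; apply: (@rint_mul (fun x => h x * cosp k th x) M) => x.
  by apply: cvgM; [exact: hc|exact: continuous_cosp].
rewrite normrM; apply: le_trans (hM x).
by rewrite ler_piMr// cos_max.
Qed.

Let multiplier1 : multiplier (fun=> 1).
Proof.
split=> [x||k th]; first exact: cvg_cst.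
  by exists 1 => x; rewrite normr1.
have i1 : rintegrable I01 (fun x => cos (freq k * x) * a x).
  apply: (@rint_mul _ 1); [exact: continuous_cosM|by move=> x; exact: cos_max].
have i2 : rintegrable I01 (fun x => sin (freq k * x) * a x).
  apply: (@rint_mul _ 1); [exact: continuous_sinM|by move=> x; exact: sin_max].
transitivity (Rintegral mu I01 (fun x => cos th * (cos (freq k * x) * a x) -
    sin th * (sin (freq k * x) * a x))).
  by apply: eq_Rintegral => x _; rewrite cosD; ring.
rewrite RintegralB//; try exact: rintegrableZ.
by rewrite !RintegralZl// acos asin !mulr0 subrr.
Qed.

Let multiplierD h g (r : R) : multiplier h -> multiplier g ->
  multiplier (fun x => h x + r * g x).
Proof.
move=> [hc [M hM] h0] [gc [N gN] g0]; split=> [x||k th].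
- by apply: cvgD; [exact: hc|apply: cvgMl_tmp; exact: gc].
- exists (M + `|r| * N) => x; apply: le_trans (ler_normD _ _) _.
  by rewrite lerD// normrM ler_wpM2l.
transitivity (Rintegral mu I01 (fun x => h x * cos (freq k * x + th) * a x +
    r * (g x * cos (freq k * x + th) * a x))).
  by apply: eq_Rintegral => x _; ring.
rewrite RintegralD//; last 2 first.
- exact: rint_mul_cosp hc hM.
- by apply: rintegrableZ => //; exact: rint_mul_cosp gc gN.
rewrite h0 RintegralZl//; first by rewrite g0 mulr0 addr0.
exact: rint_mul_cosp gc gN.
Qed.

Let multiplier_cos h ph : multiplier h ->
  multiplier (fun x => h x * cosp 1 ph x).
Proof.
move=> [hc [M hM] h0]; split=> [x||k th].
- by apply: cvgM; [exact: hc|exact: continuous_cosp].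
- exists M => x; rewrite normrM; apply: le_trans (hM x).
  by rewrite ler_piMr// cos_max.
transitivity (Rintegral mu I01 (fun x =>
    2^-1 * (h x * cosp (k + 1) (th + ph) x * a x) +
    2^-1 * (h x * cosp (k - 1) (th - ph) x * a x))).
  apply: eq_Rintegral => x _; rewrite /cosp !freqD freqN.
  rewrite (_ : (freq k + freq 1) * x + (th + ph) =
    (freq k * x + th) + (freq 1 * x + ph)); last by ring.
  rewrite (_ : (freq k - freq 1) * x + (th - ph) =
    (freq k * x + th) - (freq 1 * x + ph)); last by ring.
  by move: (freq k * x + th) (freq 1 * x + ph) => A B; rewrite cosD cosB; field.
have i1 l t := rint_mul_cosp l t hc hM.
rewrite RintegralD//; try exact: rintegrableZ.
rewrite !RintegralZl//; try exact: i1.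
by rewrite [X in _ * X + _]h0 [X in _ + _ * X]h0 !mulr0 addr0.
Qed.

Let multiplier_poly (q : {poly R}) ph : multiplier (fun x => q.[cosp 1 ph x]).
Proof.
elim/poly_ind: q => [|q r IH].
  have -> : (fun x => (0 : {poly R}).[cosp 1 ph x]) = (fun x => 1 + (-1) * 1).
    by apply/funext => x; rewrite horner0 mulr1 subrr.
  by apply: multiplierD; exact: multiplier1.
have -> : (fun x => (q * 'X + r%:P).[cosp 1 ph x]) =
    (fun x => q.[cosp 1 ph x] * cosp 1 ph x + r * 1).
  by apply/funext => x; rewrite !hornerE.
by apply: multiplierD; [exact: multiplier_cos|exact: multiplier1].
Qed.

(** On the circle, [0, y] is the arc centred at y / 2 where cos (2 pi x - pi y) >= cos (pi y). The
    affine function [p] of that cosine takes values in [0, 1] and is below 1/2 exactly inside the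
    arc, so the trigonometric polynomials [h n], bounded by 1, converge almost everywhere to the
    indicator of the arc. *)
Let integral_initial (y : R) : 0 < y < 1 -> Rintegral mu `[0, y] a = 0.
Proof.
move=> /andP[y0 y1].
pose p x := 2^-1 + 4^-1 * (cos (pi * y) - cosp 1 (- (pi * y)) x).
have p01 x : 0 <= p x <= 1.
  have := cos_max (pi * y); have := cos_max (freq 1 * x - pi * y).
  by rewrite /p /cosp !ler_norml; lra.
pose h n x := (1 - p x ^+ n) ^+ (2 ^ n).
have hmul n : multiplier (h n).
  pose P : {poly R} := (2^-1 + 4^-1 * cos (pi * y))%:P - 4^-1 *: 'X.
  have -> : h n = (fun x => ((1 - P ^+ n) ^+ (2 ^ n)).[cosp 1 (- (pi * y)) x]).
    apply/funext => x; rewrite !(hornerE, horner_exp) /h /p.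
    by congr ((1 - _ ^+ _) ^+ _); ring.
  exact: multiplier_poly.
have h01 n x : 0 <= h n x <= 1.
  have /andP[? ?] := p01 x; have ? : 0 <= p x ^+ n <= 1 by rewrite exprn_ge0// exprn_ile1.
  by rewrite /h exprn_ge0 ?exprn_ile1//; lra.
have h0 n : Rintegral mu I01 (fun x => h n x * a x) = 0.
  have [_ _ /(_ 0 0) hn] := hmul n; rewrite -[RHS]hn.
  by apply: eq_Rintegral => x _; rewrite /freq mulr0 mul0r addr0 cos0 mulr1.
have mh n : measurable_fun I01 (h n).
  by apply: measurable_funTS; apply: continuous_measurable_fun; have [] := hmul n.
pose chi (x : R) : R := (x <= y)%R%:R.
have mchi : measurable_fun I01 chi.
  rewrite (_ : chi = \1_(`]-oo, y])); first exact: measurable_indic.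
  by apply/funext => x; rewrite indicE mem_setE in_itv.
have ma := rintegrable_measurable ia.
have lim : {ae mu, forall x, I01 x ->
    (fun n => h n x * a x) @ \oo --> chi x * a x}.
  (* The points of [0, 1] where p = 1/2; there (1 - p^n)^(2^n) tends to 1/e instead of 0 or 1. *)
  exists [set (0 : R); y; 1]; split.
  - by do 2?apply: measurableU; exact: measurable_set1.
  - exact/countable_lebesgue_measure0/finite_set_countable.
  move=> x /= /not_implyP[]; rewrite in_itv/= => /andP[x0 x1]; apply: contra_notP => xN.
  have {}x0 : 0 < x by rewrite lt0r x0 andbT; apply/eqP => xE; apply: xN; left; left.
  have {}x1 : x < 1 by rewrite lt_neqAle x1 andbT; apply/eqP => xE; apply: xN; right.
  have pi0 := pi_gt0 R.
  have sx : 0 < sin (pi * x) by apply: sin_gt0_pi; rewrite mulr_gt0//= gtr_pMr.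
  (* The factor sin (pi x) is positive on (0, 1), so the position of p relative to 1/2 is decided by
     the sign of y - x. *)
  have pE : p x = 2^-1 - 2^-1 * (sin (pi * x) * sin (pi * (y - x))).
    rewrite /p /cosp (_ : freq 1 * x - pi * y = pi * x - pi * (y - x)); last first.
      by rewrite /freq; ring.
    rewrite (_ : pi * y = pi * x + pi * (y - x)); last by ring.
    by move: (pi * x) (pi * (y - x)) => A B; rewrite cosD cosB; field.
  apply: cvgMr_tmp; rewrite /chi; have [xy|yx|xy] := ltgtP x y; last by case: xN; left; right.
    apply: cvg_step_lt; first by have /andP[] := p01 x.
    have : 0 < sin (pi * (y - x)).
      by apply: sin_gt0_pi; rewrite mulr_gt0 ?subr_gt0//= gtr_pMr//; lra.
    by rewrite pE; nra.
  apply: cvg_step_gt; first by have /andP[] := p01 x.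
  have : 0 < sin (pi * (x - y)).
    by apply: sin_gt0_pi; rewrite mulr_gt0 ?subr_gt0//= gtr_pMr//; lra.
  by rewrite pE -opprB mulrN sinN; nra.
have bound : {ae mu, forall x, I01 x -> forall n, `|h n x * a x| <= `|a x|}.
  apply: aeW => x _ n; rewrite normrM ler_piMl//.
  by have /andP[? ?] := h01 n x; rewrite ger0_norm.
have [_ /(cvg_lim (@Rhausdorff R))] := cvg_Rintegral_dominated measurable_I01
  (fun n => measurable_funM (mh n) ma) (measurable_funM mchi ma) lim
  (integrable_norm ia) bound.
rewrite (_ : (fun n => _) = fun=> 0); last by apply/funext.
rewrite lim_cst; last exact: Rhausdorff.
move=> /esym e; rewrite -[RHS]e Rintegral_mkcond [RHS]Rintegral_mkcond.
apply: eq_Rintegral => x _; rewrite !patchE !mem_setE !in_itv/= /chi.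
have [x0|//] := leP 0 x; have [xy|yx] /= := leP x y.
  by rewrite (le_trans xy (ltW y1)) mul1r.
by case: ifP => //; rewrite mul0r.
Qed.

(** The integrals over all [0, y] vanish, so the primitive of [a] is constant on (0, 1), and
    Lebesgue differentiation returns [a] almost everywhere. *)
Lemma fourier_injective : {ae mu, forall x, I01 x -> a x = 0}.
Proof.
pose b := a \_ I01.
have ib : rintegrable setT b.
  by have := ia; rewrite /rintegrable integrable_mkcond//; apply: eq_integrable => // x _;
    rewrite /b /= restrict_EFin.
have bi (y : R) : mu.-integrable [set` Interval (BLeft 0) (BRight y)] (EFin \o b).
  exact: integrableS ib.
have bl : locally_integrable [set: R] b.
  by apply: integrable_locally ia; exact: measurable_I01.
have N : mu [set (0 : R); 1] = 0.
  exact/countable_lebesgue_measure0/finite_set_countable.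
have mN : measurable ([set (0 : R); 1] : set (measurableTypeR R)).
  by apply: measurableU; exact: measurable_set1.
have aeN : {ae mu, forall x, x != 0 /\ x != 1}.
  exists [set (0 : R); 1]; split => // x /= /not_andP[] /negP; rewrite negbK => /eqP ->.
    by left.
  by right.
apply: (@filterS2 _ _ (ae_filter_ringOfSetsType mu) _ _ _ _ aeN (FTC1 bi bl)) => x [x0 x1] dF.
rewrite /= in_itv/= => /andP[x0' x1'].
have {}x0 : 0 < x by rewrite lt0r x0.
have {}x1 : x < 1 by rewrite lt_neqAle x1.
have [|_] := dF _; first by rewrite /= lte_fin.
rewrite {2}/b patchE mem_setE in_itv/= (ltW x0) (ltW x1)/= => <-.
rewrite derive1E (near_eq_derive (g := cst 0)) ?derive_cst//.
near=> y; have y0 : 0 < y by near: y; exact: lt_nbhsr.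
have y1 : y < 1 by near: y; exact: lt_nbhsl.
rewrite -[RHS](integral_initial (y := y)) ?y0//.
apply: eq_Rintegral => z; rewrite !mem_setE in_itv/= => /andP[z0 zy].
by rewrite /b patchE mem_setE in_itv/= z0 (le_trans zy (ltW y1)).
Unshelve. all: by end_near. Qed.

End FourierInjectivity.

(** * Fourier coefficients of periodic complex functions *)

Section PeriodicFunctions.
Context {R : realType}.
Local Notation mu := (@lebesgue_measure R).
Local Notation Re := complex.Re.
Local Notation Im := complex.Im.
Local Notation I01 := (`[0, 1]%classic : set (measurableTypeR R)).
Implicit Types (c : @pdist R) (k : int) (g h : R -> R[i]).

Lemma fcoefE g k : fcoef g k = cintegral I01 (fun x => expi (- k) x * g x).
Proof.
apply: eq_cintegral => x _; congr (_ * _); rewrite /expi freqN mulNr//.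
Qed.

Lemma cintegrable_expiM g k : cintegrable I01 g ->
  cintegrable I01 (fun x => expi k x * g x).
Proof.
apply: (@cintegrable_mul _ _ _ _ 1) => //.
- exact: measurable_Re_expi.
- exact: measurable_Im_expi.
- by move=> x _; rewrite cabs_expi.
Qed.

Lemma fcoefB g h k : cintegrable I01 g -> cintegrable I01 h ->
  fcoef (fun x => g x - h x) k = fcoef g k - fcoef h k.
Proof.
move=> gi hi; rewrite !fcoefE -cintegralB; try exact: cintegrable_expiM.
  by apply: eq_cintegral => x _; rewrite mulrBr.
exact: measurable_I01.
Qed.

(** The cosine integral is even in k and the sine integral odd. The coefficients at k and - k
    therefore decouple into vanishing cosine and sine integrals of the real and of the imaginary
    part. *)
Lemma fcoef_eq0 g : cintegrable I01 g -> (forall k, fcoef g k = 0) ->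
  {ae mu, forall x, I01 x -> g x = 0}.
Proof.
move=> [gi1 gi2] g0; have mI := @measurable_I01 R.
have ic k (a : R -> R) : rintegrable I01 a -> rintegrable I01 (fun x => cos (freq k * x) * a x).
  apply: (@rintegrable_mul _ _ _ _ 1) => //; last by move=> x _; exact: cos_max.
  by apply: measurable_funTS; exact: continuous_measurable_fun (@continuous_cosM _ _).
have isn k (a : R -> R) : rintegrable I01 a -> rintegrable I01 (fun x => sin (freq k * x) * a x).
  apply: (@rintegrable_mul _ _ _ _ 1) => //; last by move=> x _; exact: sin_max.
  by apply: measurable_funTS; exact: continuous_measurable_fun (@continuous_sinM _ _).
pose C k (a : R -> R) := Rintegral mu I01 (fun x => cos (freq k * x) * a x).
pose S k (a : R -> R) := Rintegral mu I01 (fun x => sin (freq k * x) * a x).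
have CN k a : C (- k) a = C k a.
  by apply: eq_Rintegral => x _; rewrite freqN mulNr cosN.
have SN k a : rintegrable I01 a -> S (- k) a = - S k a.
  move=> ia; rewrite -[RHS]mulN1r /S -RintegralZl//; last exact: isn.
  by apply: eq_Rintegral => x _; rewrite freqN mulNr sinN mulN1r mulNr.
have e1 k : C k (fun x => Re (g x)) - S k (fun x => Im (g x)) = 0.
  have := g0 (- k); rewrite fcoefE opprK => /(congr1 (@complex.Re R)) /= e.
  rewrite -[RHS]e /C /S -RintegralB//; [|exact: ic|exact: isn].
  by apply: eq_Rintegral => x _; rewrite ReM Re_expi Im_expi.
have e2 k : C k (fun x => Im (g x)) + S k (fun x => Re (g x)) = 0.
  have := g0 (- k); rewrite fcoefE opprK => /(congr1 (@complex.Im R)) /= e.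
  rewrite -[RHS]e /C /S -RintegralD//; [|exact: ic|exact: isn].
  by apply: eq_Rintegral => x _; rewrite ImM Re_expi Im_expi.
have a1 : {ae mu, forall x, I01 x -> Re (g x) = 0}.
  apply: fourier_injective => // k; have h1 := e1 k; have h2 := e1 (- k);
    have h3 := e2 k; have h4 := e2 (- k);
    rewrite CN SN// in h2; rewrite CN SN// in h4;
    rewrite -/(C k (fun x => Re (g x))) -/(S k (fun x => Re (g x))); lra.
have a2 : {ae mu, forall x, I01 x -> Im (g x) = 0}.
  apply: fourier_injective => // k; have h1 := e1 k; have h2 := e1 (- k);
    have h3 := e2 k; have h4 := e2 (- k);
    rewrite CN SN// in h2; rewrite CN SN// in h4;
    rewrite -/(C k (fun x => Im (g x))) -/(S k (fun x => Im (g x))); lra.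
apply: (@filterS2 _ _ (ae_filter_ringOfSetsType mu) _ _ _ _ a1 a2) => x h1 h2 Ix.
by apply: eqC; [exact: h1|exact: h2].
Qed.

Lemma fcoef_inj g h : cintegrable I01 g -> cintegrable I01 h ->
  fcoef g = fcoef h -> {ae mu, forall x, I01 x -> g x = h x}.
Proof.
move=> gi hi gh; have mI := @measurable_I01 R.
have := @fcoef_eq0 (fun x => g x - h x) (cintegrableB mI gi hi).
have ae0 : forall k, fcoef (fun x => g x - h x) k = 0.
  by move=> k; rewrite fcoefB// gh subrr.
move=> /(_ ae0); apply: filterS => x gh0 Ix.
by apply/eqP; rewrite -subr_eq0 gh0.
Qed.

Lemma lebesgue_measure_translation (c : R) (A : set (measurableTypeR R)) :
  measurable A ->
  pushforward mu (+%R^~ c : _ -> measurableTypeR R) A = mu A.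
Proof.
have mc : measurable_fun setT (+%R^~ c : measurableTypeR R -> measurableTypeR R).
  by apply: continuous_measurable_fun => x; apply: cvgD; [exact: cvg_id|exact: cvg_cst].
move=> mA; apply/esym/lebesgue_measure_unique => //= _ [[a b]] _ <-.
rewrite /pushforward (_ : _ @^-1` _ = `](a - c), (b - c)]%classic); last first.
  by apply/seteqP; split=> x /=; rewrite !in_itv/= ltrBlDr lerBrDr.
rewrite !lebesgue_measure_itv/= !lte_fin ltrD2r; case: ifP => // _.
by rewrite -!EFinB; congr EFin; ring.
Qed.

(** By periodicity every exceptional point is an integer translate of one in [0, 1]; translation
    invariance makes the countable union of translates null. *)
Lemma ae_periodic (P : R -> Prop) : (forall x, P (x + 1) <-> P x) ->
  {ae mu, forall x, I01 x -> P x} -> {ae mu, forall x, P x}.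
Proof.
move=> PP [N [mN N0 PN]].
have Pn (n : nat) x : P (x + n%:R) <-> P x.
  elim: n x => [|n IH] x; first by rewrite addr0.
  by rewrite -natr1 addrA PP IH.
pose T (r : R) : set (measurableTypeR R) := (+%R^~ r : R -> measurableTypeR R) @^-1` N.
have mT (r : R) : measurable (T r).
  rewrite -[T r]setTI; apply: continuous_measurable_fun mN => //.
  by move=> x; apply: cvgD; [exact: cvg_id|exact: cvg_cst].
have TN (r : R) : mu.-negligible (T r).
  by exists (T r); split => //; have := lebesgue_measure_translation r mN; rewrite N0.
apply: (@negligibleS _ _ _ mu ((\bigcup_n T n%:R) `|` (\bigcup_n T (- n%:R)))); last first.
  by apply: negligibleU; exact: negligible_bigcup.
move=> x /= nPx.
have [n [xn|xn]] : exists n : nat, I01 (x + n%:R) \/ I01 (x - n%:R).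
  have /andP[f1 f2] := mem_rg1_floor x.
  case E : (Num.floor x) => [n|n].
    exists n; right; rewrite /= in_itv/=; move: f1 f2; rewrite E; lra.
  exists n.+1; left; rewrite /= in_itv/=; move: f1 f2.
  by rewrite E NegzE intrN; lra.
- left; exists n => //; apply: PN => /= h; apply: nPx; exact/(Pn n)/h.
- right; exists n => //; apply: PN => /= h; apply: nPx.
  by rewrite -(subrK n%:R x); apply/Pn/h.
Qed.

End PeriodicFunctions.

(** * Convolution of coefficient sequences *)

Section Convolution.
Context {R : realType}.
Local Notation Re := complex.Re.
Local Notation Im := complex.Im.
Local Notation cabs := (@Normc.normc R).
Implicit Types (c d : @pdist R) (ell : R) (s : seq int) (j k l : int).

Definition trunc s c : @pdist R := fun k => if k \in s then c k else 0.

Lemma wabs_trunc_le ell s c k : wabs ell (trunc s c) k <= wabs ell c k.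
Proof.
rewrite !wabsE ler_wpM2l ?sqrtr_ge0// /trunc; case: ifP => // _.
by rewrite cabs0 cabs_ge0.
Qed.

Lemma Hnorm_trunc_le ell s c : (Hnorm ell (trunc s c) <= Hnorm ell c)%E.
Proof.
rewrite -[leRHS]mul1e; apply: Hnorm_le_wabs => // k.
by rewrite mul1r wabs_trunc_le.
Qed.

Lemma Hnorm_tail_le ell s c : (Hnorm ell (c \- trunc s c)%R <= Hnorm ell c)%E.
Proof.
rewrite -[leRHS]mul1e; apply: Hnorm_le_wabs => // k.
rewrite mul1r !wabsE ler_wpM2l ?sqrtr_ge0// /trunc/=; case: ifP => _.
  by rewrite subrr cabs0 cabs_ge0.
by rewrite subr0.
Qed.

(** The squared tail beyond the n-th window is at most the limit of the bounded increasing window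
    sums minus the n-th of them. *)
Lemma cvg_Hnorm_tail ell c : (Hnorm ell c < +oo)%E ->
  (fun n => Hnorm ell (c \- trunc (win n) c)) @ \oo --> 0%E.
Proof.
move=> /Hnorm_finP[M M0 cM].
pose A n := \sum_(k <- win n) wabs ell c k ^+ 2.
have Aub n : A n <= M ^+ 2 by move: n; apply/Hnorm_winP; rewrite ?cM.
have And : nondecreasing_seq A.
  move=> m n mn; apply: ler_sum_sub; [|exact: win_uniq|exact: sub_win].
  by move=> k; exact: sqr_ge0.
have Acvg : A @ \oo --> limn A.
  by apply: nondecreasing_is_cvgn => //; exists (M ^+ 2) => _ [n _ <-].
set a := limn A in Acvg.
have Aa n : A n <= a by apply: nondecreasing_cvgn_le => //; apply: cvgP Acvg.
have le n : (Hnorm ell (c \- trunc (win n) c)%R <= (Num.sqrt (a - A n))%:E)%E.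
  apply/Hnorm_leP => [|s us]; first exact: sqrtr_ge0.
  rewrite sqr_sqrtr ?subr_ge0//.
  have [N sN] := seq_sub_win (s ++ win n).
  rewrite (eq_bigr (fun k => if k \in win n then 0 else wabs ell c k ^+ 2)); last first.
    move=> k _; rewrite !wabsE /trunc/=; case: ifP => _; last by rewrite subr0.
    by rewrite subrr cabs0 mulr0 expr0n.
  rewrite lerBrDr; apply: le_trans (Aa N).
  apply: (@le_trans _ _ (\sum_(k <- win N)
     (if k \in win n then 0 else wabs ell c k ^+ 2) + A n)).
    rewrite lerD2r; apply: ler_sum_sub => // [k|k ks].
      by case: ifP => // _; exact: sqr_ge0.
    by apply: sN; rewrite mem_cat ks.
  have -> : A n = \sum_(k <- win N) (if k \in win n then wabs ell c k ^+ 2 else 0).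
    rewrite -big_mkcond -big_filter; apply: perm_big; apply: uniq_perm.
    - exact: win_uniq.
    - by rewrite filter_uniq// win_uniq.
    - move=> k; rewrite mem_filter; case kn : (k \in win n) => //=.
      by apply/esym/sN; rewrite mem_cat kn orbT.
  rewrite -big_split/= le_eqVlt; apply/orP; left; apply/eqP; apply: eq_bigr => k _.
  by case: ifP; rewrite ?addr0 ?add0r.
have h : (fun n => (Num.sqrt (a - A n))%:E) @ \oo --> 0%E.
  apply: cvg_EFin; first exact: nearW.
  rewrite -[X in _ --> X]sqrtr0 -(subrr a).
  apply: continuous_cvg; first exact: sqrt_continuous.
  by apply: cvgB; [exact: cvg_cst|exact: Acvg].
apply: squeeze_cvge (cvg_cst 0%E) h; apply: nearW => n.
by rewrite Hnorm_ge0 le.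
Qed.

(** The coefficients of the product of two trigonometric polynomials with modes in s. Keeping both
    indices in s makes it symmetric as well as bilinear, so that differences of squares factor. *)
Definition conv s c d : @pdist R := fun k =>
  \sum_(j <- s) \sum_(l <- s) c j * d l * ((j + l)%R == k)%:R.

(** A Peetre-type inequality: 1 + (a + b)^2 <= 2 (1 + a^2)(1 + b^2), with defect 1 + (a - b)^2 + 2
    (a b)^2, raised to the power ell >= 0. *)
Lemma weightD_le ell j l : 0 <= ell ->
  weight ell (j + l) <= 2 `^ ell * (weight ell j * weight ell l) :> R.
Proof.
move=> ell0; rewrite /weight freqD; move: (freq j) (freq l) => a b.
have pos x : 0 <= 1 + x ^+ 2 :> R by rewrite addr_ge0// sqr_ge0.
rewrite -!powRM ?mulr_ge0//; apply: ge0_ler_powR => //; rewrite ?nnegrE ?mulr_ge0//.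
rewrite -subr_ge0 [leRHS](_ : _ = 1 + (a - b) ^+ 2 + 2 * (a * b) ^+ 2); last by ring.
by apply: addr_ge0; [apply: addr_ge0|apply: mulr_ge0] => //; exact: sqr_ge0.
Qed.

Lemma sqrt_weightD_le ell j l : 0 <= ell ->
  Num.sqrt (weight ell (j + l)) <=
    Num.sqrt (2 `^ ell) * (Num.sqrt (weight ell j) * Num.sqrt (weight ell l)) :> R.
Proof.
move=> ell0; rewrite -!sqrtrM ?powR_ge0 ?weight_ge0//.
by rewrite ler_wsqrtr// weightD_le.
Qed.

(* The convolution of two elements of [H^ell] is only bounded, but the two
   derivatives gained by the resolvent make it square summable. *)
Lemma conv_le ell s c d k (A B : R) : 0 <= ell -> uniq s -> 0 <= A -> 0 <= B ->
  (Hnorm ell c <= A%:E)%E -> (Hnorm ell d <= B%:E)%E ->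
  wabs ell (conv s c d) k <= Num.sqrt (2 `^ ell) * (A * B).
Proof.
move=> ell0 us A0 B0 cA dB; rewrite wabsE.
set K := Num.sqrt (2 `^ ell); have K0 : 0 <= K by exact: sqrtr_ge0.
(* For given j only l = k - j contributes, provided it lies in s. The map j to k - j is injective,
   so the bound on d still applies to the reindexed sum. *)
pose dk j := if k - j \in s then wabs ell d (k - j) else 0.
apply: (@le_trans _ _ (K * \sum_(j <- s) wabs ell c j * dk j)); last first.
  rewrite ler_wpM2l//; apply: cauchy_schwarz_sum => //.
    by move: s us {dk}; exact/Hnorm_leP.
  apply: (@le_trans _ _ (\sum_(j <- [seq k - i | i <- s]) wabs ell d j ^+ 2)).
    rewrite big_map; apply: ler_sum => j _; rewrite /dk; case: ifP => // _.
    by rewrite expr0n sqr_ge0.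
  have : uniq [seq k - i | i <- s].
    by rewrite map_inj_uniq// => i i' /addrI/oppr_inj.
  by move: [seq k - i | i <- s]; exact/Hnorm_leP.
apply: le_trans (ler_wpM2l (sqrtr_ge0 _) (cabs_sum _ _ _)) _.
rewrite !mulr_sumr; apply: ler_sum => j _.
have -> : \sum_(l <- s) c j * d l * ((j + l)%R == k)%:R =
    if k - j \in s then c j * d (k - j) else 0.
  case: ifPn => kjs.
    rewrite (bigD1_seq (k - j))//= [j + (k - j)]addrC subrK eqxx mulr1 big1 ?addr0// => l lk.
    rewrite [_ == _](_ : _ = false) ?mulr0//; apply: contraNF lk => /eqP <-.
    by rewrite [j + l]addrC addrK.
  rewrite big_seq big1// => l ls.
  rewrite [_ == _](_ : _ = false) ?mulr0//; apply: contraNF kjs => /eqP <-.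
  by rewrite [j + l]addrC addrK.
rewrite /dk; case: ifP => _; last by rewrite cabs0 !mulr0.
rewrite cabsM !wabsE.
apply: (@le_trans _ _ (K * (Num.sqrt (weight ell j) * Num.sqrt (weight ell (k - j))) *
    (cabs (c j) * cabs (d (k - j))))).
  rewrite ler_wpM2r ?mulr_ge0 ?cabs_ge0//.
  by have := sqrt_weightD_le j (k - j) ell0; rewrite [j + (k - j)]addrC subrK.
by rewrite le_eqVlt; apply/orP; left; apply/eqP; ring.
Qed.

Lemma convDl s c c' d k :
  conv s (fun j => c j + c' j) d k = conv s c d k + conv s c' d k.
Proof.
rewrite /conv -big_split/=; apply: eq_bigr => j _.
by rewrite -big_split/=; apply: eq_bigr => l _; rewrite !mulrDl.
Qed.

Lemma convC s c d k : conv s c d k = conv s d c k.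
Proof.
rewrite /conv exchange_big/=; apply: eq_bigr => j _; apply: eq_bigr => l _.
by rewrite [l + j]addrC [c l * d j]mulrC.
Qed.

Lemma convNl s c d k : conv s (fun j => - c j) d k = - conv s c d k.
Proof.
rewrite /conv -sumrN; apply: eq_bigr => j _.
by rewrite -sumrN; apply: eq_bigr => l _; rewrite !mulNr.
Qed.

(** The factorization of a difference of squares, from which both the convergence of windowed
    squares and the Lipschitz bound of the nonlinearity follow. *)
Lemma conv_sqrB s c d k :
  conv s c c k - conv s d d k = conv s (c \- d) (c \+ d) k.
Proof.
rewrite [conv s (_ \- _) _ k]convDl convNl.
rewrite [conv s c (_ \+ _) k]convC [conv s d (_ \+ _) k]convC !convDl.
by rewrite [conv s d c k]convC; ring.
Qed.

(** Inside the larger window the smaller square is the square of a truncation, so [conv_sqrB] can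
    compare squares over two different windows. *)
Lemma conv_trunc n m c k : (m <= n)%N ->
  conv (win m) c c k = conv (win n) (trunc (win m) c) (trunc (win m) c) k.
Proof.
move=> mn.
have ext (F : int -> R[i]) : \sum_(j <- win m) F j =
    \sum_(j <- win n) if j \in win m then F j else 0.
  rewrite -big_mkcond -big_filter; apply: perm_big; apply: uniq_perm.
  - exact: win_uniq.
  - by rewrite filter_uniq// win_uniq.
  - move=> j; rewrite mem_filter; case jm : (j \in win m) => //=.
    by apply/esym; apply: (sub_win mn).
rewrite /conv ext; apply: eq_bigr => j _; case: ifPn => jm; last first.
  by rewrite big1// => l _; rewrite /trunc (negPf jm) !mul0r.
rewrite ext; apply: eq_bigr => l _; rewrite /trunc jm; case: ifP => // _.
by rewrite mulr0 mul0r.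
Qed.

Lemma conv_win_cauchy c m n k (A e : R) : (m <= n)%N -> 0 <= A -> 0 <= e ->
  (Hnorm 0 c <= A%:E)%E -> (Hnorm 0 (c \- trunc (win m) c)%R <= e%:E)%E ->
  cabs (conv (win n) c c k - conv (win m) c c k) <= e * (A + A).
Proof.
move=> mn A0 e0 cA ce; rewrite (conv_trunc c k mn) conv_sqrB.
have h := @conv_le 0 (win n) (c \- trunc (win m) c) (c \+ trunc (win m) c) k
  e (A + A) (lexx 0) (win_uniq n) e0 (addr_ge0 A0 A0) ce.
apply: le_trans (cabs_le_wabs _ _ (lexx 0)) _; apply: le_trans (h _) _.
  apply: le_trans (HnormD _ _ _) _; rewrite EFinD leeD//.
  exact: le_trans (Hnorm_trunc_le _ _ _) cA.
by rewrite powRr0 sqrtr1 mul1r.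
Qed.

Lemma cauchy_seq_cvg (u : nat -> R) :
  (forall e, 0 < e -> exists N, forall m n, (N <= m)%N -> (m <= n)%N ->
    `|u n - u m| < e) -> u @ \oo --> limn u.
Proof.
move=> h; apply: cauchy_cvg; apply: cauchy_exP => e e0; have [N hN] := h e e0.
exists (u N); exists N => // n /= Nn.
by rewrite /ball/= distrC hN.
Qed.

(* The Fourier coefficients of the square of a function with coefficients c. *)
Definition autoconv c : @pdist R := fun k =>
  limn (fun n => Re (conv (win n) c c k)) +i*
  limn (fun n => Im (conv (win n) c c k)).

Lemma cvg_autoconv c k : (Hnorm 0 c < +oo)%E ->
  (fun n => Re (conv (win n) c c k)) @ \oo --> Re (autoconv c k) /\
  (fun n => Im (conv (win n) c c k)) @ \oo --> Im (autoconv c k).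
Proof.
move=> cfin; have [A A0 cA] := Hnorm_finP cfin.
have h e : 0 < e -> exists N, forall m n, (N <= m)%N -> (m <= n)%N ->
    cabs (conv (win n) c c k - conv (win m) c c k) < e.
  move=> e0; pose r := e / (A + A + 1).
  have A1 : 0 < A + A + 1 by rewrite ltr_wpDl// addr_ge0.
  have r0 : 0 < r by rewrite divr_gt0.
  have /fine_cvgP[_ /cvgr0Pnorm_lt/(_ r r0)] := cvg_Hnorm_tail cfin.
  have tfin n : Hnorm 0 (c \- trunc (win n) c) \is a fin_num.
    by rewrite ge0_fin_numE ?Hnorm_ge0// (le_lt_trans (Hnorm_tail_le _ _ _)).
  move=> [N _ hN]; exists N => m n Nm mn.
  have := @conv_win_cauchy c m n k A r mn A0 (ltW r0); rewrite cA => /(_ (lexx _)) le.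
  apply: (le_lt_trans (le _)).
    rewrite -(fineK (tfin m)) lee_fin ltW//; apply: le_lt_trans (hN m Nm).
    by rewrite ler_norm.
  by rewrite /r mulrAC ltr_pdivrMr// ltr_pM2l// ltrDl.
split; apply: cauchy_seq_cvg => e e0; have [N hN] := h e e0; exists N => m n Nm mn;
  apply: le_lt_trans (hN m n Nm mn).
  by rewrite -ReN -ReD Re_le_cabs.
by rewrite -ImN -ImD Im_le_cabs.
Qed.

End Convolution.

(** * Riesz-Fischer theorem and the coefficients of a square *)

Section RieszFischer.
Context {R : realType}.
Local Notation mu := (@lebesgue_measure R).
Local Notation Re := complex.Re.
Local Notation Im := complex.Im.
Local Notation cabs := (@Normc.normc R).
Local Notation I01 := (`[0, 1]%classic : set (measurableTypeR R)).
Implicit Types (c : @pdist R) (s : seq int) (j k l : int) (g h : R -> R[i]).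

(** A total substitute for the limit: the upper limit is measurable in a parameter whether or not
    the sequence converges, and equals the limit when it does. *)
Definition relim (u : nat -> R) : R := fine (limn_esup (fun n => (u n)%:E)).

Lemma cvg_relim (u : nat -> R) (l : R) : u @ \oo --> l -> relim u = l.
Proof.
move=> ul; rewrite /relim.
have ulE : (fun n => (u n)%:E) @ \oo --> l%:E by apply: cvg_EFin => //; exact: nearW.
by rewrite is_cvg_limn_esupE ?(cvg_lim _ ulE)//; exact: cvgP ulE.
Qed.

Lemma measurable_relim (D : set (measurableTypeR R)) (u : nat -> R -> R) :
  (forall n, measurable_fun D (u n)) -> measurable_fun D (fun x => relim (u ^~ x)).
Proof.
move=> mu_; apply: (measurableT_comp (f := fine)) => //.
by apply: measurable_fun_limn_esup => n; exact/measurable_EFinP.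
Qed.

Definition cmeasurable (D : set (measurableTypeR R)) g :=
  measurable_fun D (fun x => Re (g x)) /\ measurable_fun D (fun x => Im (g x)).

Lemma cmeasurableM D g h : cmeasurable D g -> cmeasurable D h ->
  cmeasurable D (fun x => g x * h x).
Proof.
move=> [g1 g2] [h1 h2]; split.
  under eq_fun do rewrite ReM; apply: measurable_funB; exact: measurable_funM.
by under eq_fun do rewrite ImM; apply: measurable_funD; exact: measurable_funM.
Qed.

Lemma cmeasurableZ D (z : R[i]) g : cmeasurable D g ->
  cmeasurable D (fun x => z * g x).
Proof. by apply: cmeasurableM; split; exact: measurable_cst. Qed.

Lemma cvg_cintegral_dominated D (g_ : nat -> R -> R[i]) g (G : R -> R) :
  measurable D -> (forall n, cmeasurable D (g_ n)) -> cmeasurable D g ->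
  {ae mu, forall x, D x -> (fun n => Re (g_ n x)) @ \oo --> Re (g x) /\
                           (fun n => Im (g_ n x)) @ \oo --> Im (g x)} ->
  rintegrable D G -> {ae mu, forall x, D x -> forall n, cabs (g_ n x) <= G x} ->
  [/\ cintegrable D g,
    (fun n => Re (cintegral D (g_ n))) @ \oo --> Re (cintegral D g) &
    (fun n => Im (cintegral D (g_ n))) @ \oo --> Im (cintegral D g)].
Proof.
move=> mD mg_ [mg1 mg2] g_g iG g_G.
have [i1 c1] : rintegrable D (fun x => Re (g x)) /\
    (fun n => Rintegral mu D (fun x => Re (g_ n x))) @ \oo --> Rintegral mu D (fun x => Re (g x)).
  apply: (@cvg_Rintegral_dominated _ _ _ _ G) => //.
  - by move=> n; have [] := mg_ n.
  - by apply: filterS g_g => x h /h[].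
  - by apply: filterS g_G => x h /h{}h n; apply: le_trans (Re_le_cabs _) (h n).
have [i2 c2] : rintegrable D (fun x => Im (g x)) /\
    (fun n => Rintegral mu D (fun x => Im (g_ n x))) @ \oo --> Rintegral mu D (fun x => Im (g x)).
  apply: (@cvg_Rintegral_dominated _ _ _ _ G) => //.
  - by move=> n; have [] := mg_ n.
  - by apply: filterS g_g => x h /h[].
  - by apply: filterS g_G => x h /h{}h n; apply: le_trans (Im_le_cabs _) (h n).
by split.
Qed.

Definition tpoly s c (x : R) : R[i] := \sum_(k <- s) c k * expi k x.

Lemma tpoly_periodic s c x : tpoly s c (x + 1) = tpoly s c x.
Proof. by apply: eq_bigr => k _; rewrite expi_periodic. Qed.

Lemma cabs_tpoly_le s c x : cabs (tpoly s c x) <= \sum_(k <- s) cabs (c k).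
Proof.
apply: le_trans (cabs_sum _ _ _) _; apply: ler_sum => k _.
by rewrite cabsM cabs_expi mulr1.
Qed.

Lemma cmeasurable_expi D k : measurable D -> cmeasurable D (expi k).
Proof.
by move=> mD; split; [exact: measurable_Re_expi|exact: measurable_Im_expi].
Qed.

Lemma cmeasurable_tpoly D s c : measurable D -> cmeasurable D (tpoly s c).
Proof.
move=> mD; split.
  under eq_fun do rewrite Re_sum; apply: measurable_sum => k.
  by have [] := cmeasurableZ (c k) (cmeasurable_expi k mD).
under eq_fun do rewrite Im_sum; apply: measurable_sum => k.
by have [] := cmeasurableZ (c k) (cmeasurable_expi k mD).
Qed.

Lemma cintegrable_expi k : cintegrable I01 (expi k).
Proof.
have mI := @measurable_I01 R; have [m1 m2] := cmeasurable_expi k mI.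
have fin : (mu I01 < +oo)%E by rewrite mu01 ltry.
split; apply: (@rintegrable_bounded _ _ _ 1) => // x _.
  by rewrite Re_expi cos_max.
by rewrite Im_expi sin_max.
Qed.

Lemma cintegral_expiZ (z : R[i]) k :
  cintegral I01 (fun x => z * expi k x) = z * (k == 0)%:R.
Proof.
rewrite cintegralZ; [|exact: measurable_I01|exact: cintegrable_expi].
by congr (_ * _); exact: cintegral_expi.
Qed.

Lemma fcoef_tpoly s c k : uniq s -> fcoef (tpoly s c) k = trunc s c k.
Proof.
move=> us; have mI := @measurable_I01 R; rewrite fcoefE.
rewrite (eq_cintegral (m := fun x => \sum_(j <- s) c j * expi (j - k) x)); last first.
  move=> x _; rewrite /tpoly mulr_sumr; apply: eq_bigr => j _.
  by rewrite mulrCA -expiD addrC.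
rewrite cintegral_sum//; last by move=> j; apply: cintegrableZ => //; exact: cintegrable_expi.
rewrite /trunc; case: ifPn => ks.
  rewrite (bigD1_seq k)//= cintegral_expiZ subrr eqxx mulr1 big1 ?addr0// => j jk.
  by rewrite cintegral_expiZ subr_eq0 (negPf jk) mulr0.
rewrite big_seq big1// => j js; rewrite cintegral_expiZ subr_eq0.
by rewrite [_ == _](_ : _ = false) ?mulr0//; apply: contraNF ks => /eqP <-.
Qed.

Lemma fcoef_tpoly_sqr s c k : fcoef (fun x => tpoly s c x ^+ 2) k = conv s c c k.
Proof.
have mI := @measurable_I01 R; rewrite fcoefE.
rewrite (eq_cintegral (m := fun x =>
    \sum_(j <- s) \sum_(l <- s) (c j * c l) * expi (j + l - k) x)); last first.
  move=> x _; rewrite expr2 /tpoly mulr_suml mulr_sumr; apply: eq_bigr => j _.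
  rewrite !mulr_sumr; apply: eq_bigr => l _.
  by rewrite !expiD; ring.
have i1 j l : cintegrable I01 (fun x => (c j * c l) * expi (j + l - k) x).
  by apply: cintegrableZ => //; exact: cintegrable_expi.
rewrite cintegral_sum//; last by move=> j; exact: cintegrable_sum.
apply: eq_bigr => j _; rewrite cintegral_sum//; apply: eq_bigr => l _.
by rewrite cintegral_expiZ subr_eq0.
Qed.

Lemma parseval_tpoly s c : uniq s ->
  rintegrable I01 (fun x => sqnormc (tpoly s c x)) /\
  Rintegral mu I01 (fun x => sqnormc (tpoly s c x)) = \sum_(k <- s) sqnormc (c k).
Proof.
move=> us; have mI := @measurable_I01 R.
pose F x := \sum_(j <- s) \sum_(l <- s) (c j * conjc (c l)) * expi (j - l) x.
have conjE k (x : R) : conjc (expi k x) = expi (- k) x.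
  apply: eqC; rewrite ?Re_expi ?Im_expi freqN mulNr ?cosN ?sinN -?Re_expi -?Im_expi;
  by case: (expi k x).
have FE x : sqnormc (tpoly s c x) = Re (F x).
  have -> : F x = tpoly s c x * conjc (tpoly s c x).
    rewrite rmorph_sum/= /F /tpoly mulr_suml; apply: eq_bigr => j _.
    rewrite mulr_sumr; apply: eq_bigr => l _.
    have -> : conjc (c l * expi l x) = conjc (c l) * conjc (expi l x).
      exact: rmorphM.
    by rewrite expiD conjE; ring.
  by case: (tpoly s c x) => a b; rewrite /sqnormc/= mulrN opprK !expr2.
have i1 j l : cintegrable I01 (fun x => (c j * conjc (c l)) * expi (j - l) x).
  by apply: cintegrableZ => //; exact: cintegrable_expi.
have iF : cintegrable I01 F by apply: cintegrable_sum => // j; exact: cintegrable_sum.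
split.
  rewrite (_ : (fun x => _) = (fun x => Re (F x))); first by have [] := iF.
  by apply/funext => x; rewrite FE.
transitivity (Re (cintegral I01 F)).
  by apply: eq_Rintegral => x _; rewrite FE.
rewrite cintegral_sum//; last by move=> j; exact: cintegrable_sum.
rewrite Re_sum big_seq [RHS]big_seq; apply: eq_bigr => j js.
rewrite cintegral_sum// (bigD1_seq j)//= cintegral_expiZ subrr eqxx mulr1 big1 ?addr0.
  by case: (c j) => a b; rewrite /sqnormc/= mulrN opprK !expr2.
by move=> l lj; rewrite cintegral_expiZ subr_eq0 eq_sym (negPf lj) mulr0.
Qed.

Lemma tpoly_trunc s s' c x : uniq s -> uniq s' -> {subset s <= s'} ->
  tpoly s' (trunc s c) x = tpoly s c x.
Proof.
move=> us us' ss'; rewrite /tpoly.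
rewrite (eq_bigr (fun k => if k \in s then c k * expi k x else 0)); last first.
  by move=> k _; rewrite /trunc; case: ifP => // _; rewrite mul0r.
rewrite -big_mkcond -big_filter; apply: perm_big; apply: uniq_perm => //.
  by rewrite filter_uniq.
by move=> k; rewrite mem_filter; case ks : (k \in s) => //=; rewrite ss'.
Qed.

Lemma cvgr_unique (u : nat -> R) (a b : R) :
  u @ \oo --> a -> u @ \oo --> b -> a = b.
Proof.
by move=> ua ub; rewrite -(cvg_lim (@Rhausdorff R) ua) (cvg_lim (@Rhausdorff R) ub).
Qed.

(* Along windows whose tails decrease like [4^-i], the weighted sum of the squared
   increments is integrable, hence finite almost everywhere: it forces the
   partial sums to converge and dominates them, together with their squares. *)
Lemma riesz_fischer c : (Hnorm 0 c < +oo)%E -> exists g : R -> R[i],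
  [/\ forall x, g (x + 1) = g x, cintegrable I01 g,
      cintegrable I01 (fun x => g x ^+ 2), fcoef g = c &
      fcoef (fun x => g x ^+ 2) = autoconv c].
Proof.
move=> cfin; have mI := @measurable_I01 R.
have /choice[n_ n_P] : forall i, exists n, forall m, (n <= m)%N ->
    (Hnorm 0 (c \- trunc (win m) c)%R <= (4^-1 ^+ i)%:E)%E.
  move=> i.
  have r0 : 0 < 4^-1 ^+ i :> R by apply: exprn_gt0; lra.
  have /fine_cvgP[_ /cvgr0Pnorm_lt/(_ _ r0)[n _ nP]] := cvg_Hnorm_tail cfin.
  exists n => m nm; have := nP m nm => /=.
  have tfin : Hnorm 0 (c \- trunc (win m) c) \is a fin_num.
    by rewrite ge0_fin_numE ?Hnorm_ge0// (le_lt_trans (Hnorm_tail_le _ _ _)).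
  rewrite -(fineK tfin) lee_fin => /ltW; apply: le_trans; exact: ler_norm.
(* Nondecreasing, at least n_ i for the tail bound, and at least i so that the windows exhaust all
   modes. *)
pose N i := (\sum_(j < i.+1) n_ j + i)%N.
have nN i : (n_ i <= N i)%N by rewrite /N big_ord_recr/= -addnA addnCA leq_addr.
have iN i : (i <= N i)%N by rewrite leq_addl.
have NS i : (N i <= N i.+1)%N by rewrite /N [in leqRHS]big_ord_recr/= leq_add// leq_addr.
pose S i := tpoly (win (N i)) c.
pose D i := tpoly (win (N i.+1)) (c \- trunc (win (N i)) c).
have SS i x : S i.+1 x = S i x + D i x.
  rewrite /S /D -(@tpoly_trunc (win (N i)) (win (N i.+1)))//; try exact: win_uniq.
    by rewrite /tpoly -big_split/=; apply: eq_bigr => k _; rewrite -mulrDl addrC subrK.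
  exact: sub_win.
have SE m x : S m x = S 0%N x + \sum_(0 <= i < m) D i x.
  elim: m => [|m IH]; first by rewrite big_nil addr0.
  by rewrite SS IH big_nat_recr//= addrA.
(* By Parseval the integral of sqnormc (D i) is at most 16^-i; the weight 4^i leaves the summable
   bound 4^-i. *)
pose q i x := 4 ^+ i * sqnormc (D i x).
have q0 i x : 0 <= q i x by rewrite mulr_ge0 ?exprn_ge0// sqnormc_ge0.
have mD i : cmeasurable I01 (D i) by exact: cmeasurable_tpoly.
have mq i : measurable_fun I01 (q i).
  have [? ?] := mD i; apply: measurable_funM; first exact: measurable_cst.
  by apply: measurable_funD; exact: measurable_funX.
have iq i : (\int[mu]_(x in I01) (q i x)%:E <= (4^-1 ^+ i)%:E)%E.
  have [iD ID] := parseval_tpoly (c \- trunc (win (N i)) c) (win_uniq (N i.+1)).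
  rewrite -EFin_Rintegral//; last exact: rintegrableZ.
  rewrite lee_fin RintegralZl// ID.
  have h : \sum_(k <- win (N i.+1)) sqnormc ((c \- trunc (win (N i)) c) k) <= (4^-1 ^+ i) ^+ 2.
    have := n_P i (N i) (nN i); rewrite Hnorm_leP ?exprn_ge0// => /(_ _ (win_uniq (N i.+1))).
    apply: le_trans; apply: ler_sum => k _.
    by rewrite sqr_wabs /weight powRr0 mul1r.
  apply: le_trans (ler_wpM2l _ h) _; first by rewrite exprn_ge0.
  by rewrite expr2 mulrA -exprMn divff// expr1n mul1r.
pose K x := (\sum_(i <oo) (q i x)%:E)%E.
have mK : measurable_fun I01 K.
  apply: ge0_emeasurable_sum => [i x _ _|i _]; first by rewrite lee_fin.
  exact/measurable_EFinP.
have K0 x : (0 <= K x)%E by apply: nneseries_ge0 => i _ _; rewrite lee_fin.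
have geo m : \sum_(0 <= i < m) 4^-1 ^+ i <= 2 :> R.
  suff -> : \sum_(0 <= i < m) 4^-1 ^+ i = (4 / 3) * (1 - 4^-1 ^+ m) :> R.
    have : 0 <= 4^-1 ^+ m :> R by rewrite exprn_ge0.
    lra.
  elim: m => [|m IH]; first by rewrite big_nil expr0 subrr mulr0.
  by rewrite big_nat_recr//= IH exprS; field.
have iK : mu.-integrable I01 K.
  apply/integrableP; split => //; apply: (@le_lt_trans _ _ 2%:E); last by rewrite ltry.
  under eq_integral do rewrite gee0_abs//.
  rewrite integral_nneseries//; last 2 first.
  - by move=> i; exact/measurable_EFinP.
  - by move=> i x _; rewrite lee_fin.
  apply: lime_le.
    by apply: is_cvg_nneseries => i _ _; apply: integral_ge0 => x _; rewrite lee_fin.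
  apply: nearW => m; apply: (@le_trans _ _ (\sum_(0 <= i < m) (4^-1 ^+ i)%:E)%E).
    exact: lee_sum.
  by rewrite sumEFin lee_fin.
pose k1 x := fine (K x).
have ik1 : rintegrable I01 k1.
  apply: le_integrable iK => //.
    by apply/measurable_EFinP; apply: measurableT_comp mK.
  move=> x _; rewrite /k1/=; have := K0 x; case: (K x) => //= _.
  by rewrite normr0 leey.
have aeK : {ae mu, forall x, I01 x -> K x \is a fin_num} by exact: integrable_ae.
have sumq x m : K x \is a fin_num -> \sum_(0 <= i < m) q i x <= k1 x.
  move=> Kx; rewrite -lee_fin /k1 fineK// -sumEFin.
  by apply: nneseries_lim_ge => i _ _; rewrite lee_fin.
have k10 x : 0 <= k1 x by exact: fine_ge0.
have sumD x m : K x \is a fin_num ->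
    \sum_(0 <= i < m) cabs (D i x) <= Num.sqrt 2 * Num.sqrt (k1 x).
  move=> Kx.
  (* Cauchy-Schwarz after inserting 2^-i 2^i: one factor is the geometric sum of 4^-i, at most 2,
     the other is the sum of the q i. *)
  rewrite (eq_bigr (fun i => 2^-1 ^+ i * (2 ^+ i * cabs (D i x)))); last first.
    by move=> i _; rewrite mulrA -exprMn mulVf// expr1n mul1r.
  apply: cauchy_schwarz_sum; rewrite ?sqrtr_ge0// sqr_sqrtr//.
    rewrite (eq_bigr (fun i => 4^-1 ^+ i))//= => i _.
    by rewrite -exprM mulnC exprM; congr (_ ^+ _); field.
  apply: le_trans (sumq x m Kx); apply: ler_sum => i _.
  rewrite exprMn sqr_cabs /q ler_wpM2r ?sqnormc_ge0//.
  by rewrite -exprM mulnC exprM (_ : 2 ^+ 2 = 4 :> R)//; ring.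
have cvgS x (P : R[i] -> R) : (forall z w, P (z + w) = P z + P w) ->
    (forall z, `|P z| <= cabs z) -> K x \is a fin_num ->
    (fun m => P (S m x)) @ \oo --> relim (fun m => P (S m x)).
  move=> PD Ple Kx.
  have P0 : P 0 = 0 by apply: (addrI (P 0)); rewrite -PD !addr0.
  have Psum m : P (\sum_(0 <= i < m) D i x) = \sum_(0 <= i < m) P (D i x).
    elim: m => [|m IH]; first by rewrite !big_nil P0.
    by rewrite !big_nat_recr//= PD IH.
  have sc : cvgn (series (fun i => P (D i x))).
    apply: normed_cvg; apply: nondecreasing_is_cvgn.
      apply/nondecreasing_seqP => m.
      by rewrite /= /series/= [leRHS]big_nat_recr//= lerDl.
    exists (Num.sqrt 2 * Num.sqrt (k1 x)) => _ [m _ <-].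
    by apply: le_trans (sumD x m Kx); rewrite /= /series/=; apply: ler_sum.
  have h : (fun m => P (S m x)) @ \oo --> P (S 0%N x) + limn (series (fun i => P (D i x))).
    rewrite (_ : (fun m => _) = (fun m => P (S 0%N x) + series (fun i => P (D i x)) m)).
      by apply: cvgD; [exact: cvg_cst|exact: sc].
    by apply/funext => m; rewrite SE PD Psum.
  by rewrite (cvg_relim h).
pose g x := relim (fun m => Re (S m x)) +i* relim (fun m => Im (S m x)).
have mS m : cmeasurable I01 (S m) by exact: cmeasurable_tpoly.
have mg : cmeasurable I01 g.
  by split; apply: measurable_relim => m; have [] := mS m.
have cvgRe x : K x \is a fin_num -> (fun m => Re (S m x)) @ \oo --> Re (g x).
  by apply: cvgS; [exact: ReD|exact: Re_le_cabs].
have cvgIm x : K x \is a fin_num -> (fun m => Im (S m x)) @ \oo --> Im (g x).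
  by apply: cvgS; [exact: ImD|exact: Im_le_cabs].
pose B := \sum_(k <- win (N 0%N)) cabs (c k).
have B0 : 0 <= B by apply: sumr_ge0 => k _; exact: cabs_ge0.
(* Dominates the partial sums and their squares at once: |S|^2 <= 2 B^2 + 4 k1 because |S| is at
   most B plus the summed increments, and |S| <= 1 + |S|^2. *)
pose G x := 1 + 2 * B ^+ 2 + 4 * k1 x.
have iG : rintegrable I01 G.
  apply: rintegrableD => //; last exact: rintegrableZ.
  apply: (@rintegrable_bounded _ _ _ `|1 + 2 * B ^+ 2|) => //; first by rewrite mu01 ltry.
have SG x m : K x \is a fin_num -> cabs (S m x) ^+ 2 <= 2 * B ^+ 2 + 4 * k1 x.
  move=> Kx; set b := Num.sqrt 2 * Num.sqrt (k1 x).
  have b2 : b ^+ 2 = 2 * k1 x by rewrite exprMn !sqr_sqrtr.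
  have b0 : 0 <= b by rewrite mulr_ge0 ?sqrtr_ge0.
  have : cabs (S m x) <= B + b.
    rewrite SE; apply: le_trans (cabsD _ _) _; apply: lerD; first exact: cabs_tpoly_le.
    exact: le_trans (cabs_sum _ _ _) (sumD x m Kx).
  by have := cabs_ge0 (S m x); have := sqr_ge0 (B - b); nra.
have dom (g_ : nat -> R -> R[i]) h : (forall n, cmeasurable I01 (g_ n)) -> cmeasurable I01 h ->
    (forall x, K x \is a fin_num -> [/\ (fun n => Re (g_ n x)) @ \oo --> Re (h x),
      (fun n => Im (g_ n x)) @ \oo --> Im (h x) & forall n, cabs (g_ n x) <= G x]) ->
    [/\ cintegrable I01 h,
      (fun n => Re (cintegral I01 (g_ n))) @ \oo --> Re (cintegral I01 h) &
      (fun n => Im (cintegral I01 (g_ n))) @ \oo --> Im (cintegral I01 h)].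
  move=> mg_ mh gh; apply: (@cvg_cintegral_dominated _ _ _ G) => //.
    by apply: filterS aeK => x /[apply] /gh[].
  by apply: filterS aeK => x /[apply] /gh[].
have expiM k h : cmeasurable I01 h -> cmeasurable I01 (fun x => expi k x * h x).
  by apply: cmeasurableM; exact: cmeasurable_expi.
have cvgReM x k (u : nat -> R[i]) (z : R[i]) : (fun n => Re (u n)) @ \oo --> Re z ->
    (fun n => Im (u n)) @ \oo --> Im z ->
    (fun n => Re (expi k x * u n)) @ \oo --> Re (expi k x * z) /\
    (fun n => Im (expi k x * u n)) @ \oo --> Im (expi k x * z).
  move=> u1 u2; rewrite ReM ImM; split.
    by under eq_fun do rewrite ReM; apply: cvgB; apply: cvgMl_tmp.
  by under eq_fun do rewrite ImM; apply: cvgD; apply: cvgMl_tmp.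
have sq2 x : K x \is a fin_num ->
    (fun n => Re (S n x ^+ 2)) @ \oo --> Re (g x ^+ 2) /\
    (fun n => Im (S n x ^+ 2)) @ \oo --> Im (g x ^+ 2).
  move=> Kx; have r := cvgRe x Kx; have i := cvgIm x Kx.
  rewrite expr2 ReM ImM; split.
    by under eq_fun do rewrite expr2 ReM; apply: cvgB; apply: cvgM.
  by under eq_fun do rewrite expr2 ImM; apply: cvgD; apply: cvgM.
have SG1 x m : K x \is a fin_num -> cabs (S m x) <= G x.
  move=> Kx; have := SG x m Kx; have := sqr_ge0 (cabs (S m x) - 1).
  by rewrite /G; nra.
have SG2 x m : K x \is a fin_num -> cabs (S m x ^+ 2) <= G x.
  by move=> Kx; have := SG x m Kx; rewrite /G !expr2 cabsM; lra.
have msq h : cmeasurable I01 h -> cmeasurable I01 (fun x => h x ^+ 2).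
  by move=> mh; exact: cmeasurableM.
have ig : cintegrable I01 g.
  by have [] := dom S g mS mg (fun x Kx => And3 (cvgRe x Kx) (cvgIm x Kx) (fun n => SG1 x n Kx)).
have [ig2 _ _] := dom (fun n x => S n x ^+ 2) (fun x => g x ^+ 2)
  (fun n => msq _ (mS n)) (msq _ mg)
  (fun x Kx => And3 (sq2 x Kx).1 (sq2 x Kx).2 (fun n => SG2 x n Kx)).
have coef k : (fun n => Re (fcoef (S n) k)) @ \oo --> Re (fcoef g k) /\
    (fun n => Im (fcoef (S n) k)) @ \oo --> Im (fcoef g k).
  rewrite fcoefE; under eq_fun do rewrite fcoefE.
  under [X in _ /\ (X @ _ --> _)]eq_fun do rewrite fcoefE.
  have [] // := dom (fun n x => expi (- k) x * S n x) (fun x => expi (- k) x * g x).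
  - by move=> n; exact/expiM/mS.
  - exact/expiM/mg.
  move=> x Kx; have [? ?] := cvgReM x (- k) _ _ (cvgRe x Kx) (cvgIm x Kx).
  by split => // n; rewrite cabsM cabs_expi mul1r SG1.
have coef2 k :
  (fun n => Re (fcoef (fun x => S n x ^+ 2) k)) @ \oo --> Re (fcoef (fun x => g x ^+ 2) k) /\
    (fun n => Im (fcoef (fun x => S n x ^+ 2) k)) @ \oo --> Im (fcoef (fun x => g x ^+ 2) k).
  rewrite fcoefE; under eq_fun do rewrite fcoefE.
  under [X in _ /\ (X @ _ --> _)]eq_fun do rewrite fcoefE.
  have [] // := dom (fun n x => expi (- k) x * S n x ^+ 2) (fun x => expi (- k) x * g x ^+ 2).
  - by move=> n; exact/expiM/msq/mS.
  - exact/expiM/msq/mg.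
  move=> x Kx; have [? ?] := cvgReM x (- k) _ _ (sq2 x Kx).1 (sq2 x Kx).2.
  by split => // n; rewrite cabsM cabs_expi mul1r SG2.
have Ninf : N @ \oo --> \oo.
  by move=> A [m _ mA]; exists m => // n /= mn; apply: mA => /=; exact: leq_trans (iN n).
exists g; split => //.
- move=> x; rewrite /g; congr (relim _ +i* relim _); apply/funext => m;
    by rewrite /S tpoly_periodic.
- apply/funext => k; have [h1 h2] := coef k.
  have ev : \forall n \near \oo, fcoef (S n) k = c k.
    exists `|k|%N => // n /= kn; rewrite fcoef_tpoly ?win_uniq// /trunc mem_win.
    by rewrite (leq_trans kn).
  apply: eqC; [apply: (cvgr_unique h1)|apply: (cvgr_unique h2)].
    by apply: cvg_near_cst; apply: filterS ev => n ->.
  by apply: cvg_near_cst; apply: filterS ev => n ->.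
- apply/funext => k; have [h1 h2] := coef2 k.
  have [a1 a2] := cvg_autoconv k cfin.
  have e n : fcoef (fun x => S n x ^+ 2) k = conv (win (N n)) c c k by exact: fcoef_tpoly_sqr.
  apply: eqC; [apply: (cvgr_unique h1)|apply: (cvgr_unique h2)].
    rewrite (_ : (fun n => _) = (fun n => Re (conv (win n) c c k)) \o N).
      exact: (cvg_comp _ _ Ninf a1).
    by apply/funext => n; rewrite e.
  rewrite (_ : (fun n => _) = (fun n => Im (conv (win n) c c k)) \o N).
    exact: (cvg_comp _ _ Ninf a2).
  by apply/funext => n; rewrite e.
Qed.

End RieszFischer.

(** * The nonlinearity and the semigroup *)

Section QuadraticTerm.
Context {R : realType}.
Local Notation mu := (@lebesgue_measure R).
Local Notation Re := complex.Re.
Local Notation Im := complex.Im.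
Local Notation cabs := (@Normc.normc R).
Local Notation I01 := (`[0, 1]%classic : set (measurableTypeR R)).
Implicit Types (c d q : @pdist R) (k : int) (g h : R -> R[i]).
Implicit Types (ell : R).

Lemma ae_eq_cintegral D g h : measurable D -> cmeasurable D g -> cmeasurable D h ->
  {ae mu, forall x, D x -> g x = h x} -> cintegral D g = cintegral D h.
Proof.
move=> mD [g1 g2] [h1 h2] gh; rewrite /cintegral; congr (fine _ +i* fine _).
  apply: ae_eq_integral => //; try exact/measurable_EFinP.
  by apply: filterS gh => x /[apply] ->.
apply: ae_eq_integral => //; try exact/measurable_EFinP.
by apply: filterS gh => x /[apply] ->.
Qed.

Lemma cintegrable_cmeasurable D g : cintegrable D g -> cmeasurable D g.
Proof. by move=> [? ?]; split; exact: rintegrable_measurable. Qed.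

Lemma Hdist0_ell0 ell c : 0 <= ell -> Hdist0 ell c -> (Hnorm 0 c < +oo)%E.
Proof. by move=> ell0 [cfin _]; apply: le_lt_trans cfin; exact: Hnorm_mono. Qed.

Lemma Hper0_cintegrable ell g : Hper0 ell g -> cintegrable I01 g.
Proof. by move=> [_ ? ? _]. Qed.

Lemma Hper0_rep ell c : 0 <= ell -> Hdist0 ell c ->
  exists g, Hper0 ell g /\ fcoef g = c.
Proof.
move=> ell0 cH; have [g [gp [g1 g2] _ gc _]] := riesz_fischer (Hdist0_ell0 ell0 cH).
by exists g; split => //; split => //; rewrite gc.
Qed.

(** [Hper0] records only integrability of g. Injectivity of the coefficients identifies g almost
    everywhere on [0, 1] with the representative of [riesz_fischer], whose square is integrable with
    known coefficients. *)
Lemma fcoef_sqr ell g : 0 <= ell -> Hper0 ell g ->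
  fcoef (fun x => g x ^+ 2) = autoconv (fcoef g).
Proof.
move=> ell0 gH; have [_ _ _ gfin] := gH; have ig := Hper0_cintegrable gH.
have [h [_ ih ih2 hc <-]] := riesz_fischer (Hdist0_ell0 ell0 gfin).
have gh := fcoef_inj ig ih (esym hc).
have mI := @measurable_I01 R.
have msq f : cmeasurable I01 f -> cmeasurable I01 (fun x => f x ^+ 2).
  by move=> mf; exact: cmeasurableM.
apply/funext => k; rewrite !fcoefE; apply: ae_eq_cintegral => //.
- by apply: cmeasurableM; [exact: cmeasurable_expi|exact/msq/cintegrable_cmeasurable].
- by apply: cmeasurableM; [exact: cmeasurable_expi|exact/msq/cintegrable_cmeasurable].
- by apply: filterS gh => x /[apply] ->.
Qed.

Lemma Hper0_ae_unique ell g h : Hper0 ell g -> Hper0 ell h -> fcoef g = fcoef h ->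
  {ae mu, forall x, g x = h x}.
Proof.
move=> gH hH gh; have [gp _ _ _] := gH; have [hp _ _ _] := hH.
apply: ae_periodic => [x|]; first by rewrite gp hp.
exact: fcoef_inj (Hper0_cintegrable gH) (Hper0_cintegrable hH) gh.
Qed.

Lemma autoconvB_le ell c d k (A B : R) : 0 <= ell -> 0 <= A -> 0 <= B ->
  (Hnorm ell c < +oo)%E -> (Hnorm ell d < +oo)%E ->
  (Hnorm ell (c \- d)%R <= A%:E)%E -> (Hnorm ell (c \+ d)%R <= B%:E)%E ->
  wabs ell (autoconv c \- autoconv d) k <= Num.sqrt (2 `^ ell) * (A * B).
Proof.
move=> ell0 A0 B0 cfin dfin cdA cdB.
have fin0 e : (Hnorm ell e < +oo)%E -> (Hnorm 0 e < +oo)%E.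
  by apply: le_lt_trans; exact: Hnorm_mono.
have [c1 c2] := cvg_autoconv k (fin0 _ cfin).
have [d1 d2] := cvg_autoconv k (fin0 _ dfin).
pose e_ n := conv (win n) c c k - conv (win n) d d k.
have e1 : (fun n => Re (e_ n)) @ \oo --> Re ((autoconv c \- autoconv d) k).
  rewrite [X in _ --> X]ReD ReN; under eq_fun do rewrite ReD ReN.
  exact: cvgB.
have e2 : (fun n => Im (e_ n)) @ \oo --> Im ((autoconv c \- autoconv d) k).
  rewrite [X in _ --> X]ImD ImN; under eq_fun do rewrite ImD ImN.
  exact: cvgB.
rewrite wabsE; move: ((autoconv c \- autoconv d) k) e1 e2 => z e1 e2.
have h : (fun n => Num.sqrt (weight ell k) * cabs (e_ n)) @ \oo -->
    Num.sqrt (weight ell k) * cabs z.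
  apply: cvgMl_tmp; rewrite cabsE; under eq_fun do rewrite cabsE.
  apply: continuous_cvg; first exact: sqrt_continuous.
  by apply: cvgD; apply: cvgM.
rewrite -(cvg_lim (@Rhausdorff R) h); apply: limr_le; first exact: cvgP h.
apply: nearW => n; rewrite -wabsE/= /e_.
have := conv_le k ell0 (win_uniq n) A0 B0 cdA cdB.
by rewrite !wabsE -conv_sqrB.
Qed.

Lemma sum_win_S n (F : int -> R) :
  \sum_(k <- win n.+1) F k = F n.+1%:Z + F (- n.+1%:Z) + \sum_(k <- win n) F k.
Proof.
have -> : \sum_(k <- win n.+1) F k = \sum_(k <- [:: n.+1%:Z, - n.+1%:Z & win n]) F k.
  apply: perm_big; apply: uniq_perm; first exact: win_uniq.
    by rewrite 2!cons_uniq win_uniq inE !mem_win; lia.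
  by move=> k; rewrite mem_win [RHS]in_cons [X in _ || X]in_cons mem_win; lia.
by rewrite !big_cons addrA.
Qed.

Lemma freq_sqr_ge k : k%:~R ^+ 2 <= freq k ^+ 2 :> R.
Proof.
rewrite /freq exprMn ler_peMl ?sqr_ge0//.
have := pi_ge2 R; nra.
Qed.

(** Each term is at most 1 / (1 + k^2). The sharper bound 5 - 2 / (n + 1/2) telescopes, since 1 / (1
    + (n + 1)^2) <= 1 / ((n + 1/2)(n + 3/2)), and is an equality at n = 0. *)
Lemma sum_freq_le n : \sum_(k <- win n) (freq k / (1 + freq k ^+ 2)) ^+ 2 <= 5 :> R.
Proof.
apply: (@le_trans _ _ (\sum_(k <- win n) (1 + k%:~R ^+ 2)^-1)).
  apply: ler_sum => k _; have h := freq_sqr_ge k; move: (freq k) h => w h.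
  have k0 : 0 < 1 + k%:~R ^+ 2 :> R by rewrite ltr_pwDl// sqr_ge0.
  have w0 : 0 < 1 + w ^+ 2 by rewrite ltr_pwDl// sqr_ge0.
  apply: (@le_trans _ _ (1 + w ^+ 2)^-1); last by rewrite lef_pV2// lerD2l.
  rewrite exprMn exprVn ler_pdivrMr ?exprn_gt0// expr2 mulKf ?gt_eqF//; lra.
suff : \sum_(k <- win n) (1 + k%:~R ^+ 2)^-1 <= 5 - 2 / (n%:R + 2^-1) :> R.
  by move=> /le_trans; apply; rewrite gerBl divr_ge0// addr_ge0// invr_ge0.
elim: n => [|n IH].
  by rewrite big_cons big_nil/= expr0n !addr0 add0r invr1; lra.
rewrite sum_win_S; apply: le_trans (lerD (lexx _) IH) _.
rewrite rmorphN/= sqrrN -pmulrn -[n.+1%:R]natr1.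
have n0 : 0 <= n%:R :> R by [].
move: (n%:R : R) n0 => x x0.
have -> : 5 - 2 / (x + 2^-1) = 5 - 2 / (x + 1 + 2^-1) - 2 / ((x + 2^-1) * (x + 1 + 2^-1)).
  by field; apply/andP; split; apply: lt0r_neq0; lra.
have : (1 + (x + 1) ^+ 2)^-1 <= ((x + 2^-1) * (x + 1 + 2^-1))^-1.
  by rewrite lef_pV2 ?posrE; nra.
lra.
Qed.

(* For q the coefficients of u ^ 2 this is (I - Delta)^{-1} (u u_x). *)
Definition transport q : @pdist R := resolvent (fun k => 2^-1 * ddx q k).

Lemma transportB q q' k : transport q k - transport q' k = transport (q \- q') k.
Proof. by rewrite /transport /resolvent /ddx/=; ring. Qed.

Lemma transport_zero_mode q : transport q 0 = 0.
Proof. by rewrite /transport /resolvent /ddx /freq mulr0 mul0r !mulr0. Qed.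

Lemma wabs_transport ell q k :
  wabs ell (transport q) k = 2^-1 * `|freq k / (1 + freq k ^+ 2)| * wabs ell q k.
Proof.
have w0 : 0 < 1 + (@freq R k) ^+ 2 by rewrite ltr_pwDl// sqr_ge0.
rewrite !wabsE /transport /resolvent /ddx !cabsM cabs_real.
have -> : cabs (0 +i* freq k) = `|freq k|.
  by rewrite cabsE /sqnormc/= expr0n add0r sqrtr_sqr.
have -> : cabs 2^-1 = 2^-1.
  have -> : 2^-1 = (2^-1 : R)%:C :> R[i] by rewrite rmorphV ?unitfE// rmorph_nat.
  by rewrite cabs_real ger0_norm.
rewrite [`|freq k / _|]normrM.
move: (Num.sqrt _) (cabs (q k)) `|freq k| `|(1 + freq k ^+ 2)^-1| (2^-1 : R).
by move=> a b x y z; ring.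
Qed.

(** Square summability of freq / (1 + freq^2) turns a weighted supremum bound into an l^2 bound; the
    factor 1/2 of the convection term is estimated by 1. *)
Lemma Hnorm_transport ell q (M : R) : 0 <= M -> (forall k, wabs ell q k <= M) ->
  (Hnorm ell (transport q) <= (Num.sqrt 5 * M)%:E)%E.
Proof.
move=> M0 qM; apply/Hnorm_winP => [|n]; first by rewrite mulr_ge0 ?sqrtr_ge0.
rewrite exprMn sqr_sqrtr//; apply: le_trans (ler_wpM2r (sqr_ge0 M) (sum_freq_le n)).
rewrite mulr_suml; apply: ler_sum => k _.
rewrite wabs_transport exprMn; apply: ler_pM; rewrite ?sqr_ge0//; last first.
  by rewrite ler_sqr ?nnegrE ?wabs_ge0.
rewrite exprMn real_normK ?num_real// ler_piMl ?sqr_ge0//; lra.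
Qed.

Definition quad c := transport (autoconv c).

(** The factor sqrt 5 comes from [sum_freq_le], sqrt (2^ell) from the splitting of the weight in
    [weightD_le]. *)
Definition quad_const ell : R := Num.sqrt 5 * Num.sqrt (2 `^ ell).

Lemma quad_const_gt0 ell : 0 < quad_const ell.
Proof. by rewrite mulr_gt0// sqrtr_gt0// powR_gt0. Qed.

Lemma Hnorm_quadB ell c d (A B : R) : 0 <= ell -> 0 <= A -> 0 <= B ->
  (Hnorm ell c < +oo)%E -> (Hnorm ell d < +oo)%E ->
  (Hnorm ell (c \- d)%R <= A%:E)%E -> (Hnorm ell (c \+ d)%R <= B%:E)%E ->
  (Hnorm ell (quad c \- quad d)%R <= (quad_const ell * (A * B))%:E)%E.
Proof.
move=> ell0 A0 B0 cfin dfin cdA cdB.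
rewrite (_ : quad c \- quad d = transport (autoconv c \- autoconv d)); last first.
  by apply/funext => k; exact: transportB.
rewrite /quad_const -mulrA; apply: Hnorm_transport => [|k].
  by rewrite mulr_ge0 ?sqrtr_ge0// mulr_ge0.
exact: autoconvB_le.
Qed.

End QuadraticTerm.

(** * Decay of the semigroup and smoothing by the resolvent *)

Section Multipliers.
Context {R : realType}.
Local Notation Re := complex.Re.
Local Notation cabs := (@Normc.normc R).
Implicit Types (v : @pdist R) (k : int) (ell beta gamma : R).

Lemma Re_symA beta gamma k : Re (symA beta gamma k) =
  - ((beta + gamma * freq k ^+ 2) / (1 + freq k ^+ 2)).
Proof. by rewrite /symA /opA /resolvent /ddx; move: (freq k) => w /=; ring. Qed.

(** With w = freq^2 >= 4 pi^2 on nonzero modes, (beta + gamma w) / (1 + w) is monotone in w, lying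
    between its value at 4 pi^2 and its limit gamma. The condition on gamma makes both positive, and
    [a] is the smaller one. *)
Lemma symA_decay beta gamma :
  Num.max 0 (- (beta / (4 * pi ^+ 2))) < gamma ->
  exists2 a : R, 0 < a & forall k, k != 0 -> Re (symA beta gamma k) <= - a.
Proof.
rewrite gt_max => /andP[g0 gb]; pose p : R := 4 * pi ^+ 2.
have p0 : 0 < p by rewrite mulr_gt0// exprn_gt0// pi_gt0.
have gp : 0 < beta + gamma * p.
  by move: gb; rewrite -/p ltrNl ltr_pdivlMr//; nra.
pose b := (beta + gamma * p) / (1 + p); have b0 : 0 < b by rewrite divr_gt0// addr_gt0.
exists (Num.min gamma b); first by rewrite lt_min g0.
move=> k k0; rewrite Re_symA lerN2.
have kp : p <= freq k ^+ 2.
  rewrite /freq exprMn /p (_ : (2 * pi) ^+ 2 = 4 * pi ^+ 2); last by ring.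
  have : 1 <= k ^+ 2 :> int by move: k0; rewrite expr2; nia.
  by rewrite -(ler_int R) rmorphXn/= => k1; rewrite ler_peMr// ltW.
move: (freq k ^+ 2) kp => w kp; have w0 : 0 < 1 + w by lra.
have bE : b * (1 + p) = beta + gamma * p by rewrite /b mulfVK// gt_eqF// addr_gt0.
rewrite ler_pdivlMr//; have [gb'|bg] := leP gamma b.
  nra.
nra.
Qed.

Lemma wabs_expA ell beta gamma t v k :
  wabs ell (expA beta gamma t v) k = expR (t * Re (symA beta gamma k)) * wabs ell v k.
Proof.
rewrite !wabsE /expA cabsM [cabs (cexp _)]cabsE sqnormc_cexp sqrtr_sqr ReCM.
by rewrite ger0_norm ?expR_ge0// mulrCA.
Qed.

Lemma Hnorm_expA ell beta gamma (a t : R) v :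
  (forall k, k != 0 -> Re (symA beta gamma k) <= - a) -> 0 <= t -> v 0 = 0 ->
  (Hnorm ell (expA beta gamma t v) <= (expR (- (a * t)))%:E * Hnorm ell v)%E.
Proof.
move=> sa t0 v0; apply: Hnorm_le_wabs => [|k]; first exact: expR_ge0.
rewrite wabs_expA; have [->|k0] := eqVneq k 0.
  by rewrite wabsE v0 cabs0 !mulr0.
rewrite ler_wpM2r ?wabs_ge0// ler_expR; have := sa k k0; nra.
Qed.

Lemma expA_zero_mode beta gamma t v : v 0 = 0 -> expA beta gamma t v 0 = 0.
Proof. by move=> v0; rewrite /expA v0 mulr0. Qed.

Lemma expAD beta gamma s t v :
  expA beta gamma (s + t) v = expA beta gamma s (expA beta gamma t v).
Proof. by apply/funext => k; rewrite /expA rmorphD/= mulrDl cexpD mulrA. Qed.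

Lemma expAB beta gamma t v w k :
  expA beta gamma t v k - expA beta gamma t w k = expA beta gamma t (v \- w) k.
Proof. by rewrite /expA mulrBr. Qed.

Lemma wabs_resolvent ell v k : wabs ell (resolvent v) k = wabs (ell - 2) v k.
Proof.
rewrite !wabsE /resolvent cabsM mulrA; congr (_ * _).
have w0 : 0 < 1 + (@freq R k) ^+ 2 by rewrite ltr_pwDl// sqr_ge0.
rewrite cabs_real ger0_norm ?invr_ge0 ?(ltW w0)//.
rewrite /weight powRB ?(gt_eqF w0) ?implybT// powR_mulrn ?(ltW w0)//.
by rewrite sqrtrM ?powR_ge0// sqrtrV ?sqr_ge0// sqrtr_sqr ger0_norm// ltW.
Qed.

(** The gain of two derivatives is exact, hence the H^{ell-2} norm of the forcing in the final
    estimate. *)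
Lemma Hnorm_resolvent ell v : Hnorm ell (resolvent v) = Hnorm (ell - 2) v.
Proof.
by apply/eqP; rewrite eq_le -[leRHS]mul1e -[X in _ && (_ <= X)%E]mul1e;
  apply/andP; split; apply: Hnorm_le_wabs => // k; rewrite mul1r wabs_resolvent.
Qed.

Lemma resolventB v w k : resolvent v k - resolvent w k = resolvent (v \- w) k.
Proof. by rewrite /resolvent/= mulrBr. Qed.

End Multipliers.

(** * Bochner integrals *)

Section LowerIntegral.
Context {R : realType}.
Local Notation mu := (@lebesgue_measure R).
Implicit Types (D : set (measurableTypeR R)) (f g : R -> \bar R).
Local Open Scope ereal_scope.

(* The integral of a nonnegative function that need not be measurable is the
   supremum of the integrals of the simple functions below it. *)
Lemma le_lower_integral D f g : (forall x, D x -> 0 <= f x) ->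
  (forall x, D x -> f x <= g x) ->
  \int[mu]_(x in D) f x <= \int[mu]_(x in D) g x.
Proof.
move=> f0 fg; have g0 x : D x -> 0 <= g x by move=> Dx; exact: le_trans (f0 x Dx) (fg x Dx).
rewrite !ge0_integralE//; apply: le_ereal_sup => _ [h hf <-]; exists h => // x.
apply: le_trans (hf x) _; rewrite !patchE; case: ifPn => // /set_mem; exact: fg.
Qed.

(** Here only the upper function is measurable: raised to +oo on the exceptional null set it keeps
    its integral and dominates f everywhere. Such comparisons arise because a path in
    [is_bochner_integral] is measurable only off a null set. *)
Lemma ae_le_lower_integral D f g : measurable D -> (forall x, D x -> 0 <= f x) ->
  (forall x, D x -> 0 <= g x) -> measurable_fun D g ->
  {ae mu, forall x, D x -> f x <= g x} ->
  \int[mu]_(x in D) f x <= \int[mu]_(x in D) g x.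
Proof.
move=> mD f0 g0 mg [N [mN N0 fgN]].
pose b := (fun x => maxe (g x) ((cst +oo \_ N) x)).
have mb : measurable_fun D b.
  apply: measurable_maxe => //; apply: measurable_funS (measurableT) (@subsetT _ _) _.
  by apply/(measurable_restrictT _ mN); exact: measurable_cst.
have gb : {ae mu, forall x, D x -> b x = g x}.
  exists N; split => // x /= /not_implyP[Dx]; apply: contra_notP => Nx.
  by rewrite /b patchE memNset// max_l// g0.
have b0 x : D x -> 0 <= b x by move=> Dx; rewrite le_max g0.
rewrite (_ : \int[mu]_(x in D) g x = \int[mu]_(x in D) b x); last first.
  by apply/esym; apply: ge0_ae_eq_integral.
apply: le_lower_integral => // x Dx; rewrite /b patchE.
have [Nx|Nx] := pselect (N x); first by rewrite mem_set// max_r ?leey.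
rewrite memNset// max_l ?g0//; apply: contrapT => fg; apply: Nx; apply: fgN => /=.
by move=> /(_ Dx).
Qed.

(** The dual case, with the lower function measurable: it is set to 0 on the null set. *)
Lemma ae_ge_lower_integral D f g : measurable D -> (forall x, D x -> 0 <= f x) ->
  (forall x, D x -> 0 <= g x) -> measurable_fun D g ->
  {ae mu, forall x, D x -> g x <= f x} ->
  \int[mu]_(x in D) g x <= \int[mu]_(x in D) f x.
Proof.
move=> mD f0 g0 mg [N [mN N0 gfN]].
pose b := g \_ (~` N).
have mb : measurable_fun D b.
  by apply/(measurable_restrict _ (measurableC mN) mD); apply: measurable_funS mg.
have gb : {ae mu, forall x, D x -> g x = b x}.
  exists N; split => // x /= /not_implyP[Dx]; apply: contra_notP => Nx.
  by rewrite /b patchE mem_set.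
rewrite (_ : \int[mu]_(x in D) g x = \int[mu]_(x in D) b x); last first.
  apply: ge0_ae_eq_integral => // x Dx; rewrite /b patchE; case: ifP => // _; exact: g0.
apply: le_lower_integral => x Dx; rewrite /b patchE; have [Nx|Nx] := pselect (N x).
- by rewrite memNset//= => /(_ Nx).
- by rewrite mem_set// g0.
- by rewrite memNset ?f0//= => /(_ Nx).
- rewrite mem_set//; apply: contrapT => gf; apply: Nx; apply: gfN => /=.
  by move=> /(_ Dx).
Qed.

End LowerIntegral.

Section Bochner.
Context {R : realType}.
Local Notation mu := (@lebesgue_measure R).
Local Notation Re := complex.Re.
Local Notation Im := complex.Im.
Variable ell : R.
Hypothesis ell0 : 0 <= ell.
Implicit Types (D N : set (measurableTypeR R)) (F G : R -> @pdist R) (k : int).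
Implicit Types (s : simple_fun ell) (c v w : @pdist R).

Lemma coef_measurableB D F G : coef_measurable D F -> coef_measurable D G ->
  coef_measurable D (fun t => F t \- G t).
Proof.
move=> mF mG k; have [? ?] := mF k; have [? ?] := mG k; split.
  by under eq_fun do rewrite ReD ReN; exact: measurable_funB.
by under eq_fun do rewrite ImD ImN; exact: measurable_funB.
Qed.

(** Setting a strongly measurable path to 0 on a suitable null set makes all its coefficients Borel
    on D. *)
Definition cut N F : R -> @pdist R := fun t => if t \in N then fun=> 0 else F t.

Lemma cmeasurable_indicM D N (z : R[i]) : measurable D -> measurable N ->
  cmeasurable D (fun t => (\1_N t)%:C * z).
Proof.
move=> mD mN; apply: (@cmeasurableM _ _ (fun t => (\1_N t)%:C) (fun=> z)); split => //.
exact: measurable_indic.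
Qed.

Lemma coef_measurable_simple D s : measurable D -> coef_measurable D (sf_val s).
Proof.
move=> mD k; split.
  under eq_fun do rewrite Re_sum; apply: measurable_sum => j.
  by have [] := cmeasurable_indicM (sf_coef j k) mD (sf_measurable j).
under eq_fun do rewrite Im_sum; apply: measurable_sum => j.
by have [] := cmeasurable_indicM (sf_coef j k) mD (sf_measurable j).
Qed.

Lemma cintegrable_indicM D N (z : R[i]) : measurable D -> measurable N ->
  (mu N < +oo)%E -> cintegrable D (fun t => (\1_N t)%:C * z) /\
  cintegral D (fun t => (\1_N t)%:C * z) = (fine (mu (N `&` D)))%:C * z.
Proof.
move=> mD mN Nfin.
have i1 : rintegrable D (\1_N : R -> R).
  apply/integrableP; split; first by apply/measurable_EFinP; exact: measurable_indic.
  apply: (@le_lt_trans _ _ (mu N)) => //.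
  under eq_integral do rewrite gee0_abs ?lee_fin//.
  by rewrite integral_indic// le_measure ?inE//; exact: measurableI.
have ic : cintegrable D (fun t => (\1_N t)%:C).
  by split => //; exact: (@integrable0 _ _ _ mu D).
have E t : (\1_N t)%:C * z = z * (\1_N t)%:C by rewrite mulrC.
under eq_fun do rewrite E; split; first exact: cintegrableZ.
rewrite cintegralZ// mulrC; congr (_ * _); rewrite /cintegral; apply: eqC => /=.
  by rewrite /Rintegral integral_indic.
by rewrite Rintegral_cst// mul0r.
Qed.

Lemma cintegrable_simple D s k : measurable D -> cintegrable D (fun t => sf_val s t k).
Proof.
move=> mD; apply: cintegrable_sum => // j.
by have [] := cintegrable_indicM (sf_coef j k) mD (sf_measurable j) (sf_finite j).
Qed.

Lemma sf_integralE D s k : measurable D ->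
  sf_integral D s k = cintegral D (fun t => sf_val s t k).
Proof.
move=> mD.
have h (j : 'I_(sf_size s)) :=
  cintegrable_indicM (sf_coef j k) mD (sf_measurable j) (sf_finite j).
rewrite cintegral_sum//; last by move=> j; have [] := h j.
by apply: eq_bigr => j _; have [_ ->] := h j.
Qed.

Lemma Hnorm_simple_le s t : (Hnorm ell (sf_val s t) <=
  \sum_j (\1_(sf_set (s := s) j) t)%:E * Hnorm ell (sf_coef (s := s) j))%E.
Proof.
have h (I : Type) (r : seq I) (z : I -> R) (c : I -> @pdist R) :
    (forall i, 0 <= z i) ->
    (Hnorm ell (fun k => \sum_(i <- r) (z i)%:C * c i k)%R <=
     \sum_(i <- r) (z i)%:E * Hnorm ell (c i))%E.
  move=> z0; elim: r => [|i r IH].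
    rewrite big_nil (_ : (fun k => _) = fun=> 0) ?Hnorm0//.
    by apply/funext => k; rewrite big_nil.
  rewrite big_cons (_ : (fun k => _) = (fun k => (z i)%:C * c i k) \+
    (fun k => \sum_(j <- r) (z j)%:C * c j k)); last first.
    by apply/funext => k; rewrite big_cons.
  apply: le_trans (HnormD _ _ _) _; apply: leeD => //.
  apply: Hnorm_le_wabs => // k.
  by rewrite !wabsE cabsM cabs_real ger0_norm// mulrCA.
by apply: h => j; rewrite indicE ler0n.
Qed.

Lemma integral_Hnorm_simple_fin D s : measurable D ->
  (\int[mu]_(t in D) Hnorm ell (sf_val s t) < +oo)%E.
Proof.
move=> mD.
have m1 j : measurable_fun D (fun t => ((\1_(sf_set (s := s) j) t)%:E * Hnorm ell (sf_coef j))%E).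
  apply: emeasurable_funM; last exact: measurable_cst.
  by apply/measurable_EFinP; exact: measurable_indic (sf_measurable j).
apply: (@le_lt_trans _ _ (\int[mu]_(t in D)
    \sum_j (\1_(sf_set (s := s) j) t)%:E * Hnorm ell (sf_coef (s := s) j))%E).
  apply: ge0_le_integral => //.
  - by move=> t _; exact: Hnorm_ge0.
  - by apply: measurable_Hnorm; exact: coef_measurable_simple.
  - exact: emeasurable_sum.
  - by move=> t _; exact: Hnorm_simple_le.
rewrite ge0_integral_sum//; last first.
  by move=> j t _; rewrite mule_ge0 ?Hnorm_ge0// lee_fin indicE ler0n.
apply: lte_sum_pinfty => j _; have [cfin _] := sf_Hdist0 j.
have [C C0 ->] := Hnorm_finP cfin.
rewrite ge0_integralZr//; last first.
  by apply/measurable_EFinP; exact: measurable_indic (sf_measurable j).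
rewrite integral_indic//; last exact: sf_measurable.
rewrite muleC lte_mul_pinfty ?lee_fin//.
apply: le_lt_trans (sf_finite j); apply: le_measure; rewrite ?inE//.
  by apply: measurableI => //; exact: sf_measurable.
exact: sf_measurable.
Qed.

Lemma Hnorm_sub_triangle c v w :
  (Hnorm ell (c \- w)%R <= Hnorm ell (c \- v)%R + Hnorm ell (v \- w)%R)%E.
Proof.
rewrite (_ : c \- w = (c \- v) \+ (v \- w)); first exact: HnormD.
by apply/funext => k /=; rewrite addrA subrK.
Qed.

Lemma Hnorm_subC c v : Hnorm ell (c \- v) = Hnorm ell (v \- c).
Proof. by rewrite -HnormN; congr Hnorm; apply/funext => k /=; rewrite opprB. Qed.

Lemma Hnorm_eq0 c : Hnorm ell c = 0%E -> c = fun=> 0.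
Proof.
move=> c0; apply/funext => k; have := cabs_le_Hnorm c k ell0.
by rewrite c0 lee_fin => h; apply: Normc.eq0_normc; apply/eqP; rewrite eq_le h cabs_ge0.
Qed.

Lemma cvg_Hnorm_coef (c_ : nat -> @pdist R) c k :
  (fun n => Hnorm ell (c \- c_ n)) @ \oo --> 0%E ->
  (fun n => Re (c_ n k)) @ \oo --> Re (c k) /\
  (fun n => Im (c_ n k)) @ \oo --> Im (c k).
Proof.
move=> /fine_cvgP[fin /cvgr0Pnorm_lt h].
split; apply/cvgrPdist_lt => e e0; near=> n.
  apply: (@le_lt_trans _ _ (fine (Hnorm ell (c \- c_ n)))).
    rewrite -ReN -ReD; apply: le_trans (Re_le_cabs _) _.
    rewrite -lee_fin fineK; last by near: n.
    exact: (cabs_le_Hnorm (c \- c_ n)).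
  by apply: le_lt_trans (ler_norm _) _; near: n; exact: h.
apply: (@le_lt_trans _ _ (fine (Hnorm ell (c \- c_ n)))).
  rewrite -ImN -ImD; apply: le_trans (Im_le_cabs _) _.
  rewrite -lee_fin fineK; last by near: n.
  exact: (cabs_le_Hnorm (c \- c_ n)).
by apply: le_lt_trans (ler_norm _) _; near: n; exact: h.
Unshelve. all: by end_near. Qed.

(** Off the null set the coefficients are limits of those of the simple functions; multiplying the
    latter by the indicator of the complement makes the convergence hold on all of D. *)
Lemma ae_approx_coef_measurable D F (s : nat -> simple_fun ell) : measurable D ->
  ae_approx D F s -> exists N, [/\ measurable N, mu N = 0 & coef_measurable D (cut N F)].
Proof.
move=> mD [N [mN N0 FN]]; exists N; split => // k.
have lim t : D t -> ~ N t -> (fun n => Hnorm ell (F t \- sf_val (s n) t)) @ \oo --> 0%E.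
  by move=> Dt Nt; apply: contrapT => h; apply: Nt; apply: FN => /= /(_ Dt).
have mNc : measurable (~` N) by exact: measurableC.
have approxk n : cmeasurable D (fun t => (\1_(~` N) t)%:C * sf_val (s n) t k).
  apply: cmeasurableM; last exact: coef_measurable_simple.
  by split => //; exact: measurable_indic.
have lim' t : D t ->
    (fun n => Re ((\1_(~` N) t)%:C * sf_val (s n) t k)) @ \oo --> Re (cut N F t k) /\
    (fun n => Im ((\1_(~` N) t)%:C * sf_val (s n) t k)) @ \oo --> Im (cut N F t k).
  have uE n : (\1_(~` N) t)%:C * sf_val (s n) t k = if t \in N then 0 else sf_val (s n) t k.
    by rewrite indicE in_setC; case: (t \in N); rewrite ?mul0r// mul1r.
  move=> Dt; rewrite /cut; split; under eq_fun do rewrite uE; case: ifPn => [_|tN].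
  - exact: cvg_cst.
  - by have [] := cvg_Hnorm_coef k (lim t Dt (fun Nt => negP tN (mem_set Nt))).
  - exact: cvg_cst.
  - by have [] := cvg_Hnorm_coef k (lim t Dt (fun Nt => negP tN (mem_set Nt))).
split.
  apply: (@measurable_fun_cvg _ _ _ _ (fun n t => Re ((\1_(~` N) t)%:C * sf_val (s n) t k))).
    by move=> n; have [] := approxk n.
  by move=> t /lim'[].
apply: (@measurable_fun_cvg _ _ _ _ (fun n t => Im ((\1_(~` N) t)%:C * sf_val (s n) t k))).
  by move=> n; have [] := approxk n.
by move=> t /lim'[].
Qed.

Lemma ae_cut N F D : measurable N -> mu N = 0 ->
  {ae mu, forall t, D t -> F t = cut N F t}.
Proof.
move=> mN N0; exists N; split => // t /= /not_implyP[Dt].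
by apply: contra_notP => Nt; rewrite /cut memNset.
Qed.

(** The coefficientwise integral of the cut path differs from the integral of the n-th simple
    function by at most the integral of the error norm ([Hnorm_cintegral_le]), so it is the same
    limit as w. *)
Lemma bochner_integral_coef D F w : measurable D -> is_bochner_integral ell D F w ->
  exists N, [/\ measurable N, mu N = 0, coef_measurable D (cut N F),
    (\int[mu]_(t in D) Hnorm ell (cut N F t) < +oo)%E &
    forall k, cintegrable D (fun t => cut N F t k) /\
              w k = cintegral D (fun t => cut N F t k)].
Proof.
move=> mD [s [Fs Fs0 ws]].
have [N [mN N0 mF]] := ae_approx_coef_measurable mD Fs.
exists N; set F' := cut N F in mF *.
have mFs n : coef_measurable D (fun t => F' t \- sf_val (s n) t).
  by apply: coef_measurableB => //; exact: coef_measurable_simple.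
have mH n : measurable_fun D (fun t => Hnorm ell (F' t \- sf_val (s n) t)).
  exact: measurable_Hnorm.
have le n : (\int[mu]_(t in D) Hnorm ell (F' t \- sf_val (s n) t)%R <=
    \int[mu]_(t in D) Hnorm ell (F t \- sf_val (s n) t)%R)%E.
  apply: ae_ge_lower_integral => //.
  - by move=> t _; exact: Hnorm_ge0.
  - by move=> t _; exact: Hnorm_ge0.
  by apply: filterS (ae_cut F D mN N0) => t h /h ->.
have Fs'0 : (fun n => \int[mu]_(t in D) Hnorm ell (F' t \- sf_val (s n) t)%R)%E @ \oo --> 0%E.
  apply: squeeze_cvge (cvg_cst 0%E) Fs0; apply: nearW => n.
  by rewrite le andbT; apply: integral_ge0 => t _; exact: Hnorm_ge0.
(* Errors tending to 0 are eventually finite; one finite error and the integrability of that simple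
   function make the norm of the cut path integrable. *)
have [n0 hn0] : exists n, (\int[mu]_(t in D) Hnorm ell (F' t \- sf_val (s n) t)%R < +oo)%E.
  have /fine_cvgP[[n _ hn] _] := Fs'0; exists n; have := hn n (leqnn n).
  by rewrite ge0_fin_numE//; apply: integral_ge0 => t _; exact: Hnorm_ge0.
have F'fin : (\int[mu]_(t in D) Hnorm ell (F' t) < +oo)%E.
  apply: (@le_lt_trans _ _ (\int[mu]_(t in D)
    (Hnorm ell (F' t \- sf_val (s n0) t)%R + Hnorm ell (sf_val (s n0) t)))%E).
    apply: ge0_le_integral => //.
    - by move=> t _; exact: Hnorm_ge0.
    - exact: measurable_Hnorm.
    - apply: emeasurable_funD => //; by apply: measurable_Hnorm; exact: coef_measurable_simple.
    - move=> t _; apply: le_trans (HnormD _ _ _).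
      rewrite le_eqVlt; apply/orP; left; apply/eqP; congr Hnorm.
      by apply/funext => k /=; rewrite subrK.
  rewrite ge0_integralD//.
  - by rewrite lte_add_pinfty// integral_Hnorm_simple_fin.
  - by move=> t _; exact: Hnorm_ge0.
  - by move=> t _; exact: Hnorm_ge0.
  - by apply: measurable_Hnorm; exact: coef_measurable_simple.
have iH : mu.-integrable D (fun t => Hnorm ell (F' t)).
  apply/integrableP; split; first exact: measurable_Hnorm.
  by under eq_integral do rewrite gee0_abs ?Hnorm_ge0//.
have ic k : cintegrable D (fun t => F' t k).
  have [m1 m2] := mF k; split; apply: le_integrable iH => //; try exact/measurable_EFinP.
    move=> t _; rewrite [leRHS]gee0_abs ?Hnorm_ge0//=.
    by apply: le_trans (cabs_le_Hnorm _ k ell0); rewrite lee_fin Re_le_cabs.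
  move=> t _; rewrite [leRHS]gee0_abs ?Hnorm_ge0//=.
  by apply: le_trans (cabs_le_Hnorm _ k ell0); rewrite lee_fin Im_le_cabs.
split => //.
pose w' : @pdist R := fun k => cintegral D (fun t => F' t k).
have w's n : (Hnorm ell (w' \- sf_integral D (s n))%R <=
    \int[mu]_(t in D) Hnorm ell (F' t \- sf_val (s n) t)%R)%E.
  rewrite (_ : w' \- _ = fun k => cintegral D (fun t => (F' t \- sf_val (s n) t) k)).
    apply: Hnorm_cintegral_le => // k; apply: cintegrableB => //.
    exact: cintegrable_simple.
  apply/funext => k; rewrite /= sf_integralE// -cintegralB//.
  exact: cintegrable_simple.
suff : Hnorm ell (w \- w') = 0%E.
  move=> /Hnorm_eq0 e k; split => //; apply/eqP; rewrite -subr_eq0; apply/eqP.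
  exact: (congr1 (@^~ k) e).
have lim : (fun n => Hnorm ell (w \- sf_integral D (s n))%R +
    \int[mu]_(t in D) Hnorm ell (F' t \- sf_val (s n) t)%R)%E @ \oo --> 0%E.
  by rewrite -[X in _ --> X]adde0; apply: cvgeD.
apply/eqP; rewrite eq_le Hnorm_ge0 andbT.
rewrite -(cvg_lim (@ereal_hausdorff R) lim); apply: lime_ge; first exact: cvgP lim.
apply: nearW => n; apply: le_trans (Hnorm_sub_triangle _ (sf_integral D (s n)) _) _.
by rewrite leeD2l// Hnorm_subC.
Qed.

End Bochner.

(** * Existence of Bochner integrals of bounded paths *)

Section BochnerExistence.
Context {R : realType}.
Local Notation mu := (@lebesgue_measure R).
Local Notation Re := complex.Re.
Local Notation Im := complex.Im.
Local Notation cabs := (@Normc.normc R).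
Variable ell : R.
Hypothesis ell0 : 0 <= ell.
Implicit Types (D N : set (measurableTypeR R)) (F G : R -> @pdist R) (k : int).
Implicit Types (c w : @pdist R).

Lemma sf_add_exists (s s' : simple_fun ell) : exists s'' : simple_fun ell,
  forall t k, sf_val s'' t k = sf_val s t k + sf_val s' t k.
Proof.
case: s s' => m A a mA fA aH [n B b mB fB bH].
pose S (j : 'I_(m + n)) := match fintype.split j with inl i => A i | inr i => B i end.
pose C (j : 'I_(m + n)) := match fintype.split j with inl i => a i | inr i => b i end.
have mS j : measurable (S j) by rewrite /S; case: fintype.split.
have fS j : (mu (S j) < +oo)%E by rewrite /S; case: fintype.split.
have CH j : Hdist0 ell (C j) by rewrite /C; case: fintype.split.
exists (SimpleFun mS fS CH) => t k; rewrite /sf_val/= big_split_ord/=.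
congr (_ + _); apply: eq_bigr => i _.
  by rewrite /S /C (_ : fintype.split (lshift n i) = inl i)//; exact: (unsplitK (inl i)).
by rewrite /S /C (_ : fintype.split (rshift m i) = inr i)//; exact: (unsplitK (inr i)).
Qed.

Lemma sf_zero_exists : exists s : simple_fun ell, forall t k, sf_val s t k = 0.
Proof.
have mS (j : 'I_0) : measurable (set0 : set (measurableTypeR R)) by [].
have fS (j : 'I_0) : (mu (set0 : set (measurableTypeR R)) < +oo)%E by case: j.
have CH (j : 'I_0) : Hdist0 ell (fun=> 0 : R[i]) by case: j.
exists (@SimpleFun R ell 0 (fun=> set0) (fun=> (fun=> 0)) mS fS CH) => t k.
by rewrite /sf_val/= big_ord0.
Qed.

(** Uniform approximation is stable under sums, so a path with finitely many modes can be treated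
    one mode at a time. *)
Definition uniformly_simple D F := forall e : R, 0 < e ->
  exists s : simple_fun ell, forall t, D t ->
    (Hnorm ell (F t \- sf_val s t)%R <= e%:E)%E.

Lemma uniformly_simpleD D F G : uniformly_simple D F -> uniformly_simple D G ->
  uniformly_simple D (fun t => F t \+ G t).
Proof.
move=> Fs Gs e e0; have e20 : 0 < e / 2 by rewrite divr_gt0.
have [s Fse] := Fs _ e20; have [s' Gse] := Gs _ e20.
have [s'' sE] := sf_add_exists s s'; exists s'' => t Dt.
rewrite (_ : _ \- _ = (F t \- sf_val s t) \+ (G t \- sf_val s' t)); last first.
  by apply/funext => k; rewrite /= sE; ring.
apply: le_trans (HnormD _ _ _) _; rewrite (splitr e) EFinD.
by apply: leeD; [exact: Fse|exact: Gse].
Qed.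

Lemma uniformly_simple_scaled D (h : R -> R) c (M : R) : measurable D ->
  (mu D < +oo)%E -> measurable_fun D h -> (forall t, D t -> `|h t| <= M) ->
  Hdist0 ell c -> uniformly_simple D (fun t k => (h t)%:C * c k).
Proof.
move=> mD Dfin mh hM cH e e0; have [cfin _] := cH; have [C C0 cC] := Hnorm_finP cfin.
(* The mesh of the quantization of h: an error r in h costs r C <= e in norm, and the 1 keeps the
   denominator positive when C = 0. *)
pose r := e / (C + 1); have r0 : 0 < r by rewrite divr_gt0// ltr_wpDl.
(* The levels r z with |z| <= L cover the values of h. The extra 1 serves the negative values, whose
   floor may reach - floor (M / r) - 1. *)
pose L := `|Num.floor (M / r)|.+1%N.
pose z (j : 'I_(L + L).+1) : int := j%:Z - L%:Z.
pose E (j : 'I_(L + L).+1) : set (measurableTypeR R) :=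
  D `&` [set t | Num.floor (h t / r) = z j].
have EE j : E j = D `&` h @^-1` `[r * (z j)%:~R, r * ((z j)%:~R + 1)[.
  rewrite /E; congr (_ `&` _); apply/seteqP; split => t /=; rewrite in_itv/=.
    move=> fE; have := floor_le (h t / r); have := floorD1_gt (h t / r).
    by rewrite fE intrD ler_pdivlMr// ltr_pdivrMr// ![r * _]mulrC => -> ->.
  rewrite ![r * _]mulrC -ler_pdivlMr// -ltr_pdivrMr// => /andP[h1 h2].
  by apply: floor_def; rewrite h1 intrD.
have mE j : measurable (E j) by rewrite EE; exact: mh.
have fE j : (mu (E j) < +oo)%E.
  by apply: le_lt_trans Dfin; apply: le_measure; rewrite ?inE//; apply: subIsetl.
have aH j : Hdist0 ell (fun k => (r * (z j)%:~R)%:C * c k).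
  split; last by have [_ ->] := cH; rewrite mulr0.
  apply: (@le_lt_trans _ _ (`|r * (z j)%:~R|%:E * Hnorm ell c)%E).
    by apply: Hnorm_le_wabs => // k; rewrite !wabsE cabsM cabs_real mulrCA.
  by rewrite lte_mul_pinfty// lee_fin.
exists (SimpleFun mE fE aH) => t Dt.
pose fl := Num.floor (h t / r).
have flL : - (L%:Z) <= fl <= L%:Z.
  have /ler_normlP[h1 h2] := hM t Dt.
  have f1 : fl <= Num.floor (M / r) by apply: le_floor; rewrite ler_pM2r ?invr_gt0.
  have f2 : - Num.floor (M / r) - 1 <= fl.
    rewrite floor_ge_int intrD intrN.
    have := floorD1_gt (M / r); rewrite intrD => h3.
    rewrite ler_pdivlMr//; move: h3; rewrite ltr_pdivrMr//.
    by move: (Num.floor _)%:~R => x; nra.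
  by rewrite /L; lia.
have jP : (absz (fl + L%:Z)%R < (L + L).+1)%N by lia.
pose j0 := Ordinal jP.
have zj0 : z j0 = fl by rewrite /z /=; lia.
have -> : (fun k => (h t)%:C * c k) \- sf_val (SimpleFun mE fE aH) t =
    fun k => (h t - r * fl%:~R)%:C * c k.
  apply/funext => k; rewrite /= /sf_val/= (bigD1 j0)//= big1 ?addr0.
    rewrite indicE mem_set; last by split => //; rewrite /= zj0.
    by rewrite mul1r zj0 rmorphB/= mulrBl.
  move=> j jj0; rewrite indicE memNset ?mul0r// => -[_ /= zj].
  move/negP : jj0; apply; apply/eqP/val_inj => /=.
  by move: zj; rewrite -/fl /z; lia.
apply: (@le_trans _ _ (`|h t - r * fl%:~R|%:E * Hnorm ell c)%E).
  by apply: Hnorm_le_wabs => // k; rewrite !wabsE cabsM cabs_real mulrCA.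
rewrite cC -EFinM lee_fin; apply: (@le_trans _ _ (r * C)).
  rewrite ler_wpM2r// ger0_norm.
    have := floorD1_gt (h t / r); rewrite intrD -/fl ltr_pdivrMr//; nra.
  by rewrite subr_ge0 mulrC -ler_pdivlMr// floor_le.
by rewrite /r mulrAC ler_pdivrMr ?ltr_wpDl//; nra.
Qed.

Lemma eq_uniformly_simple D F G : (forall t, D t -> F t = G t) ->
  uniformly_simple D F -> uniformly_simple D G.
Proof.
by move=> FG Fs e /Fs[s sF]; exists s => t Dt; rewrite -FG//; exact: sF.
Qed.

Definition single k (z : R[i]) : @pdist R := fun j => if j == k then z else 0.

Lemma single_Hdist0 k (z : R[i]) : k != 0 -> Hdist0 ell (single k z).
Proof.
move=> k0; split; last by rewrite /single eq_sym (negPf k0).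
apply: (@le_lt_trans _ _ (wabs ell (fun=> z) k)%:E); last by rewrite ltry.
apply/Hnorm_leP => [|s us]; first exact: wabs_ge0.
rewrite (eq_bigr (fun j => if j == k then wabs ell (fun=> z) k ^+ 2 else 0)); last first.
  move=> j _; rewrite !wabsE /single; case: eqP => [->//|_].
  by rewrite cabs0 mulr0 expr0n.
rewrite -big_mkcond/=; case ks : (k \in s).
  by rewrite -big_filter filter_pred1_uniq// big_seq1.
rewrite big_seq_cond big_pred0 ?sqr_ge0// => j.
by case: eqP => [->|]; rewrite ?ks ?andbF.
Qed.

Lemma uniformly_simple_trunc D F (M : R) (s : seq int) : measurable D ->
  (mu D < +oo)%E -> coef_measurable D F ->
  (forall t, D t -> F t 0 = 0 /\ (Hnorm ell (F t) <= M%:E)%E) -> uniq s ->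
  uniformly_simple D (fun t => trunc s (F t)).
Proof.
move=> mD Dfin mF FM; elim: s => [_|k s IH /= /andP[ks /IH{}IH]].
  have [s sE] := sf_zero_exists; move=> e e0; exists s => t Dt.
  rewrite (_ : _ \- _ = fun=> 0) ?Hnorm0 ?lee_fin ?(ltW e0)//.
  by apply/funext => k; rewrite /= sE subr0.
(* Simple functions take mean-zero values, so the zero mode, which vanishes on D, is skipped rather
   than approximated. *)
have [k0|k0] := eqVneq k 0.
  apply: eq_uniformly_simple IH => t Dt; apply/funext => j; rewrite /trunc in_cons.
  case: eqP => [->|//]; have [F0 _] := FM t Dt.
  by rewrite k0 F0; case: ifP.
have [m1 m2] := mF k.
have Fk t : D t -> cabs (F t k) <= M.
  by move=> /FM[_ h]; have := le_trans (cabs_le_Hnorm _ k ell0) h; rewrite lee_fin.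
have s1 : uniformly_simple D (fun t j => (Re (F t k))%:C * single k 1 j).
  apply: (@uniformly_simple_scaled _ _ _ M) => //; last exact: single_Hdist0.
  by move=> t /Fk; apply: le_trans; exact: Re_le_cabs.
have s2 : uniformly_simple D (fun t j => (Im (F t k))%:C * single k (0 +i* 1) j).
  apply: (@uniformly_simple_scaled _ _ _ M) => //; last exact: single_Hdist0.
  by move=> t /Fk; apply: le_trans; exact: Im_le_cabs.
apply: eq_uniformly_simple (uniformly_simpleD (uniformly_simpleD s1 s2) IH) => t Dt.
apply/funext => j; rewrite /= /single /trunc in_cons; case: eqP => [->|_] /=.
  rewrite (negPf ks) addr0; case: (F t k) => a b; apply: eqC => /=; ring.
by rewrite !mulr0 !add0r.
Qed.

(** The truncated path is approximated uniformly; only the tail depends on t. It tends to 0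
    pointwise and is bounded by the norm of F t, which supplies the domination in
    [bochner_integral_bounded]. *)
Lemma simple_approximation D F (M : R) : measurable D ->
  (mu D < +oo)%E -> coef_measurable D F ->
  (forall t, D t -> F t 0 = 0 /\ (Hnorm ell (F t) <= M%:E)%E) ->
  exists s : nat -> simple_fun ell, forall n t, D t ->
    (Hnorm ell (F t \- sf_val (s n) t)%R <=
     Hnorm ell (F t \- trunc (win n) (F t))%R + (n.+1%:R^-1)%:E)%E.
Proof.
move=> mD Dfin mF FM.
have /choice[s sP] : forall n, exists s : simple_fun ell, forall t, D t ->
    (Hnorm ell (trunc (win n) (F t) \- sf_val s t)%R <= (n.+1%:R^-1)%:E)%E.
  move=> n; apply: (uniformly_simple_trunc mD Dfin mF FM (win_uniq n)).
  by rewrite invr_gt0.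
exists s => n t Dt; apply: le_trans (Hnorm_sub_triangle _ _ (trunc (win n) (F t)) _) _.
by rewrite leeD2l// sP.
Qed.

Lemma cvg_simple_approximation D F (s : nat -> simple_fun ell) t : D t ->
  (Hnorm ell (F t) < +oo)%E ->
  (forall n t, D t -> (Hnorm ell (F t \- sf_val (s n) t)%R <=
     Hnorm ell (F t \- trunc (win n) (F t))%R + (n.+1%:R^-1)%:E)%E) ->
  (fun n => Hnorm ell (F t \- sf_val (s n) t)) @ \oo --> 0%E.
Proof.
move=> Dt Ffin sF.
have lim : (fun n => Hnorm ell (F t \- trunc (win n) (F t))%R + (n.+1%:R^-1)%:E)%E @ \oo --> 0%E.
  rewrite -[X in _ --> X]adde0; apply: cvgeD => //; first exact: cvg_Hnorm_tail.
  by apply: cvg_EFin; [exact: nearW|exact: cvg_harmonic].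
apply: squeeze_cvge (cvg_cst 0%E) lim; apply: nearW => n.
by rewrite Hnorm_ge0 sF.
Qed.

Lemma strongly_measurable_bounded D F (M : R) : measurable D ->
  (mu D < +oo)%E -> coef_measurable D F ->
  (forall t, D t -> F t 0 = 0 /\ (Hnorm ell (F t) <= M%:E)%E) ->
  strongly_measurable ell D F.
Proof.
move=> mD Dfin mF FM; have [s sF] := simple_approximation mD Dfin mF FM.
exists s; apply: aeW => t Dt; apply: (cvg_simple_approximation Dt) => //.
by have [_ h] := FM t Dt; apply: le_lt_trans h _; rewrite ltry.
Qed.

Lemma bochner_integral_bounded D F (M : R) : measurable D ->
  (mu D < +oo)%E -> coef_measurable D F ->
  (forall t, D t -> F t 0 = 0 /\ (Hnorm ell (F t) <= M%:E)%E) ->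
  (forall k, cintegrable D (fun t => F t k)) /\
  is_bochner_integral ell D F (fun k => cintegral D (fun t => F t k)).
Proof.
move=> mD Dfin mF FM; have [s sF] := simple_approximation mD Dfin mF FM.
have Ffin t : D t -> (Hnorm ell (F t) < +oo)%E.
  by move=> /FM[_ h]; apply: le_lt_trans h _; rewrite ltry.
have Fs t : D t -> (fun n => Hnorm ell (F t \- sf_val (s n) t)) @ \oo --> 0%E.
  by move=> Dt; apply: (cvg_simple_approximation Dt) => //; exact: Ffin.
have ic k : cintegrable D (fun t => F t k).
  have [m1 m2] := mF k.
  have Fk t : D t -> cabs (F t k) <= M.
    by move=> /FM[_ h]; have := le_trans (cabs_le_Hnorm _ k ell0) h; rewrite lee_fin.
  split; apply: (@rintegrable_bounded _ _ _ M) => // t Dt; apply: le_trans (Fk t Dt).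
    exact: Re_le_cabs.
  exact: Im_le_cabs.
split => //; set w : @pdist R := fun k => _.
have mFs n : coef_measurable D (fun t => F t \- sf_val (s n) t).
  by apply: coef_measurableB => //; exact: coef_measurable_simple.
have mH n : measurable_fun D (fun t => Hnorm ell (F t \- sf_val (s n) t)).
  exact: measurable_Hnorm.
have Fs0 : (fun n => \int[mu]_(t in D) Hnorm ell (F t \- sf_val (s n) t)%R)%E @ \oo --> 0%E.
  have mc : mu.-integrable D (fun=> (M + 1)%:E).
    by apply: (@rintegrable_bounded _ _ (fun=> M + 1) `|M + 1|) => //; exact: measurable_cst.
  have lim : {ae mu, forall t, D t ->
      (fun n => Hnorm ell (F t \- sf_val (s n) t)) @ \oo --> (cst 0%E) t} by exact: aeW.
  have bound : {ae mu, forall t, forall n, D t ->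
      (`|Hnorm ell (F t \- sf_val (s n) t)%R| <= (M + 1)%:E)%E}.
    apply: aeW => t n Dt; rewrite gee0_abs ?Hnorm_ge0//; apply: le_trans (sF n t Dt) _.
    rewrite EFinD; apply: leeD.
      by apply: le_trans (Hnorm_tail_le _ _ _) _; have [] := FM t Dt.
    by rewrite lee_fin invf_le1// ler1n.
  have [_ _] := dominated_convergence mD mH (measurable_cst 0%E) lim mc bound.
  by rewrite integral0.
exists s; split => //; first exact: aeW.
apply: squeeze_cvge (cvg_cst 0%E) Fs0; apply: nearW => n; rewrite Hnorm_ge0/=.
rewrite (_ : w \- _ = fun k => cintegral D (fun t => (F t \- sf_val (s n) t) k)).
  apply: Hnorm_cintegral_le => // k; apply: cintegrableB => //.
  exact: cintegrable_simple.
apply/funext => k; rewrite /= sf_integralE// -cintegralB//.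
exact: cintegrable_simple.
Qed.

End BochnerExistence.

(** * Fixed point and uniqueness of mild solutions *)

Section Duhamel.
Context {R : realType}.
Local Notation mu := (@lebesgue_measure R).
Local Notation Re := complex.Re.
Local Notation Im := complex.Im.
Local Notation cabs := (@Normc.normc R).
Variables (ell beta gamma a : R).
Hypothesis ell0 : 0 <= ell.
Hypothesis a0 : 0 < a.
Hypothesis decay : forall k : int, k != 0 -> Re (symA beta gamma k) <= - a.
Implicit Types (D N : set (measurableTypeR R)) (F G U V : R -> @pdist R) (k : int).
Implicit Types (c phi : @pdist R) (s t : R).

Local Notation "S_[ t ]" := (expA beta gamma t) (at level 0).

Lemma integral_exp_decay (b t : R) : 0 < b -> 0 <= t ->
  (\int[mu]_(s in `[0%R, t]) (expR (- (b * (t - s))))%:E <= (b^-1)%:E)%E.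
Proof.
move=> b0 t0.
have dF (s : R) : is_derive s (1 : R) (fun s => b^-1 * expR (- (b * (t - s))))
    (expR (- (b * (t - s)))).
  apply: is_derive_eq; rewrite /GRing.scale/=.
  by field; rewrite gt_eqF.
have cf : continuous (fun s : R => expR (- (b * (t - s)))).
  move=> s; apply: continuous_comp; last exact: continuous_expR.
  apply: cvgN; apply: cvgMl_tmp; apply: cvgB; [exact: cvg_cst|exact: cvg_id].
rewrite -EFin_Rintegral//; last first.
  apply: continuous_compact_integrable; first exact: segment_compact.
  exact: continuous_subspaceT.
rewrite (Rintegral_FTC2 t0 dF cf) lee_fin subrr mulr0 oppr0 expR0 mulr1 gerBl.
by rewrite mulr_ge0 ?invr_ge0 ?expR_ge0// ltW.
Qed.

Lemma cmeasurable_cexp D (z : R[i]) t : measurable D ->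
  cmeasurable D (fun s => cexp ((t - s)%:C * z)).
Proof.
move=> mD; have lin (r : R) : continuous (fun s : R => (t - s) * r).
  by move=> s; apply: cvgMr_tmp; apply: cvgB; [exact: cvg_cst|exact: cvg_id].
have E s : (t - s)%:C * z = ((t - s) * Re z) +i* ((t - s) * Im z).
  by case: z => p q; apply: eqC => /=; ring.
split; under eq_fun do rewrite E; apply: measurable_funM; apply: measurable_funTS;
  apply: continuous_measurable_fun => s.
- by apply: continuous_comp; [exact: lin|exact: continuous_expR].
- by apply: continuous_comp; [exact: lin|exact: continuous_cos].
- by apply: continuous_comp; [exact: lin|exact: continuous_expR].
- by apply: continuous_comp; [exact: lin|exact: continuous_sin].
Qed.

Lemma coef_measurable_expA D G t : measurable D -> coef_measurable D G ->
  coef_measurable D (fun s => S_[t - s] (G s)).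
Proof. by move=> mD mG k; apply: cmeasurableM; [exact: cmeasurable_cexp|exact: mG]. Qed.

Lemma coef_measurable_resolvent D G : coef_measurable D G ->
  coef_measurable D (fun s => resolvent (G s)).
Proof. by move=> mG k; apply: cmeasurableZ; exact: mG. Qed.

Lemma coef_measurable_quad D U : measurable D -> coef_measurable D U ->
  (forall s, D s -> (Hnorm ell (U s) < +oo)%E) ->
  coef_measurable D (fun s => quad (U s)).
Proof.
move=> mD mU Ufin; apply: coef_measurable_resolvent => k; do 2 apply: cmeasurableZ.
have mc n : cmeasurable D (fun s => conv (win n) (U s) (U s) k).
  split.
    under eq_fun do rewrite Re_sum; apply: measurable_sum => j.
    under eq_fun do rewrite Re_sum; apply: measurable_sum => l.
    have [] // : cmeasurable D (fun s => U s j * U s l * ((j + l)%R == k)%:R).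
    by apply: cmeasurableM; [apply: cmeasurableM; exact: mU|split; exact: measurable_cst].
  under eq_fun do rewrite Im_sum; apply: measurable_sum => j.
  under eq_fun do rewrite Im_sum; apply: measurable_sum => l.
  have [] // : cmeasurable D (fun s => U s j * U s l * ((j + l)%R == k)%:R).
  by apply: cmeasurableM; [apply: cmeasurableM; exact: mU|split; exact: measurable_cst].
have lim s : D s -> (Hnorm 0 (U s) < +oo)%E.
  by move=> /Ufin; apply: le_lt_trans; exact: Hnorm_mono.
split.
  apply: (@measurable_fun_cvg _ _ _ _ (fun n s => Re (conv (win n) (U s) (U s) k))).
    by move=> n; have [] := mc n.
  by move=> s /lim /(cvg_autoconv k)[].
apply: (@measurable_fun_cvg _ _ _ _ (fun n s => Im (conv (win n) (U s) (U s) k))).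
  by move=> n; have [] := mc n.
by move=> s /lim /(cvg_autoconv k)[].
Qed.

(** Taken mode by mode, so it is defined for every G; for bounded paths [bochner_evolved] identifies
    it with a Bochner integral. *)
Definition convolution G t : @pdist R := fun k =>
  cintegral `[0, t] (fun s => S_[t - s] (G s) k).

Definition duhamel phi G t : @pdist R := S_[t] phi \+ convolution G t.

(* Borel coefficients on each [0, b], rather than strong measurability, so that no
   null sets accumulate in the iteration. *)
Definition bounded_path (M : R) G :=
  (forall b, coef_measurable `[0, b] G) /\
  (forall s, 0 <= s -> G s 0 = 0 /\ (Hnorm ell (G s) <= M%:E)%E).

Lemma lebesgue_itv_fin (b : R) : (mu (`[0%R, b]%classic : set R) < +oo)%E.
Proof.
have := @lebesgue_measure_itv R `[0, b]%R; rewrite /= => e.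
by rewrite [X in (X < _)%E]e; case: ifP => _; rewrite ltry.
Qed.

Lemma evolved_forcing M G t : bounded_path M G -> 0 <= t ->
  coef_measurable `[0, t] (fun s => S_[t - s] (G s)) /\
  forall s, `[0, t]%classic s -> S_[t - s] (G s) 0 = 0 /\
    (Hnorm ell (S_[t - s] (G s)) <= (expR (- (a * (t - s))) * M)%:E)%E.
Proof.
move=> [mG GM] t0; split; first exact: coef_measurable_expA.
move=> s; rewrite /= in_itv/= => /andP[s0 st]; have [G0 Gs] := GM s s0.
split; first exact: expA_zero_mode.
apply: le_trans (Hnorm_expA ell decay _ G0) _; first by rewrite subr_ge0.
by rewrite EFinM lee_wpmul2l// lee_fin expR_ge0.
Qed.

Lemma evolved_forcing_bound M G t : bounded_path M G -> 0 <= t ->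
  forall s, `[0, t]%classic s -> S_[t - s] (G s) 0 = 0 /\
    (Hnorm ell (S_[t - s] (G s)) <= M%:E)%E.
Proof.
move=> GM t0 s st; have [_ /(_ s st)[G0 Gs]] := evolved_forcing GM t0.
split => //; apply: le_trans Gs _; rewrite lee_fin.
have M0 : 0 <= M.
  by have [_ /(_ 0 (lexx _))[_]] := GM; move=> /(le_trans (Hnorm_ge0 _ _)); rewrite lee_fin.
rewrite ler_piMl// expR_le1 oppr_le0 mulr_ge0 ?(ltW a0)// subr_ge0.
by move: st; rewrite /= in_itv/= => /andP[].
Qed.

Lemma bochner_evolved M G t : bounded_path M G -> 0 <= t ->
  (forall k, cintegrable `[0, t] (fun s => S_[t - s] (G s) k)) /\
  is_bochner_integral ell `[0, t] (fun s => S_[t - s] (G s)) (convolution G t).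
Proof.
move=> GM t0; apply: (@bochner_integral_bounded _ _ ell0 _ _ M) => //.
- exact: lebesgue_itv_fin.
- by have [] := evolved_forcing GM t0.
- exact: evolved_forcing_bound.
Qed.

(** The decay bounds the time integral of the semigroup by 1 / a uniformly in t, which is why the
    smallness threshold does not depend on the time window. *)
Lemma Hnorm_convolution_le M G t : bounded_path M G -> 0 <= t ->
  (Hnorm ell (convolution G t) <= (M / a)%:E)%E.
Proof.
move=> GM t0; have [ic _] := bochner_evolved GM t0.
have [mS bS] := evolved_forcing GM t0.
have M0 : 0 <= M.
  by have [_ /(_ 0 (lexx _))[_]] := GM; move=> /(le_trans (Hnorm_ge0 _ _)); rewrite lee_fin.
have mexp : measurable_fun (`[0, t]%classic : set (measurableTypeR R))
    (fun s => expR (- (a * (t - s)))).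
  apply: measurable_funTS; apply: continuous_measurable_fun => s.
  apply: continuous_comp; last exact: continuous_expR.
  apply: cvgN; apply: cvgMl_tmp; apply: cvgB; [exact: cvg_cst|exact: cvg_id].
apply: le_trans (Hnorm_cintegral_le _ _ ic) _; first exact: measurable_itv.
apply: (@le_trans _ _ (\int[mu]_(s in `[0%R, t]) ((expR (- (a * (t - s))))%:E * M%:E))%E).
  apply: ge0_le_integral => //.
  - by move=> s _; exact: Hnorm_ge0.
  - exact: measurable_Hnorm.
  - by apply: emeasurable_funM; [exact/measurable_EFinP|exact: measurable_cst].
  - by move=> s /bS[_]; rewrite EFinM.
rewrite ge0_integralZr//; last exact/measurable_EFinP.
by rewrite muleC EFinM lee_wpmul2l ?lee_fin// integral_exp_decay.
Qed.

Lemma duhamel_le (P M : R) phi G t : bounded_path M G -> 0 <= t ->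
  phi 0 = 0 -> (Hnorm ell phi <= P%:E)%E ->
  duhamel phi G t 0 = 0 /\ (Hnorm ell (duhamel phi G t) <= (P + M / a)%:E)%E.
Proof.
move=> GM t0 phi0 phiP; split.
  rewrite /duhamel/= expA_zero_mode// add0r /convolution.
  rewrite (eq_cintegral (m := fun=> 0)); last first.
    by move=> s st; have [] := evolved_forcing_bound GM t0 st.
  by rewrite /cintegral/= !Rintegral_cst// mul0r.
apply: le_trans (HnormD _ _ _) _; rewrite EFinD; apply: leeD; last first.
  exact: Hnorm_convolution_le.
apply: le_trans (Hnorm_expA ell decay t0 phi0) _.
apply: le_trans phiP; rewrite gee_pMl//; last 2 first.
- exact: Hnorm_ge0.
- by rewrite lee_fin expR_le1 oppr_le0 mulr_ge0// ltW.
Qed.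

Lemma cmeasurableD D (g h : R -> R[i]) : cmeasurable D g -> cmeasurable D h ->
  cmeasurable D (fun x => g x + h x).
Proof.
move=> [g1 g2] [h1 h2]; split.
  rewrite (_ : (fun x => _) = (fun x => Re (g x)) \+ (fun x => Re (h x))).
    exact: measurable_funD.
  by apply/funext => x; rewrite ReD.
rewrite (_ : (fun x => _) = (fun x => Im (g x)) \+ (fun x => Im (h x))).
  exact: measurable_funD.
by apply/funext => x; rewrite ImD.
Qed.

Lemma cmeasurable_parameterized_integral (b : R) (h : R -> R[i]) : 0 <= b ->
  cintegrable `[0, b] h ->
  cmeasurable `[0, b] (fun t => cintegral `[0, t] h).
Proof.
move=> b0 [ih1 ih2]; split.
  apply: (@subspace_continuous_measurable_fun _ `[0, b]
    (fun t => parameterized_integral mu 0 t (fun x => Re (h x)))) => //.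
  exact: parameterized_integral_continuous.
apply: (@subspace_continuous_measurable_fun _ `[0, b]
  (fun t => parameterized_integral mu 0 t (fun x => Im (h x)))) => //.
exact: parameterized_integral_continuous.
Qed.

(** Here t occurs in the integrand and in the domain. Splitting exp ((t - s) z) as exp ((t - b) z)
    exp ((b - s) z) leaves the primitive of a fixed integrable function, which is continuous in
    t. *)
Lemma coef_measurable_duhamel M phi G b : bounded_path M G ->
  coef_measurable `[0, b] (duhamel phi G).
Proof.
move=> GM k; have [b0|b0] := leP 0 b; last first.
  by rewrite set_itv_ge ?bnd_simp -?ltNge//; split; exact: measurable_fun_set0.
set z := symA beta gamma k.
have expt (t : R) : t%:C * z = (0 - t)%:C * - z by rewrite sub0r rmorphN/= mulrNN.
have exptb (t s : R) : (t - s)%:C * z = (b - t)%:C * - z + (b - s)%:C * z.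
  by rewrite mulrN -mulNr -mulrDl -rmorphN -rmorphD/=; congr (_%:C * _); ring.
pose h s := S_[b - s] (G s) k.
have [/(_ k) ih _] := bochner_evolved GM b0.
have mexp (c : R) : cmeasurable (`[0, b]%classic : set (measurableTypeR R))
  (fun t => cexp ((c - t)%:C * - z)) by exact: cmeasurable_cexp.
have mI := cmeasurable_parameterized_integral b0 ih.
have E t : `[0, b]%classic t -> duhamel phi G t k =
    cexp ((0 - t)%:C * - z) * phi k + cexp ((b - t)%:C * - z) * cintegral `[0, t] h.
  rewrite /= in_itv/= => /andP[t0 tb].
  rewrite /duhamel/= /expA /convolution -/z expt; congr (_ + _).
  rewrite -cintegralZ//; last first.
    case: ih => ih1 ih2; split.
      apply: (integrableS _ _ _ ih1) => //; apply: subset_itvl; by rewrite bnd_simp.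
    apply: (integrableS _ _ _ ih2) => //; apply: subset_itvl; by rewrite bnd_simp.
  by apply: eq_cintegral => s _; rewrite /h /expA mulrA -cexpD -exptb.
have [m1 m2] : cmeasurable (`[0, b]%classic : set (measurableTypeR R))
    (fun t => cexp ((0 - t)%:C * - z) * phi k + cexp ((b - t)%:C * - z) * cintegral `[0, t] h).
  apply: cmeasurableD; apply: cmeasurableM; [exact: mexp| |exact: mexp|exact: mI].
  by split => /=; exact: measurable_cst.
split.
  by apply: eq_measurable_fun m1 => t /set_mem/E ->.
by apply: eq_measurable_fun m2 => t /set_mem/E ->.
Qed.

Lemma bounded_path_ge0 M G : bounded_path M G -> 0 <= M.
Proof.
move=> [_ /(_ 0 (lexx _))[_]].
by move=> /(le_trans (Hnorm_ge0 _ _)); rewrite lee_fin.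
Qed.

Lemma bounded_path_fin M G s : bounded_path M G -> 0 <= s ->
  (Hnorm ell (G s) < +oo)%E.
Proof. by move=> [_ GM] /GM[_ /le_lt_trans]; apply; rewrite ltry. Qed.

Lemma bounded_pathB A B F G : bounded_path A F -> bounded_path B G ->
  bounded_path (A + B) (fun s => F s \- G s).
Proof.
move=> [mF FA] [mG GB]; split => [b|s s0].
  exact: coef_measurableB.
have [F0 Fs] := FA s s0; have [G0 Gs] := GB s s0; split.
  by rewrite /= F0 G0 subr0.
by apply: le_trans (HnormB _ _ _) _; rewrite EFinD leeD.
Qed.

Lemma bounded_path_duhamel P M phi G : phi 0 = 0 -> (Hnorm ell phi <= P%:E)%E ->
  bounded_path M G -> bounded_path (P + M / a) (duhamel phi G).
Proof.
move=> phi0 phiP GM; split => [b|s s0]; first exact: coef_measurable_duhamel GM.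
exact: duhamel_le.
Qed.

Lemma quad0 : quad (fun=> 0 : R[i]) = (fun=> 0).
Proof.
have e n k : conv (win n) (fun=> 0 : R[i]) (fun=> 0) k = 0.
  by rewrite /conv big1// => j _; rewrite big1// => l _; rewrite !mul0r.
apply/funext => k; rewrite /quad /transport /resolvent /ddx /autoconv.
under eq_fun do rewrite e; under [X in _ +i* (limn X)]eq_fun do rewrite e.
by rewrite !lim_cst// !mulr0.
Qed.

Lemma bounded_path_quad r U : bounded_path r U ->
  bounded_path (quad_const ell * (r * r)) (fun s => quad (U s)).
Proof.
move=> Ur; have r0 := bounded_path_ge0 Ur; have [mU UU] := Ur; split => [b|s s0].
  apply: coef_measurable_quad => // s; rewrite /= in_itv/= => /andP[s0 _].
  exact: bounded_path_fin Ur s0.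
split; first exact: transport_zero_mode.
have -> : quad (U s) = quad (U s) \- quad (fun=> 0).
  by rewrite quad0; apply/funext => k /=; rewrite subr0.
have H0 : Hnorm ell (fun=> 0 : R[i]) = 0%E by exact: Hnorm0.
apply: Hnorm_quadB => //.
- exact: bounded_path_fin Ur s0.
- by rewrite H0.
- by apply: le_trans (HnormB _ _ _) _; rewrite H0 adde0; have [] := UU s s0.
- by apply: le_trans (HnormD _ _ _) _; rewrite H0 adde0; have [] := UU s s0.
Qed.

Lemma bounded_path_quadB (r d : R) U V : bounded_path r U -> bounded_path r V ->
  bounded_path d (fun s => U s \- V s) ->
  bounded_path (quad_const ell * (d * (r + r))) (fun s => quad (U s) \- quad (V s)).
Proof.
move=> Ur Vr UVD; have r0 := bounded_path_ge0 Ur; have d0 := bounded_path_ge0 UVD.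
have [mQ _] := bounded_pathB (bounded_path_quad Ur) (bounded_path_quad Vr).
split => // s s0; split; first by rewrite /= /quad !transport_zero_mode subr0.
apply: Hnorm_quadB => //; first exact: addr_ge0.
- exact: bounded_path_fin Ur s0.
- exact: bounded_path_fin Vr s0.
- by have [_ /(_ s s0)[]] := UVD.
apply: le_trans (HnormD _ _ _) _; rewrite EFinD leeD//.
  by have [_ /(_ s s0)[]] := Ur.
by have [_ /(_ s s0)[]] := Vr.
Qed.

Lemma duhamelB A B phi F G t : bounded_path A F -> bounded_path B G -> 0 <= t ->
  duhamel phi F t \- duhamel phi G t = convolution (fun s => F s \- G s) t.
Proof.
move=> FA GB t0; apply/funext => k; rewrite /duhamel/= opprD addrACA subrr add0r.
have [iF _] := bochner_evolved FA t0; have [iG _] := bochner_evolved GB t0.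
rewrite -cintegralB//; apply: eq_cintegral => s _.
by rewrite expAB.
Qed.

(** The limit is formed mode by mode with [relim], which keeps it measurable in a parameter; lower
    semicontinuity of the norm carries the geometric bound over to it. *)
Lemma geometric_Hnorm_limit (c_ : nat -> @pdist R) (d : R) : 0 <= d ->
  (forall n, (Hnorm ell (c_ n.+1 \- c_ n)%R <= (d * 2^-1 ^+ n)%:E)%E) ->
  forall n, (Hnorm ell
    ((fun k => relim (fun n => Re (c_ n k)) +i* relim (fun n => Im (c_ n k))) \- c_ n)%R
      <= (2 * d * 2^-1 ^+ n)%:E)%E.
Proof.
move=> d0 cd.
have p0 n : 0 <= 2 * d * 2^-1 ^+ n :> R by rewrite mulr_ge0 ?exprn_ge0 ?mulr_ge0 ?invr_ge0.
have step n i : (Hnorm ell (c_ (n + i)%N \- c_ n)%R <= (2 * d * 2^-1 ^+ n)%:E)%E.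
  (* The subtracted term closes the induction on i: it decreases by exactly d 2^-(n + i) at each
     step. *)
  apply: (@le_trans _ _ (2 * d * 2^-1 ^+ n - 2 * d * 2^-1 ^+ (n + i))%:E); last first.
    by rewrite lee_fin gerBl.
  elim: i => [|i IH].
    rewrite addn0 subrr (_ : _ \- _ = fun=> 0) ?Hnorm0//.
    by apply/funext => k /=; rewrite subrr.
  apply: le_trans (Hnorm_sub_triangle _ _ (c_ (n + i)%N) _) _.
  rewrite addnS; apply: le_trans (leeD (cd _) IH) _.
  by rewrite -EFinD lee_fin exprS; set x := 2^-1 ^+ (n + i); lra.
have lim0 : 2 * d * 2^-1 ^+ n @[n --> \oo] --> (0 : R).
  by rewrite -[X in _ --> X](mulr0 (2 * d)); apply: cvgMl_tmp; apply: cvg_expr0; lra.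
have cau k m n : (m <= n)%N -> cabs (c_ n k - c_ m k) <= 2 * d * 2^-1 ^+ m.
  move=> mn; rewrite -lee_fin; apply: le_trans (cabs_le_Hnorm (c_ n \- c_ m) k ell0) _.
  by rewrite -(subnKC mn).
have small (e : R) : 0 < e -> exists N : nat, forall m : nat, (N <= m)%N -> 2 * d * 2^-1 ^+ m < e.
  move=> e0; have /cvgr0Pnorm_lt/(_ e e0)[N _ hN] := lim0; exists N => m Nm.
  by have := hN m Nm; rewrite ger0_norm.
have cvgRe k : Re (c_ n k) @[n --> \oo] --> relim (fun n => Re (c_ n k)).
  have h : Re (c_ n k) @[n --> \oo] --> limn (fun n => Re (c_ n k)).
    apply: cauchy_seq_cvg => e /small[N hN]; exists N => m n Nm mn.
    apply: le_lt_trans (hN _ Nm); apply: le_trans (cau k _ _ mn).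
    by rewrite -ReN -ReD Re_le_cabs.
  by rewrite (cvg_relim h).
have cvgIm k : Im (c_ n k) @[n --> \oo] --> relim (fun n => Im (c_ n k)).
  have h : Im (c_ n k) @[n --> \oo] --> limn (fun n => Im (c_ n k)).
    apply: cauchy_seq_cvg => e /small[N hN]; exists N => m n Nm mn.
    apply: le_lt_trans (hN _ Nm); apply: le_trans (cau k _ _ mn).
    by rewrite -ImN -ImD Im_le_cabs.
  by rewrite (cvg_relim h).
move=> n; apply: (@Hnorm_lim _ _ (fun i => c_ i \- c_ n)) => //.
- move=> k; split.
    rewrite (_ : (fun i => _) = (fun i => Re (c_ i k) - Re (c_ n k))).
      by rewrite [X in _ --> X]ReD ReN; apply: cvgB; [exact: cvgRe|exact: cvg_cst].
    by apply/funext => i; rewrite ReD ReN.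
  rewrite (_ : (fun i => _) = (fun i => Im (c_ i k) - Im (c_ n k))).
    by rewrite [X in _ --> X]ImD ImN; apply: cvgB; [exact: cvgIm|exact: cvg_cst].
  by apply/funext => i; rewrite ImD ImN.
- by exists n => // i /= ni; rewrite -(subnKC ni).
Qed.

Section Picard.
Variables (P Gb : R) (phi : @pdist R) (g : R -> @pdist R).
Hypothesis phi0 : phi 0 = 0.
Hypothesis phiP : (Hnorm ell phi <= P%:E)%E.
Hypothesis gGb : bounded_path Gb g.
(** The bound for the solution of the linear problem; the ball has radius 2 m. On it the nonlinear
    term contributes at most 4 kappa m^2 / a, and the Lipschitz constant of the Duhamel map is 4
    kappa m / a. The condition 8 kappa m <= a makes the latter at most 1/2 and gives invariance as
    well. *)
Let m := P + Gb / a.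
Hypothesis small : 8 * quad_const ell * m <= a.

Let P0 : 0 <= P.
Proof. by rewrite -lee_fin (le_trans _ phiP)// Hnorm_ge0. Qed.

Let Gb0 : 0 <= Gb. Proof. exact: bounded_path_ge0 gGb. Qed.

Let m0 : 0 <= m. Proof. by rewrite addr_ge0// divr_ge0// ltW. Qed.

Definition picard_map U := duhamel phi (fun s => g s \- quad (U s)).

Definition picard n : R -> @pdist R := iter n picard_map (fun _ _ => 0).

Let kappa0 : 0 < quad_const ell := quad_const_gt0 ell.

Lemma bounded_path_picard_map U : bounded_path (2 * m) U ->
  bounded_path (2 * m) (picard_map U).
Proof.
move=> Um; have /(bounded_path_duhamel phi0 phiP) := bounded_pathB gGb (bounded_path_quad Um).
move=> [mD bD]; split => // s s0; have [D0 Ds] := bD s s0; split => //.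
apply: le_trans Ds _; rewrite lee_fin mulrDl addrA -/m mulr_natl mulr2n lerD2l.
rewrite ler_pdivrMr//; move: small kappa0; move: (quad_const ell) => kappa sm k0.
have : m * (8 * kappa * m) <= m * a by rewrite ler_wpM2l.
have : 0 <= kappa * m * m by rewrite !mulr_ge0// ltW.
lra.
Qed.

Lemma bounded_path_picard n : bounded_path (2 * m) (picard n).
Proof.
elim: n => [|n IH]; last exact: bounded_path_picard_map.
split => [b k|s s0]; first by split; exact: measurable_cst.
by rewrite Hnorm0 lee_fin mulr_ge0.
Qed.

Lemma picard_map_contract (d : R) U V :
  bounded_path (2 * m) U -> bounded_path (2 * m) V ->
  bounded_path d (fun s => U s \- V s) -> forall s, 0 <= s ->
  (Hnorm ell (picard_map U s \- picard_map V s)%R <= (d * 2^-1)%:E)%E.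
Proof.
move=> Um Vm UVd s s0; have d0 := bounded_path_ge0 UVd.
have gU := bounded_pathB gGb (bounded_path_quad Um).
have gV := bounded_pathB gGb (bounded_path_quad Vm).
rewrite (duhamelB phi gU gV s0).
have VU : bounded_path d (fun s => V s \- U s).
  have [mV _] := bounded_pathB Vm Um; split => // t t0.
  have [+ +] := UVd.2 t t0; rewrite Hnorm_subC; split => //.
  by have [/= -> _] := Vm.2 t t0; have [/= -> _] := Um.2 t t0; rewrite subr0.
have QVU := bounded_path_quadB Vm Um VU.
have -> : (fun s => (g s \- quad (U s)) \- (g s \- quad (V s))) =
    (fun s => quad (V s) \- quad (U s)).
  apply/funext => t; apply/funext => k /=.
  by rewrite opprB addrC subrKA.
apply: le_trans (Hnorm_convolution_le QVU s0) _; rewrite lee_fin ler_pdivrMr//.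
move: small; move: (quad_const ell) => kappa sm.
have : d * (8 * kappa * m) <= d * a by rewrite ler_wpM2l.
lra.
Qed.

Lemma picard_step n s : 0 <= s ->
  (Hnorm ell (picard n.+1 s \- picard n s)%R <= (2 * m * 2^-1 ^+ n)%:E)%E.
Proof.
elim: n s => [|n IH] s s0.
  rewrite expr0 mulr1 (_ : _ \- _ = picard 1 s).
    by have [_ /(_ s s0)[]] := bounded_path_picard 1.
  by apply/funext => k /=; rewrite subr0.
rewrite exprSr mulrA.
apply: (picard_map_contract (bounded_path_picard n.+1) (bounded_path_picard n) _ s0).
have [mD _] := bounded_pathB (bounded_path_picard n.+1) (bounded_path_picard n).
split => // t t0; split; last exact: IH.
have [/= -> _] := (bounded_path_picard n.+1).2 t t0.
by have [/= -> _] := (bounded_path_picard n).2 t t0; rewrite subr0.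
Qed.

Definition picard_lim s : @pdist R := fun k =>
  relim (fun n => Re (picard n s k)) +i* relim (fun n => Im (picard n s k)).

Lemma picard_lim_dist n s : 0 <= s ->
  (Hnorm ell (picard_lim s \- picard n s)%R <= (4 * m * 2^-1 ^+ n)%:E)%E.
Proof.
move=> s0; have -> : 4 * m = 2 * (2 * m) by ring.
apply: (@geometric_Hnorm_limit (fun n => picard n s)); first exact: mulr_ge0.
by move=> k; exact: picard_step.
Qed.

Lemma cvg_half_pow (d : R) : d * 2^-1 ^+ n @[n --> \oo] --> (0 : R).
Proof.
by rewrite -[X in _ --> X](mulr0 d); apply: cvgMl_tmp; apply: cvg_expr0; lra.
Qed.

Lemma bounded_path_picard_lim : bounded_path (2 * m) picard_lim.
Proof.
have cvg0 s : 0 <= s -> Hnorm ell (picard_lim s \- picard n s) @[n --> \oo] --> 0%E.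
  move=> s0; apply: (@squeeze_cvge _ _ _ _ (cst 0%E) _ (fun n => (4 * m * 2^-1 ^+ n)%:E)).
  - by apply: nearW => n; rewrite Hnorm_ge0 picard_lim_dist.
  - exact: cvg_cst.
  - apply: cvg_EFin; first exact: nearW.
    exact: cvg_half_pow.
split => [b k|s s0].
  by split; apply: measurable_relim => n; have [mp _] := bounded_path_picard n;
    have [] := mp b k.
split.
  have [h1 h2] := cvg_Hnorm_coef ell0 0 (cvg0 s s0).
  have z n : picard n s 0 = 0 by have [_ /(_ s s0)[]] := bounded_path_picard n.
  apply: eqC.
    by apply: (cvgr_unique h1); under eq_fun do rewrite z; exact: cvg_cst.
  by apply: (cvgr_unique h2); under eq_fun do rewrite z; exact: cvg_cst.
apply: (@Hnorm_lim _ _ (fun n => picard n s)); first exact: mulr_ge0.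
  by move=> k; apply: cvg_Hnorm_coef (cvg0 s s0).
by apply: nearW => n; have [_ /(_ s s0)[]] := bounded_path_picard n.
Qed.

(** The limit and its image under the map are both close to the same iterate n + 1, the image by
    contraction from the n-th iterate, so their distance is smaller than every bound in n. *)
Lemma picard_fixpoint s : 0 <= s ->
  picard_lim s = duhamel phi (fun t => g t \- quad (picard_lim t)) s.
Proof.
move=> s0; have UB := bounded_path_picard_lim.
have le n : (Hnorm ell (picard_map picard_lim s \- picard_lim s)%R <=
    (8 * m * 2^-1 ^+ n)%:E)%E.
  apply: le_trans (Hnorm_sub_triangle _ _ (picard n.+1 s) _) _.
  have dn : bounded_path (4 * m * 2^-1 ^+ n) (fun s => picard_lim s \- picard n s).
    have [mD _] := bounded_pathB UB (bounded_path_picard n).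
    split => // t t0; split; last exact: picard_lim_dist.
    have [/= -> _] := UB.2 t t0.
    by have [/= -> _] := (bounded_path_picard n).2 t t0; rewrite subr0.
  apply: le_trans (leeD (picard_map_contract UB (bounded_path_picard n) dn s0) _) _.
    by rewrite Hnorm_subC; exact: picard_lim_dist.
  rewrite -EFinD lee_fin exprSr; set x := 2^-1 ^+ n.
  have : 0 <= m * x by rewrite mulr_ge0// exprn_ge0// invr_ge0.
  lra.
have /(Hnorm_eq0 ell0) : Hnorm ell (picard_map picard_lim s \- picard_lim s) = 0%E.
  apply/eqP; rewrite eq_le Hnorm_ge0 andbT.
  have h : (8 * m * 2^-1 ^+ n)%:E @[n --> \oo] --> (0 : \bar R).
    by apply: cvg_EFin; [exact: nearW|exact: cvg_half_pow].
  rewrite -(cvg_lim _ h)//; apply: lime_ge; first by apply/cvg_ex; exists 0%E.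
  exact: nearW.
move=> e; apply/funext => k; apply/eqP; rewrite eq_sym -subr_eq0; apply/eqP.
by move/(congr1 (@^~ k)): e.
Qed.

End Picard.

End Duhamel.

(** * Coefficient paths of mild solutions and their uniqueness *)

Section MildPath.
Context {R : realType}.
Local Notation mu := (@lebesgue_measure R).
Variables (ell beta gamma : R).
Hypothesis ell0 : 0 <= ell.
Implicit Types (N : set (measurableTypeR R)) (F V : R -> @pdist R) (k : int).
Implicit Types (c v w phi : @pdist R) (s t : R).

Local Notation "S_[ t ]" := (expA beta gamma t) (at level 0).

(** The mild formulation on coefficients alone. F stands for the forcing after the resolvent has
    been applied, and [quad] already contains the resolvent of the convection term. *)
Definition mild_path phi F V t := Hdist0 ell (V t) /\
  exists2 w, is_bochner_integral ell `[0, t]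
    (fun s => S_[t - s] (F s \- quad (V s))) w & V t = S_[t] phi \+ w.

(** The symbol of A is bounded, so the estimate holds for negative times as well; the backward
    evolution in [mild_path_duhamel] relies on this. *)
Lemma Hnorm_expA_growth t v :
  (Hnorm ell (S_[t] v) <=
    (expR (`|t| * (1 + `|beta| + `|gamma|)))%:E * Hnorm ell v)%E.
Proof.
apply: Hnorm_le; first exact: expR_ge0.
move=> k; rewrite sqnormcM sqnormc_cexp ler_wpM2r ?sqnormc_ge0//.
rewrite ler_sqr ?nnegrE ?expR_ge0// ler_expR ReCM (le_trans (ler_norm _))// normrM.
by rewrite ler_wpM2l//; have [] := symA_le beta gamma k.
Qed.

Lemma expA_cut N F (r : R -> R) t : S_[r t] (cut N F t) = cut N (fun s => S_[r s] (F s)) t.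
Proof.
rewrite /cut; case: ifP => // _.
by apply/funext => k; rewrite /expA mulr0.
Qed.

(* As the expA form a group, the Bochner integral at the single time t1 controls
   those at all t <= t1, with one null set. *)
Lemma mild_path_duhamel phi F V t1 : 0 <= t1 ->
  (forall t, 0 <= t -> mild_path phi F V t) ->
  exists N, [/\ measurable N, mu N = 0,
    coef_measurable `[0, t1] (cut N (fun s => F s \- quad (V s))),
    (\int[mu]_(s in `[0%R, t1]) Hnorm ell (cut N (fun s => F s \- quad (V s))%R s) < +oo)%E &
    forall t, 0 <= t <= t1 ->
      (forall k, cintegrable `[0, t]
         (fun s => S_[t - s] (cut N (fun s => F s \- quad (V s)) s) k)) /\
      V t = duhamel beta gamma phi (cut N (fun s => F s \- quad (V s))) t].
Proof.
move=> t10 Vm; set H := fun s => F s \- quad (V s).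
have [_ [w1 w1b _]] := Vm t1 t10.
have [|N [mN N0 mE Efin iE]] := bochner_integral_coef ell0 _ w1b; first exact: measurable_itv.
set E := cut N (fun s => S_[t1 - s] (H s)) in mE Efin iE.
(* Evolving back by s - t1 recovers the integrand before propagation, so a single cut serves all t
   <= t1. *)
have HE s : cut N H s = S_[s - t1] (E s).
  rewrite /E -(expA_cut N H (fun s => t1 - s)) -expAD addrA subrK subrr.
  by apply/funext => k; rewrite /expA mul0r cexp0 mul1r.
have HEt t s : S_[t - s] (cut N H s) = S_[t - t1] (E s).
  by rewrite HE -expAD addrA subrK.
have mH : coef_measurable `[0, t1] (cut N H).
  rewrite (_ : cut N H = fun s => S_[s - t1] (E s)); last exact/funext.
  move=> k.
  have e s : cexp ((s - t1)%:C * symA beta gamma k) =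
      cexp ((t1 - s)%:C * - symA beta gamma k).
    by rewrite mulrN -mulNr -rmorphN/= opprB.
  suff : cmeasurable `[0, t1] (fun s => S_[s - t1] (E s) k) by [].
  rewrite (_ : (fun s => _) =
      (fun s => cexp ((t1 - s)%:C * - symA beta gamma k) * E s k)).
    by apply: cmeasurableM; [exact: cmeasurable_cexp|exact: mE].
  by apply/funext => s; rewrite /expA e.
exists N; split => //.
  set C := expR (t1 * (1 + `|beta| + `|gamma|)).
  apply: (@le_lt_trans _ _ (C%:E * \int[mu]_(s in `[0%R, t1]) Hnorm ell (E s))%E); last first.
    by rewrite lte_mul_pinfty// lee_fin expR_ge0.
  rewrite -ge0_integralZl//; last 3 first.
  - exact: measurable_Hnorm.
  - by move=> s _; exact: Hnorm_ge0.
  - by rewrite lee_fin expR_ge0.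
  apply: ge0_le_integral => //.
  - by move=> s _; exact: Hnorm_ge0.
  - exact: measurable_Hnorm.
  - by apply: emeasurable_funM; [exact: measurable_cst|exact: measurable_Hnorm].
  move=> s; rewrite /= in_itv/= => /andP[s0 st1]; rewrite HE.
  apply: le_trans (Hnorm_expA_growth _ _) _.
  rewrite lee_wpmul2r ?Hnorm_ge0// lee_fin ler_expR ler_wpM2r ?addr_ge0//.
  by rewrite distrC ger0_norm ?subr_ge0// gerBl.
move=> t /andP[t0 tt1].
have sub : (`[0, t]%classic : set R) `<=` `[0, t1]%classic.
  by apply: subset_itvl; rewrite bnd_simp.
have iEt k : cintegrable `[0, t] (fun s => E s k).
  have [[i1 i2] _] := iE k; split; [move: i1|move: i2]; apply: integrableS => //.
have iHt k : cintegrable `[0, t] (fun s => S_[t - s] (cut N H s) k).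
  rewrite (_ : (fun s => _) = (fun s => S_[t - t1] (E s) k)).
    exact: cintegrableZ.
  by apply/funext => s; rewrite HEt.
split => //.
(* The integral at time t brings its own null set N'. Both cuts agree almost everywhere with the
   uncut integrand, so the coefficient integrals coincide and N' drops out. *)
have [_ [w wb Vt]] := Vm t t0.
have [|N' [mN' N'0 mE' _ iE']] := bochner_integral_coef ell0 _ wb; first exact: measurable_itv.
rewrite Vt /duhamel; congr (_ \+ _); apply/funext => k.
have [iw ->] := iE' k; apply: ae_eq_cintegral;
  [exact: measurable_itv|exact: cintegrable_cmeasurable|exact: cintegrable_cmeasurable|].
have h1 := ae_cut (fun s => S_[t - s] (H s)) `[0, t]%classic mN' N'0.
have h2 := ae_cut (fun s => S_[t - s] (H s)) `[0, t]%classic mN N0.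
apply: filterS2 h1 h2 => s e1 e2 st.
by rewrite -(e1 st) (e2 st) (expA_cut N H (fun s => t - s)).
Qed.

Lemma mild_path_bounded phi F V t1 : 0 <= t1 -> (Hnorm ell phi < +oo)%E ->
  (forall t, 0 <= t -> mild_path phi F V t) ->
  exists2 B : R, 0 <= B & forall t, 0 <= t <= t1 -> (Hnorm ell (V t) <= B%:E)%E.
Proof.
move=> t10 phifin Vm; have [N [mN N0 mH Hfin VD]] := mild_path_duhamel t10 Vm.
set H := cut N _ in mH Hfin VD.
set C := expR (t1 * (1 + `|beta| + `|gamma|)).
have C0 : 0 <= C by exact: expR_ge0.
have grow r v : 0 <= r <= t1 -> (Hnorm ell (S_[r] v) <= C%:E * Hnorm ell v)%E.
  move=> /andP[r0 rt]; apply: le_trans (Hnorm_expA_growth _ _) _.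
  rewrite lee_wpmul2r ?Hnorm_ge0// lee_fin ler_expR ler_wpM2r ?addr_ge0//.
  by rewrite ger0_norm.
set I := (\int[mu]_(s in `[0%R, t1]) Hnorm ell (H s))%E in Hfin.
have I0 : (0 <= I)%E by apply: integral_ge0 => s _; exact: Hnorm_ge0.
have If : I \is a fin_num by rewrite ge0_fin_numE.
have phif : Hnorm ell phi \is a fin_num by rewrite ge0_fin_numE// Hnorm_ge0.
exists (C * fine (Hnorm ell phi) + C * fine I).
  by rewrite addr_ge0// mulr_ge0// fine_ge0// Hnorm_ge0.
move=> t t0t1; have /andP[t0 tt1] := t0t1.
have sub : (`[0, t]%classic : set R) `<=` `[0, t1]%classic.
  by apply: subset_itvl; rewrite bnd_simp.
have [iH ->] := VD t t0t1.
apply: le_trans (HnormD _ _ _) _; rewrite EFinD !EFinM !fineK//; apply: leeD.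
  exact: grow.
have mHt : coef_measurable `[0, t] H.
  by move=> k; have [m1 m2] := mH k; split; apply: measurable_funS sub _.
apply: le_trans (Hnorm_cintegral_le _ (measurable_itv _) iH) _.
apply: (@le_trans _ _ (C%:E * \int[mu]_(s in `[0%R, t]) Hnorm ell (H s))%E); last first.
  apply: lee_wpmul2l; first by rewrite lee_fin.
  apply: ge0_subset_integral => //; last by move=> s _; exact: Hnorm_ge0.
  exact: measurable_Hnorm.
rewrite -ge0_integralZl//; last 2 first.
- exact: measurable_Hnorm.
- by move=> s _; exact: Hnorm_ge0.
apply: ge0_le_integral => //.
- by move=> s _; exact: Hnorm_ge0.
- by apply: measurable_Hnorm; exact: coef_measurable_expA.
- by apply: emeasurable_funM; [exact: measurable_cst|exact: measurable_Hnorm].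
move=> s; rewrite /= in_itv/= => /andP[s0 st]; apply: grow.
by rewrite subr_ge0 st/= (le_trans _ tt1)// gerBl.
Qed.

Lemma integral_exp_growth (b t : R) : 0 < b -> 0 <= t ->
  (\int[mu]_(s in `[0%R, t]) (expR (b * s))%:E <= (expR (b * t) / b)%:E)%E.
Proof.
move=> b0 t0.
have e s : (expR (b * s))%:E = ((expR (b * t))%:E * (expR (- (b * (t - s))))%:E)%E.
  by rewrite -EFinM -expRD; congr (expR _)%:E; ring.
under eq_integral do rewrite e.
rewrite ge0_integralZl//; last first.
  apply/measurable_EFinP; apply: measurable_funTS.
  apply: continuous_measurable_fun => s; apply: continuous_comp; last exact: continuous_expR.
  apply: cvgN; apply: cvgMl_tmp; apply: cvgB; [exact: cvg_cst|exact: cvg_id].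
by rewrite EFinM lee_wpmul2l ?lee_fin ?expR_ge0// integral_exp_decay.
Qed.

(* The difference of two solutions bounded by B1 and B2 on [0, t1] is contracted
   by 1/2 in the norm weighted with exp (- lam t). *)
Lemma mild_path_unique phi F V1 V2 : (Hnorm ell phi < +oo)%E ->
  (forall t, 0 <= t -> mild_path phi F V1 t) ->
  (forall t, 0 <= t -> mild_path phi F V2 t) ->
  forall t, 0 <= t -> V1 t = V2 t.
Proof.
move=> phifin Vm1 Vm2 t1 t10.
have [N1 [mN1 N10 mH1 _ VD1]] := mild_path_duhamel t10 Vm1.
have [N2 [mN2 N20 mH2 _ VD2]] := mild_path_duhamel t10 Vm2.
have [B1 B10 V1B] := mild_path_bounded t10 phifin Vm1.
have [B2 B20 V2B] := mild_path_bounded t10 phifin Vm2.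
set H1 := cut N1 _ in mH1 VD1; set H2 := cut N2 _ in mH2 VD2.
set B := B1 + B2; have B0 : 0 <= B by exact: addr_ge0.
set C := expR (t1 * (1 + `|beta| + `|gamma|)).
have C0 : 0 <= C by exact: expR_ge0.
set kappa := quad_const ell; have k0 : 0 < kappa by exact: quad_const_gt0.
(* The integrand has Lipschitz constant C kappa B and integrating the weight costs 1 / lam, so this
   choice contracts by 1/2; the 1 keeps lam positive when B = 0. *)
set lam := 2 * (C * kappa * B) + 1.
have CkB0 : 0 <= C * kappa * B by rewrite !mulr_ge0// ltW.
have lam0 : 0 < lam by rewrite ltr_wpDl// mulr_ge0.
have diff n t : 0 <= t <= t1 ->
    (Hnorm ell (V1 t \- V2 t)%R <= (B * 2^-1 ^+ n * expR (lam * t))%:E)%E.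
  elim: n t => [|n IH] t /[dup] t0t1 /andP[t0 tt1].
    rewrite expr0 mulr1; apply: le_trans (HnormB _ _ _) _.
    apply: le_trans (leeD (V1B t t0t1) (V2B t t0t1)) _.
    by rewrite -EFinD lee_fin ler_peMr// -(expR0 R) ler_expR mulr_ge0// ltW.
  have sub : (`[0, t]%classic : set R) `<=` `[0, t1]%classic.
    by apply: subset_itvl; rewrite bnd_simp.
  have [iH1 VE1] := VD1 t t0t1; have [iH2 VE2] := VD2 t t0t1.
  pose K s := H1 s \- H2 s.
  have mK : coef_measurable `[0, t] K.
    apply: coef_measurableB => k; [have [m1 m2] := mH1 k|have [m1 m2] := mH2 k];
      by split; apply: measurable_funS sub _.
  have VE : V1 t \- V2 t = fun k => cintegral `[0, t] (fun s => S_[t - s] (K s) k).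
    rewrite VE1 VE2; apply/funext => k; rewrite /duhamel/= opprD addrACA subrr add0r.
    rewrite /convolution -cintegralB//; apply: eq_cintegral => s _.
    by rewrite expAB.
  have iK k : cintegrable `[0, t] (fun s => S_[t - s] (K s) k).
    rewrite (_ : (fun s => _) = (fun s => S_[t - s] (H1 s) k - S_[t - s] (H2 s) k)).
      exact: cintegrableB.
    by apply/funext => s; rewrite expAB.
  rewrite VE; apply: le_trans (Hnorm_cintegral_le _ (measurable_itv _) iK) _.
  pose c := C * kappa * B * (B * 2^-1 ^+ n).
  have c0 : 0 <= c by rewrite /c; apply: mulr_ge0 => //; rewrite mulr_ge0// exprn_ge0// invr_ge0.
  have mexp : measurable_fun (`[0, t]%classic : set (measurableTypeR R))
      (fun s => (expR (lam * s))%:E).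
    apply/measurable_EFinP; apply: measurable_funTS.
    apply: continuous_measurable_fun => s; apply: continuous_comp; last exact: continuous_expR.
    by apply: cvgMl_tmp; exact: cvg_id.
  apply: (@le_trans _ _ (\int[mu]_(s in `[0%R, t]) (c%:E * (expR (lam * s))%:E))%E).
    apply: ae_ge0_le_integral => //.
    - by move=> s _; exact: Hnorm_ge0.
    - by apply: measurable_Hnorm; exact: coef_measurable_expA.
    - by move=> s _; rewrite mule_ge0 ?lee_fin ?expR_ge0.
    - by apply: emeasurable_funM; [exact: measurable_cst|exact: mexp].
    have h1 := ae_cut (fun s => F s \- quad (V1 s)) `[0, t]%classic mN1 N10.
    have h2 := ae_cut (fun s => F s \- quad (V2 s)) `[0, t]%classic mN2 N20.
    apply: filterS2 h1 h2 => s e1 e2 st.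
    have s0t1 : 0 <= s <= t1.
      by move: st; rewrite /= in_itv/= => /andP[-> st]; rewrite (le_trans st).
    have /andP[s0 st1] := s0t1.
    have ts : s <= t by move: st; rewrite /= in_itv/= => /andP[].
    have -> : K s = quad (V2 s) \- quad (V1 s).
      rewrite /K /H1 /H2 -(e1 st) -(e2 st); apply/funext => k /=.
      by rewrite opprB addrC subrKA.
    apply: le_trans (Hnorm_expA_growth _ _) _.
    rewrite ger0_norm ?subr_ge0//.
    rewrite -EFinM (_ : c * _ = C * (kappa * ((B * 2^-1 ^+ n * expR (lam * s)) * B))); last first.
      by rewrite /c; ring.
    rewrite EFinM; apply: lee_pmul; rewrite ?Hnorm_ge0 ?lee_fin ?expR_ge0//.
      by rewrite ler_expR ler_wpM2r ?addr_ge0// (le_trans _ tt1)// gerBl.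
    apply: Hnorm_quadB => //.
    - by rewrite mulr_ge0 ?expR_ge0// mulr_ge0// exprn_ge0// invr_ge0.
    - by apply: le_lt_trans (V2B s s0t1) _; rewrite ltry.
    - by apply: le_lt_trans (V1B s s0t1) _; rewrite ltry.
    - by rewrite Hnorm_subC; exact: IH.
    - apply: le_trans (HnormD _ _ _) _; rewrite addeC EFinD.
      exact: leeD (V1B s s0t1) (V2B s s0t1).
  rewrite ge0_integralZl//.
  apply: (@le_trans _ _ (c%:E * (expR (lam * t) / lam)%:E)%E).
    by apply: lee_wpmul2l; [rewrite lee_fin|exact: integral_exp_growth].
  rewrite -EFinM lee_fin [leLHS]mulrA ler_pdivrMr// exprSr /c.
  set x := 2^-1 ^+ n; set e := expR _.
  have x0 : 0 <= B * x * e by rewrite mulr_ge0 ?expR_ge0// mulr_ge0// exprn_ge0// invr_ge0.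
  have : C * kappa * B * 2 * (B * x * e) <= lam * (B * x * e).
    by rewrite ler_wpM2r// /lam; lra.
  lra.
have e0 : Hnorm ell (V1 t1 \- V2 t1) = 0%E.
  apply/eqP; rewrite eq_le Hnorm_ge0 andbT.
  have h : (B * expR (lam * t1) * 2^-1 ^+ n)%:E @[n --> \oo] --> (0 : \bar R).
    by apply: cvg_EFin; [exact: nearW|exact: cvg_half_pow].
  rewrite -(cvg_lim _ h)//; apply: lime_ge; first by apply/cvg_ex; exists 0%E.
  by apply: nearW => n; rewrite mulrAC; apply: diff; rewrite t10 lexx.
apply/funext => k; apply/eqP; rewrite -subr_eq0; apply/eqP.
by have /(congr1 (@^~ k)) := Hnorm_eq0 ell0 e0.
Qed.

End MildPath.

(** * Passage between mild solutions and coefficient paths *)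

Section MildSolutions.
Context {R : realType}.
Local Notation mu := (@lebesgue_measure R).
Local Notation Re := complex.Re.
Local Notation Im := complex.Im.
Variables (ell beta gamma : R).
Hypothesis ell0 : 0 <= ell.
Implicit Types (D N : set (measurableTypeR R)) (F G : R -> @pdist R) (k : int).
Implicit Types (w : @pdist R) (s t : R).

(** Measurability of G makes the error norms with G measurable, and [ae_le_lower_integral] then
    bounds the integrals of the possibly nonmeasurable error norms with F. *)
Lemma is_bochner_integral_ae D F G w : measurable D -> coef_measurable D G ->
  {ae mu, forall t, D t -> F t = G t} ->
  is_bochner_integral ell D G w -> is_bochner_integral ell D F w.
Proof.
move=> mD mG FG [s [sG iG wG]]; exists s; split => //.
  apply: (@filterS2 _ _ (ae_filter_ringOfSetsType mu) _ _ _ _ FG sG) => t FGt sGt Dt.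
  by rewrite FGt//; exact: sGt.
apply: (@squeeze_cvge _ _ _ _ (cst 0%E) _ _ _ _ (cvg_cst _) iG).
apply: nearW => n; rewrite integral_ge0 => [|t _]; last exact: Hnorm_ge0.
apply: ae_le_lower_integral => //; try by move=> t _; exact: Hnorm_ge0.
  by apply: measurable_Hnorm; apply: coef_measurableB => //; exact: coef_measurable_simple.
by apply: (@filterS _ _ (ae_filter_ringOfSetsType mu) _ _ _ FG) => t FGt Dt; rewrite FGt.
Qed.

Lemma eq_is_bochner_integral D F G w : (forall t, D t -> F t = G t) ->
  is_bochner_integral ell D G w -> is_bochner_integral ell D F w.
Proof.
move=> FG [s [sG iG wG]]; exists s; split => //.
  apply: (@filterS _ _ (ae_filter_ringOfSetsType mu) _ _ _ sG) => t sGt Dt.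
  by rewrite FG//; exact: sGt.
rewrite (_ : (fun n => _) = (fun n => \int[mu]_(t in D) Hnorm ell (G t \- sf_val (s n) t)%R)%E)//.
by apply/funext => n; apply: eq_integral => t /set_mem Dt; rewrite FG.
Qed.

Lemma coef_measurable_cut D N F : measurable N -> coef_measurable D F ->
  coef_measurable D (cut N F).
Proof.
move=> mN mF k; have [m1 m2] := mF k.
have mi : measurable_fun D (\1_(~` N) : R -> R).
  by apply: measurable_funTS; apply: measurable_indic; exact: measurableC.
split.
  rewrite (_ : (fun t => _) = (fun t => \1_(~` N) t * Re (F t k))); first exact: measurable_funM.
  apply/funext => t; rewrite /cut indicE in_setC.
  by case: (t \in N); rewrite /= ?mul0r ?mul1r.
rewrite (_ : (fun t => _) = (fun t => \1_(~` N) t * Im (F t k))); first exact: measurable_funM.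
apply/funext => t; rewrite /cut indicE in_setC.
by case: (t \in N); rewrite /= ?mul0r ?mul1r.
Qed.

(** The cuts remove the times where F is not a limit of simple functions and those exceeding the
    essential supremum. Measurability comes from H^ell, the bound from H^{ell-2}, which the
    resolvent lifts to H^ell. *)
Lemma forcing_path F (M : R) : 0 <= M -> (forall t, 0 <= t -> F t 0 = 0) ->
  strongly_measurable ell `[0, +oo[ F ->
  (Linfty_norm (ell - 2) `[0%R, +oo[ F <= M%:E)%E ->
  exists g, bounded_path ell M g /\
    {ae mu, forall s, 0 <= s -> resolvent (F s) = g s}.
Proof.
move=> M0 F0 [s sF] /ess_supP FM.
have [|N1 [mN1 N10 mF]] := ae_approx_coef_measurable ell0 _ sF; first exact: measurable_itv.
have [N2 [mN2 N20 FN2]] := FM.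
have F2 t : 0 <= t -> t \notin N2 -> (Hnorm (ell - 2) (F t) <= M%:E)%E.
  move=> t0 tN; apply: contrapT => tM; move/negP: tN; apply; rewrite inE; apply: FN2.
  by rewrite /= patchE mem_set//= in_itv/= t0.
exists (fun t => resolvent (cut N2 (cut N1 F) t)); split; first split => [b|t t0].
- apply: coef_measurable_resolvent; apply: coef_measurable_cut => // k.
  have [m1 m2] := mF k.
  have sub : (`[0, b]%classic : set R) `<=` `[0, +oo[%classic.
    by apply: subset_itvl; rewrite bnd_simp.
  by split; apply: measurable_funS sub _.
- rewrite Hnorm_resolvent /resolvent /cut; case: ifPn => tN2; rewrite ?mulr0 ?Hnorm0 ?lee_fin//.
  by case: ifPn => tN1; rewrite ?mulr0 ?Hnorm0 ?lee_fin// F0// mulr0; split => //; exact: F2.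
have h1 := ae_cut F setT mN1 N10; have h2 := ae_cut (cut N1 F) setT mN2 N20.
apply: (@filterS2 _ _ (ae_filter_ringOfSetsType mu) _ _ _ _ h1 h2) => t e1 e2 _.
by  rewrite -e2// -e1.
Qed.

(** By [fcoef_sqr] the convection term depends on u only through its coefficients, so its resolvent
    is [quad] of them. *)
Lemma mild_solution_path phi f u : mild_solution ell beta gamma phi f u ->
  forall t, 0 <= t -> mild_path ell beta gamma (fcoef phi)
    (fun s => resolvent (fcoef (f s))) (fun s => fcoef (u s)) t.
Proof.
move=> ms t t0; have [[_ _ _ ut] [w wb ww]] := ms t t0; split => //; exists w; last exact/funext.
apply: eq_is_bochner_integral wb => s; rewrite /= in_itv/= => /andP[s0 _].
have [us _] := ms s s0; congr (expA _ _ _ _); apply/funext => k /=.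
by rewrite -resolventB /convection (fcoef_sqr ell0 us).
Qed.

Lemma path_mild_solution phi f u :
  (forall t, 0 <= t -> Hper0 ell (u t) /\ mild_path ell beta gamma (fcoef phi)
    (fun s => resolvent (fcoef (f s))) (fun s => fcoef (u s)) t) ->
  mild_solution ell beta gamma phi f u.
Proof.
move=> mp t t0; have [ut [_ [w wb ww]]] := mp t t0; split => //; exists w; last by rewrite ww.
apply: eq_is_bochner_integral wb => s; rewrite /= in_itv/= => /andP[s0 _].
have [us _] := mp s s0; congr (expA _ _ _ _); apply/funext => k /=.
by rewrite -resolventB /convection (fcoef_sqr ell0 us).
Qed.

End MildSolutions.

(** * Norms in time *)

Section Norms.
Context {R : realType}.
Local Notation mu := (@lebesgue_measure R).
Variables (ell : R).
Implicit Types (F : R -> @pdist R).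

(** Meant for x the norm of phi, z the H^ell norm of f and y its smaller H^{ell-2} norm: smallness
    is assumed through z, while the real value of y enters the estimate. *)
Lemma fin_addends (x y z : \bar R) (d : R) : (0 <= x)%E -> (0 <= y)%E ->
  (y <= z)%E -> (x + z <= d%:E)%E ->
  exists p q : R, [/\ x = p%:E, y = q%:E, 0 <= p, 0 <= q & p + q <= d].
Proof.
move=> x0 y0 yz xzd; have xyd := le_trans (leeD2l x yz) xzd.
have xf : x \is a fin_num.
  by rewrite ge0_fin_numE// (le_lt_trans _ (ltry d))// (le_trans _ xyd)// leeDl.
have yf : y \is a fin_num.
  by rewrite ge0_fin_numE// (le_lt_trans _ (ltry d))// (le_trans _ xyd)// leeDr.
exists (fine x), (fine y); rewrite !fineK//; split=> //; try exact: fine_ge0.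
by rewrite -lee_fin EFinD !fineK.
Qed.

Lemma Linfty_norm_le D F (M : R) : 0 <= M ->
  (forall t, D t -> (Hnorm ell (F t) <= M%:E)%E) -> (Linfty_norm ell D F <= M%:E)%E.
Proof.
move=> M0 FM; apply/ess_supP; apply: nearW => t; rewrite patchE.
by case: ifPn => [/set_mem/FM//|_]; rewrite lee_fin.
Qed.

Lemma Linfty_norm_ge0 D F : (0 <= Linfty_norm ell D F)%E.
Proof.
apply: ess_sup_gee.
  have := @lebesgue_measure_itv R `]-oo, +oo[%R.
  by rewrite set_itvNyy/= => ->; rewrite ltry.
by apply: nearW => t; rewrite patchE; case: ifPn => // _; exact: Hnorm_ge0.
Qed.

Lemma Linfty_norm_mono (ell' : R) D F : ell <= ell' ->
  (Linfty_norm ell D F <= Linfty_norm ell' D F)%E.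
Proof.
move=> le; apply: le_ess_sup; apply: nearW => t; rewrite !patchE.
by case: ifPn => // _; exact: Hnorm_mono.
Qed.

Lemma L2_norm_le (tau T M : R) F : 0 <= M -> 0 <= T ->
  (forall t, tau <= t <= tau + T -> (Hnorm ell (F t) <= M%:E)%E) ->
  (L2_norm ell `[tau, (tau + T)%R] F <= (M * Num.sqrt T)%:E)%E.
Proof.
move=> M0 T0 FM; rewrite /L2_norm.
have muT : mu `[tau, (tau + T)%R] = T%:E.
  have := @lebesgue_measure_itv R `[tau, (tau + T)%R]%R; rewrite /= => ->.
  rewrite lte_fin ltrDl; case: ltP => [_|T0']; first by rewrite -EFinD addrAC subrr add0r.
  by congr EFin; apply/eqP; rewrite eq_le T0 T0'.
have le : (\int[mu]_(t in `[tau, (tau + T)%R]) (Hnorm ell (F t) ^+ 2) <= (M ^+ 2 * T)%:E)%E.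
  rewrite EFinM -muT -integral_cst//.
  apply: ae_le_lower_integral => //.
  - by move=> t _; rewrite expe_ge0 ?Hnorm_ge0.
  - by move=> t _; rewrite lee_fin sqr_ge0.
  apply: nearW => t; rewrite /= in_itv/= => tT.
  by rewrite EFin_expe lee_sqr ?Hnorm_ge0 ?FM.
have -> : (M * Num.sqrt T)%:E = ((M ^+ 2 * T)%:E `^ 2^-1)%E.
  by rewrite poweR_EFin powR12_sqrt ?mulr_ge0 ?sqr_ge0// sqrtrM ?sqr_ge0// sqrtr_sqr ger0_norm.
apply: gt0_ler_poweR => //; rewrite in_itv/= leey andbT.
  by apply: integral_ge0 => t _; exact: sqre_ge0.
by rewrite lee_fin mulr_ge0 ?sqr_ge0.
Qed.

Lemma Ynorm_le (tau T M : R) F : 0 <= M -> 0 <= T ->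
  (forall t, tau <= t <= tau + T -> (Hnorm ell (F t) <= M%:E)%E) ->
  (Ynorm ell tau T F <= (M * (1 + Num.sqrt T))%:E)%E.
Proof.
move=> M0 T0 FM; rewrite mulrDr mulr1 EFinD; apply: leeD; last exact: L2_norm_le.
by apply: ge_ereal_sup => _ [t /= + <-]; rewrite in_itv/=; exact: FM.
Qed.

End Norms.

Theorem theorem1p3 (R : realType) (ell beta gamma T : R)
    (ell_ge0 : 0 <= ell)
    (gamma_gt : Num.max 0 (- (beta / (4 * pi ^+ 2))) < gamma)
    (T_gt0 : 0 < T) :
  exists2 delta : R, 0 < delta &
  forall tau : R, 0 < tau ->
  exists2 C : R, 0 < C &
  forall (phi : R -> R[i]) (f : R -> R -> R[i]),
    Hper0 ell phi ->
    (forall t, 0 <= t -> Hper0 ell (f t)) ->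
    in_Linfty ell `[0%R, +oo[ (fun t => fcoef (f t)) ->
    (Hnorm ell (fcoef phi) +
      Linfty_norm ell `[0%R, +oo[ (fun t => fcoef (f t)) <= delta%:E)%E ->
    let solution (u : R -> R -> R[i]) :=
      [/\ in_Linfty ell `[tau, (tau + T)%R] (fun t => fcoef (u t)),
          in_L2 ell `[tau, (tau + T)%R] (fun t => fcoef (u t)) &
          mild_solution ell beta gamma phi f u] in
    exists u : R -> R -> R[i],
      [/\ solution u,
          forall v, solution v ->
            forall t, 0 <= t ->
              {ae lebesgue_measure, forall x, u t x = v t x} &
          (Ynorm ell tau T (fun t => fcoef (u t)) <=
            C%:E * (Hnorm ell (fcoef phi) +
              Linfty_norm (ell - 2) `[0%R, +oo[ (fun t => fcoef (f t))))%E].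
Proof.
have [a a0 decay] := symA_decay gamma_gt.
set kappa := quad_const ell; have k0 : 0 < kappa by exact: quad_const_gt0.
(* One factor for both data: P + Gb / a <= K (P + Gb). *)
set K := Num.max 1 a^-1.
have K1 : 1 <= K by rewrite le_max lexx.
have Ka : a^-1 <= K by rewrite le_max lexx orbT.
have K0 : 0 < K by exact: lt_le_trans K1.
(* Data of total size at most this satisfy 8 kappa (P + Gb / a) <= a, the condition of the Picard
   iteration; neither tau nor T enters. *)
exists (a / (8 * kappa * K)); first by rewrite divr_gt0// mulr_gt0// mulr_gt0.
(* The solution stays in the ball of radius 2 (P + Gb / a) <= 2 K (P + Gb); a window of length T
   contributes 1 through the supremum and sqrt T through the L^2 part. *)
move=> tau tau0; exists (2 * K * (1 + Num.sqrt T)).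
  by rewrite mulr_gt0 ?mulr_gt0// ltr_wpDr// sqrtr_ge0.
move=> phi f Hphi Hf [sf _] fsmall solution.
set F := fun t => fcoef (f t).
have [_ _ _ [phifin phi0]] := Hphi.
have LbL : (Linfty_norm (ell - 2) `[0%R, +oo[ F <= Linfty_norm ell `[0%R, +oo[ F)%E.
  by apply: Linfty_norm_mono; rewrite gerBl.
have [P [Gb [phiP LbE P0 Gb0 PGb]]] :=
  fin_addends (Hnorm_ge0 _ _) (Linfty_norm_ge0 (ell - 2) _ F) LbL fsmall.
have m0 : 0 <= P + Gb / a by rewrite addr_ge0// divr_ge0// ltW.
have mK : P + Gb / a <= K * (P + Gb).
  by rewrite mulrDr lerD// ?ler_peMl// mulrC ler_wpM2r.
have small : 8 * kappa * (P + Gb / a) <= a.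
  apply: le_trans (_ : 8 * kappa * (K * (P + Gb)) <= _).
    by rewrite ler_wpM2l// mulr_ge0// ltW.
  by rewrite mulrA mulrC -ler_pdivlMr// !mulr_gt0.
have F0 t : 0 <= t -> F t 0 = 0 by move=> /Hf[_ _ _ []].
have [|g [gG Fg]] := forcing_path ell_ge0 Gb0 F0 sf; first by rewrite LbE.
have phile : (Hnorm ell (fcoef phi) <= P%:E)%E by rewrite phiP.
pose U := picard_lim beta gamma (fcoef phi) g.
have UB := bounded_path_picard_lim ell_ge0 a0 decay phi0 phile gG small.
have UE t := picard_fixpoint ell_ge0 a0 decay phi0 phile gG small (s := t).
rewrite -/U in UB UE.
have UH t : 0 <= t -> Hdist0 ell (U t).
  by move=> t0; split; [exact: bounded_path_fin UB t0|have [] := UB.2 t t0].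
(* Representatives are chosen separately at each time, with default 0 at negative times: the
   equation and the norms see u only through its coefficients, those of its square included. *)
have /choice[u uP] : forall t, exists u : R -> R[i], 0 <= t -> Hper0 ell u /\ fcoef u = U t.
  move=> t; have [t0|t0] := leP 0 t; last by exists 0.
  by have [u uP] := Hper0_rep ell_ge0 (UH t t0); exists u.
have uU t (t0 : 0 <= t) : fcoef (u t) = U t by have [] := uP t t0.
set D : set (measurableTypeR R) := `[tau, (tau + T)%R]%classic.
have D0 t : D t -> 0 <= t.
  by rewrite /D/= in_itv/= => /andP[h _]; rewrite (le_trans _ h)// ltW.
have uB t : D t -> (Hnorm ell (fcoef (u t)) <= (2 * (P + Gb / a))%:E)%E.
  by move=> /D0 t0; rewrite uU//; have [] := UB.2 t t0.
have mu2 : 0 <= 2 * (P + Gb / a) by rewrite mulr_ge0.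
have smu : strongly_measurable ell D (fun t => fcoef (u t)).
  apply: (strongly_measurable_bounded ell_ge0 (M := 2 * (P + Gb / a))).
  - exact: measurable_itv.
  - have := @lebesgue_measure_itv R `[tau, (tau + T)%R]%R; rewrite /= => e.
    by rewrite [X in (X < _)%E]e; case: ifP => _; rewrite ltry.
  - move=> k; have [m1 m2] := UB.1 (tau + T) k.
    have sub : D `<=` `[0, tau + T]%classic.
      by apply: subset_itvr; rewrite bnd_simp ltW.
    by split; [apply: eq_measurable_fun (measurable_funS _ sub m1)
              |apply: eq_measurable_fun (measurable_funS _ sub m2)] => // t /set_mem/D0/uU ->.
  - by move=> t Dt; split; [have [[_ _ _ []]] := uP t (D0 t Dt)|exact: uB].
have mild : mild_solution ell beta gamma phi f u.
  apply: path_mild_solution => // t t0; have [ut _] := uP t t0; split => //.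
  split; first by have [] := ut.
  exists (convolution beta gamma (fun s => g s \- quad (U s)) t); last by rewrite uU// UE.
  have GB := bounded_pathB gG (bounded_path_quad ell_ge0 UB).
  have [_] := bochner_evolved ell_ge0 a0 decay GB t0.
  (* The integral was built from the everywhere-defined path g; it is transferred to the given
     forcing, which agrees with g almost everywhere in time after the resolvent. *)
  apply: is_bochner_integral_ae; first exact: measurable_itv.
    by apply: coef_measurable_expA; [exact: measurable_itv|exact: GB.1].
  apply: (@filterS _ _ (ae_filter_ringOfSetsType lebesgue_measure) _ _ _ Fg) => s Fgs.
  by rewrite /= in_itv/= => /andP[s0 _]; rewrite -Fgs// uU.
exists u; split.
- split => //; split => //.
    by apply: le_lt_trans (Linfty_norm_le mu2 uB) _; rewrite ltry.
  by apply: le_lt_trans (L2_norm_le mu2 (ltW T_gt0) _) _; [exact: uB|rewrite ltry].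
- move=> v [_ _ vm] t t0.
  have [ut _] := mild t t0; have [vt _] := vm t t0.
  apply: Hper0_ae_unique ut vt _.
  exact: (mild_path_unique ell_ge0 phifin (mild_solution_path ell_ge0 mild)
    (mild_solution_path ell_ge0 vm)).
- apply: le_trans (Ynorm_le mu2 (ltW T_gt0) _) _; first exact: uB.
  rewrite phiP LbE -EFinD -EFinM lee_fin.
  have -> : 2 * K * (1 + Num.sqrt T) * (P + Gb) = 2 * (K * (P + Gb)) * (1 + Num.sqrt T).
    by ring.
  by rewrite ler_wpM2r ?addr_ge0 ?sqrtr_ge0// ler_wpM2l.
Qed.
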